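(* Let $H$ be a Hopf algebra with bijective antipode over a field $k$, and let $M$ be a stable anti-Yetter-Drinfeld module over $H$ (right $H$-module and left $H$-comodule version). (1) For every left $H$-module coalgebra $C$, the formulas $$\delta_i(m\otimes_H(c_0\otimes\dots\otimes c_{n-1}))=m\otimes_H(c_0\otimes\dots\otimes c_i^{(1)}\otimes c_i^{(2)}\otimes\dots\otimes c_{n-1}),\quad 0\le i<n,$$ $$\delta_n(m\otimes_H(c_0\otimes\dots\otimes c_{n-1}))=m^{(0)}\otimes_H(c_0^{(2)}\otimes c_1\otimes\dots\otimes c_{n-1}\otimes m^{(-1)}c_0^{(1)}),$$ $$\sigma_i(m\otimes_H(c_0\otimes\dots\otimes c_{n+1}))=m\otimes_H(c_0\otimes\dots\otimes c_i\otimes\varepsilon(c_{i+1})\otimes c_{i+2}\otimes\dots\otimes c_{n+1}),\quad 0\le i\le n,$$ $$\tau_n(m\otimes_H(c_0\otimes\dots\otimes c_n))=m^{(0)}\otimes_H(c_1\otimes\dots\otimes c_n\otimes m^{(-1)}c_0)$$ define a (co)cyclic module structure on $\{\mathcal C^n_H(C,M)\}_{n\in\mathbb N}$, $\mathcal C^n_H(C,M):=M\otimes_H C^{\otimes(n+1)}$ (here the scalar $\varepsilon(c_{i+1})$ is absorbed, so $\sigma_i$ lands in $\mathcal C^n_H(C,M)$). (2) For every left $H$-module algebra $A$, the formulas $$(\delta_if)(m\otimes a_0\otimes\dots\otimes a_n)=f(m\otimes a_0\otimes\dots\otimes a_ia_{i+1}\otimes\dots\otimes a_n),\quad 0\le i<n,$$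 $$(\delta_nf)(m\otimes a_0\otimes\dots\otimes a_n)=f\big(m^{(0)}\otimes(S^{-1}(m^{(-1)})a_n)a_0\otimes a_1\otimes\dots\otimes a_{n-1}\big),$$ $$(\sigma_if)(m\otimes a_0\otimes\dots\otimes a_n)=f(m\otimes a_0\otimes\dots\otimes a_i\otimes 1\otimes a_{i+1}\otimes\dots\otimes a_n),\quad 0\le i\le n,$$ $$(\tau_nf)(m\otimes a_0\otimes\dots\otimes a_n)=f\big(m^{(0)}\otimes(S^{-1}(m^{(-1)})a_n)\otimes a_0\otimes\dots\otimes a_{n-1}\big)$$ define a (co)cyclic module structure on $\{\mathcal C^n_H(A,M)\}_{n\in\mathbb N}$, $\mathcal C^n_H(A,M):=\mathrm{Hom}_H(M\otimes A^{\otimes(n+1)},k)$. (3) Suppose moreover that $\mathbb Q\subseteq k$ and that a left $H$-module coalgebra $C$ acts on a left $H$-module algebra $A$, in the sense that there is a linear map $C\otimes A\to A$, $c\otimes a\mapsto ca$, satisfying $c(ab)=(c^{(1)}a)(c^{(2)}b)$, $c1=\varepsilon(c)1$ and $h(ca)=(hc)a$ for all $h\in H$, $c\in C$, $a,b\in A$. Then for every $n\in\mathbb N$ the formulas $$\big([m\otimes_H(c_0\otimes\dots\otimes c_n)]\,\#\,f\big)(a_0\otimes\dots\otimes a_n)=f\big(m\otimes_H(c_0a_0)\cdots(c_na_n)\big),$$ $$\big((m\otimes_Hc)\,\#\,[f]\big)(a_0\otimes\dots\otimes a_n)=f\big(m\otimes_H(c^{(1)}a_0)\otimes\dots\otimes(c^{(n+1)}a_n)\big)$$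 (extended linearly) define, respectively, homomorphisms $$HC^n_H(C,M)\otimes HC^0_H(A,M)\xrightarrow{\ \#_{n,0}\ }HC^n(A),\qquad HC^0_H(C,M)\otimes HC^n_H(A,M)\xrightarrow{\ \#_{0,n}\ }HC^n(A).$$
   Context: All algebras are associative and unital over the field $k$; $\otimes=\otimes_k$; $\mathbb N=\{0,1,2,\dots\}$. $H$ has coproduct $\Delta(h)=h^{(1)}\otimes h^{(2)}$, counit $\varepsilon$, antipode $S$; a left coaction on $M$ is written ${}_M\Delta(m)=m^{(-1)}\otimes m^{(0)}$ (summation suppressed). A right $H$-module and left $H$-comodule $M$ is anti-Yetter-Drinfeld if ${}_M\Delta(mh)=S(h^{(3)})m^{(-1)}h^{(1)}\otimes m^{(0)}h^{(2)}$ for all $m\in M$, $h\in H$, and stable if $m^{(0)}m^{(-1)}=m$ for all $m\in M$. A left $H$-module algebra is an algebra $A$ that is a left $H$-module with $h(ab)=(h^{(1)}a)(h^{(2)}b)$, $h1=\varepsilon(h)1$. A left $H$-module coalgebra is a coalgebra $C$ that is a left $H$-module with $\Delta(hc)=h^{(1)}c^{(1)}\otimes h^{(2)}c^{(2)}$, $\varepsilon(hc)=\varepsilon(h)\varepsilon(c)$. $C^{\otimes(n+1)}$ and $A^{\otimes(n+1)}$ are left $H$-modules via the diagonal action $h(c_0\otimes\dots\otimes c_n)=h^{(1)}c_0\otimes\dots\otimes h^{(n+1)}c_n$. $M\otimes A^{\otimes(n+1)}$ is a right $H$-module via $(m\otimes\tilde a)h=mh^{(1)}\otimes S(h^{(2)})\tilde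 a$, $k$ is a right $H$-module via $\varepsilon$, and $\mathrm{Hom}_H$ denotes right $H$-linear maps. Elements of $\mathrm{Hom}_H(M\otimes A^{\otimes(n+1)},k)$ are the same as linear functionals on $M\otimes_H A^{\otimes(n+1)}$, and one writes $f(m\otimes_H\tilde a)=f(m\otimes\tilde a)$. In both (1) and (2) the faces are maps $\delta_i:\mathcal C^{n-1}\to\mathcal C^n$ ($0\le i\le n$), the degeneracies are maps $\sigma_i:\mathcal C^{n+1}\to\mathcal C^n$ ($0\le i\le n$), and $\tau_n:\mathcal C^n\to\mathcal C^n$. ''(Co)cyclic module structure'' means that these maps are well defined, $\delta_i,\sigma_i$ satisfy the cosimplicial identities, and $\tau_n\delta_i=\delta_{i-1}\tau_{n-1}$ for $1\le i\le n$, $\tau_n\delta_0=\delta_n$, $\tau_n\sigma_i=\sigma_{i-1}\tau_{n+1}$ for $1\le i\le n$, $\tau_n\sigma_0=\sigma_n\tau_{n+1}^2$, $\tau_n^{n+1}=\mathrm{id}$. When $\mathbb Q\subseteq k$ and $*$ is $C$ or $A$, the cyclic cohomology is defined by: $b_n:=\sum_{i=0}^{n+1}(-1)^i\delta_i:\mathcal C^n_H( *,M)\to\mathcal C^{n+1}_H( *,M)$; $\mathcal Z^n_H( *,M)$ is the kernel of $b_n$ restricted to $\mathrm{Ker}(\tau_n-(-1)^n)$; $\mathcal B^n_H( *,M)$ is the image of $b_{n-1}$ restricted to $\mathrm{Ker}(\tau_{n-1}-(-1)^{n-1})$ (with $\mathcal B^0_H=0$); $HC^n_H( *,M):=\mathcal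 Z^n_H( *,M)/\mathcal B^n_H( *,M)$. In particular $HC^0_H=\mathcal Z^0_H$. $[\,\cdot\,]$ denotes the cohomology class. $HC^n(A)$ is the usual cyclic cohomology of the algebra $A$, i.e. the case $H=k=M$, with cochains $\mathrm{Hom}(A^{\otimes(n+1)},k)$. *)

(* Defs.v *)
From HB Require Import structures.
From mathcomp Require Import all_boot all_algebra.
From mathcomp Require Import boolp functions.
From mathcomp Require Import freeg zify.

Set Implicit Arguments.
Unset Strict Implicit.
Unset Printing Implicit Defensive.

Import GRing.Theory.
Local Open Scope ring_scope.
Local Open Scope quotient_scope.

Section Subspace.
Variables (k : fieldType) (V : lmodType k) (S : submodClosed V).

Record subspace := Subspace { subspace_val :> V; _ : subspace_val \in S }.

HB.instance Definition _ := [isSub for subspace_val].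
HB.instance Definition _ := [Choice of subspace by <:].
HB.instance Definition _ := [SubChoice_isSubLmodule of subspace by <:].
End Subspace.

Section Span.
Variables (k : fieldType) (V : lmodType k) (G : V -> Prop).

Inductive in_span : V -> Prop :=
| in_span0 : in_span 0
| in_spanD a u v : G u -> in_span v -> in_span (a *: u + v).

Definition span : {pred V} := fun v => `[< in_span v >].

Lemma span_submod : submod_closed span.
Proof.
split=> [|a u v]; rewrite !unfold_in.
  by apply/asboolP/in_span0.
move=> /asboolP Su /asboolP Sv; apply/asboolP.
elim: Su => [|b u' v' Gu' _ IH]; first by rewrite scaler0 add0r.
by rewrite scalerDr scalerA -addrA; apply: in_spanD.
Qed.

HB.instance Definition _ :=
  GRing.isSubmodClosed.Build k V span (GRing.submod_closed_semi span_submod).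

Lemma mem_span u : G u -> u \in span.
Proof.
move=> Gu; rewrite unfold_in; apply/asboolP.
by rewrite -[u]scale1r -[_ *: _]addr0; apply: in_spanD => //; apply: in_span0.
Qed.
End Span.

Section Quotv.
Variables (k : fieldType) (V : lmodType k) (S : submodClosed V).

(* [submodClosed] only records stability under + and scaling; over a field it *)
(* gives stability under opposite, which [Quotient.quot] asks for.            *)
Let quot_pred : {pred V} := S.

HB.instance Definition _ := GRing.isSubmodClosed.Build k V quot_pred
  (GRing.subsemimodClosedP S).

Definition quotv := Quotient.quot quot_pred.

HB.instance Definition _ := GRing.Zmodule.on quotv.

Definition quotv_class (v : V) : quotv := \pi_(Quotient.quot quot_pred) v.

Lemma quotv_eq u v : quotv_class u = quotv_class v <-> u - v \in S.
Proof.
rewrite /quotv_class (rwP eqP).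
by rewrite -Quotient.idealrBE.
Qed.

Definition quotv_scale a (x : quotv) : quotv := quotv_class (a *: repr x).

Lemma quotv_classK (x : quotv) : quotv_class (repr x) = x.
Proof. exact: reprK. Qed.

Lemma quotv_classD u v :
  quotv_class (u + v) = quotv_class u + quotv_class v.
Proof. exact: (raddfD (\pi_(Quotient.quot quot_pred))). Qed.

Lemma quotv_classZ a v : quotv_class (a *: v) = quotv_scale a (quotv_class v).
Proof.
apply/quotv_eq; rewrite -scalerBr rpredZ //.
by apply/quotv_eq; rewrite quotv_classK.
Qed.

Fact quotv_scalerA a b x :
  quotv_scale a (quotv_scale b x) = quotv_scale (a * b) x.
Proof. by rewrite -[x]quotv_classK -!quotv_classZ scalerA. Qed.

Fact quotv_scale1r x : quotv_scale 1 x = x.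
Proof. by rewrite -[x]quotv_classK -quotv_classZ scale1r. Qed.

Fact quotv_scalerDr a x y :
  quotv_scale a (x + y) = quotv_scale a x + quotv_scale a y.
Proof.
rewrite -[x]quotv_classK -[y]quotv_classK.
by rewrite -quotv_classD -!quotv_classZ scalerDr quotv_classD.
Qed.

Fact quotv_scalerDl x a b :
  quotv_scale (a + b) x = quotv_scale a x + quotv_scale b x.
Proof.
by rewrite -[x]quotv_classK -!quotv_classZ scalerDl quotv_classD.
Qed.

HB.instance Definition _ := GRing.Zmodule_isLmodule.Build k (quotv)
  quotv_scalerA quotv_scale1r quotv_scalerDr quotv_scalerDl.

Fact quotv_class_linear : linear quotv_class.
Proof. by move=> a u v; rewrite quotv_classD quotv_classZ. Qed.

HB.instance Definition _ :=
  GRing.isLinear.Build k V (quotv) _ quotv_class quotv_class_linear.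
End Quotv.

Section Tensor.
Variables (k : fieldType) (V W : lmodType k).

Let free : lmodType k := {freeg (V * W)%type / k}.
Let pt (v : V) (w : W) : free := [freeg [:: (1, (v, w))]].

Inductive tensor_rel : free -> Prop :=
| tensor_rell a v v' w :
    tensor_rel (pt (a *: v + v') w - (a *: pt v w + pt v' w))
| tensor_relr a v w w' :
    tensor_rel (pt v (a *: w + w') - (a *: pt v w + pt v w')).

Definition tensor := quotv (span tensor_rel).
HB.instance Definition _ := GRing.Lmodule.on tensor.

Definition tens (v : V) (w : W) : tensor := quotv_class (span tensor_rel) (pt v w).

Lemma tens_bilinear : bilinear_for *:%R *:%R tens.
Proof.
split=> [w a v v'|v a w w']; rewrite /tens -linearP; apply/quotv_eq/mem_span.
  exact: tensor_rell.
exact: tensor_relr.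
Qed.

(* [pures t] is a list of pairs (v_j, w_j) with t = \sum_j v_j \ox w_j, see   *)
(* [puresE]; summing over [pures (comul h)] is Sweedler's notation. By        *)
(* [sum_pures_tens] and [sum_pures_linear], a sum whose general term is       *)
(* bilinear does not depend on the decomposition that [pures] picks.          *)
Definition pures (t : tensor) : seq (V * W) :=
  [seq (p.1 *: p.2.1, p.2.2) | p <- fgenum (repr t : {freeg (V * W)%type / k})].

Lemma puresE t : t = \sum_(p <- pures t) tens p.1 p.2.
Proof.
have tensZ a v w : tens (a *: v) w = a *: tens v w.
  have [/(_ w) tl _] := tens_bilinear.
  have tens0 : tens 0 w = 0.
    by have /= := tl (-1) 0 0; rewrite scaleN1r oppr0 addr0 scaleN1r addNr.
  by rewrite -[X in tens X](addr0 (a *: v)) tl tens0 addr0.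
rewrite big_map -{1}[t]quotv_classK -[X in quotv_class _ X]Freeg_enum.
elim: (fgenum _) => [|[a [v w]] s IH]; first by rewrite big_nil freeg_nil linear0.
rewrite big_cons -cat1s freeg_cat linearD /= IH tensZ; congr (_ + _).
rewrite -linearZ; congr quotv_class.
by apply/eqP/freeg_eqP => x; rewrite coeffZ !coeffU mul1r; congr (_ * _).
Qed.

Section SumPures.
Variables (E : lmodType k) (F : V -> W -> E).
Hypothesis bilF : bilinear_for *:%R *:%R F.

Let L : free -> E := fglift (fun p => F p.1 p.2).

Let L_Freeg s : L [freeg s] = \sum_(x <- s) x.1 *: F x.2.1 x.2.2.
Proof. exact: fglift_Freeg. Qed.

Let L_linear : linear L.
Proof.
have LD : {morph L : x y / x + y}.
  move=> x y; rewrite -[x]Freeg_enum -[y]Freeg_enum -freeg_cat !L_Freeg.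
  by rewrite big_cat.
move=> a x y; rewrite LD; congr (_ + _); rewrite -[x]Freeg_enum.
elim: (fgenum x) => [|[b p] s IH].
  by rewrite freeg_nil scaler0 -freeg_nil L_Freeg big_nil scaler0.
rewrite -cat1s freeg_cat scalerDr !LD IH scalerDr; congr (_ + _).
have -> : a *: [freeg [:: (b, p)]] = [freeg [:: (a * b, p)]] :> free.
  by apply/eqP/freeg_eqP => z; rewrite coeffZ !coeffU mulrA.
by rewrite !L_Freeg !big_seq1 scalerA.
Qed.

Let L_span u : u \in span tensor_rel -> L u = 0.
Proof.
have L0 : L 0 = 0 by rewrite -freeg_nil L_Freeg big_nil.
have LD x y : L (x + y) = L x + L y.
  by have := L_linear 1 x y; rewrite !scale1r.
have LB x y : L (x - y) = L x - L y.
  by rewrite addrC -[- y]scaleN1r L_linear scaleN1r addrC.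
have Lpt v w : L (pt v w) = F v w by rewrite L_Freeg big_seq1 scale1r.
rewrite unfold_in => /asboolP; elim=> [//|a {}u v Gu _ IH].
rewrite L_linear IH addr0.
suff -> : L u = 0 by rewrite scaler0.
case: Gu => [b x x' y|b x y y']; rewrite LB L_linear !Lpt.
  by have /= -> := bilF.1 y; rewrite subrr.
by have /= -> := bilF.2 x; rewrite subrr.
Qed.

Let sum_puresE D : \sum_(p <- pures (quotv_class _ D)) F p.1 p.2 = L D.
Proof.
have -> : L D = L (repr (quotv_class (span tensor_rel) D)).
  set D' := repr _; rewrite -[RHS]addr0 -(L_span (u := D - D')); last first.
    by apply/quotv_eq; rewrite quotv_classK.
  by rewrite -[L D']scale1r -L_linear scale1r addrC subrK.
rewrite big_map -[X in L X]Freeg_enum L_Freeg; apply: eq_bigr => -[a [v w]] _ /=.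
have [/(_ w) Fl _] := bilF.
have F0 : F 0 w = 0.
  by have /= := Fl (-1) 0 0; rewrite scaleN1r oppr0 addr0 scaleN1r addNr.
by rewrite -[X in F X](addr0 (a *: v)) Fl F0 addr0.
Qed.

Lemma sum_pures_linear : linear (fun t => \sum_(p <- pures t) F p.1 p.2).
Proof.
move=> a t u; rewrite -[t]quotv_classK -[u]quotv_classK -linearP.
by rewrite !sum_puresE L_linear.
Qed.

Lemma sum_pures_tens v w : \sum_(p <- pures (tens v w)) F p.1 p.2 = F v w.
Proof. by rewrite sum_puresE L_Freeg big_seq1 scale1r. Qed.

End SumPures.
End Tensor.

Notation "v \ox w" := (tens v w) (at level 40, left associativity).

(* Tensor powers: [tpow V n] is the (n+1)-st tensor power, and                *)
(* [tpure n [:: v_0; ..; v_n]] is the pure tensor v_0 \ox .. \ox v_n.         *)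

Fixpoint tpow (k : fieldType) (V : lmodType k) (n : nat) : lmodType k :=
  if n is n'.+1 then tensor V (tpow V n') else V.

Fixpoint tpure (k : fieldType) (V : lmodType k) (n : nat) (s : seq V) :
    tpow V n :=
  match n with
  | 0 => head 0 s
  | n'.+1 => head 0 s \ox tpure n' (behead s)
  end.

Definition lin_of (k : fieldType) (U E : lmodType k) (f : U -> E)
    (lin_f : linear f) : {linear U -> E} :=
  HB.pack f (GRing.isLinear.Build k U E _ f lin_f).

Section TpowTheory.
Variables (k : fieldType) (V : lmodType k).

Definition multilinear n (E : lmodType k) (F : seq V -> E) :=
  forall s1 s2, (size s1 + size s2)%N = n -> linear (fun x => F (s1 ++ x :: s2)).

Lemma tpure_multilinear n : multilinear n (@tpure k V n).
Proof.
elim: n => [|n IH] [|y s1] s2 //= => -[sz] a u v.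
- by have /= -> := (tens_bilinear V (tpow V n)).1 (tpure n s2).
- by rewrite (IH s1 s2 sz a u v); have /= -> := (tens_bilinear V (tpow V n)).2 y.
Qed.

Lemma tpow_ext n (E : lmodType k) (f g : {linear tpow V n -> E}) :
  (forall s : n.+1.-tuple V, f (tpure n s) = g (tpure n s)) -> f =1 g.
Proof.
elim: n E f g => [|n IH] E f g fg t; first by have := fg [tuple t].
rewrite [t]puresE !linear_sum; apply: eq_bigr => -[v w] _ /=.
have lin (h : {linear tpow V n.+1 -> E}) : linear (fun w => h (v \ox w)).
  move=> a x y /=; have /= -> := (tens_bilinear V (tpow V n)).2 v.
  by rewrite linearP.
pose bundle h : {linear tpow V n -> E} := lin_of (lin h).
apply: (IH E (bundle f) (bundle g)) => s /=.
exact: (fg [tuple of v :: s]).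
Qed.

Lemma tpow_lift n (E : lmodType k) (F : seq V -> E) : multilinear n F ->
  {L : {linear tpow V n -> E} |
    forall s : n.+1.-tuple V, L (tpure n s) = F s}.
Proof.
elim: n E F => [|n IH] E F mF.
  have lin : linear (fun x : tpow V 0 => F [:: x]) by exact: (mF [::] [::]).
  exists (lin_of lin) => s /=.
  by case: s => -[|x [|y s]].
have mFx x : multilinear n (fun s => F (x :: s)).
  by move=> s1 s2 sz; apply: (mF (x :: s1)); rewrite /= addSn sz.
pose L x := sval (IH E _ (mFx x)).
have LE x (s : n.+1.-tuple V) : L x (tpure n s) = F (x :: s).
  exact: (svalP (IH E _ (mFx x))).
have bilL : bilinear_for *:%R *:%R (fun x => L x : tpow V n -> E).
  split=> [t a x y|x]; last exact: linearP.
  have lin : linear (fun t => a *: L x t + L y t).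
    move=> b u v /=; rewrite (linearP (L x)) (linearP (L y)) !scalerDr !scalerA [b * a]mulrC.
    by rewrite addrACA.
  pose R : {linear tpow V n -> E} := lin_of lin.
  apply: (tpow_ext (f := L (a *: x + y)) (g := R)) => s /=.
  by rewrite !LE; apply: (mF [::]); rewrite add0n size_tuple.
exists (lin_of (sum_pures_linear bilL)) => s /=.
rewrite (sum_pures_tens bilL) (LE _ [tuple of behead s]) /=.
by case: s => -[].
Qed.
End TpowTheory.

HB.mixin Record isCoalgebra (k : fieldType) C of GRing.Lmodule k C := {
  comul : {linear C -> tensor C C};
  counit : {scalar C};
  comulA : forall c,
    \sum_(p <- pures (comul c)) \sum_(q <- pures (comul p.1))
      q.1 \ox (q.2 \ox p.2) =
    \sum_(p <- pures (comul c)) \sum_(q <- pures (comul p.2))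
      p.1 \ox (q.1 \ox q.2);
  counitl : forall c, \sum_(p <- pures (comul c)) counit p.1 *: p.2 = c;
  counitr : forall c, \sum_(p <- pures (comul c)) counit p.2 *: p.1 = c
}.

#[short(type="coalgType")]
HB.structure Definition Coalgebra (k : fieldType) :=
  {C of GRing.Lmodule k C & isCoalgebra k C}.

(* The library's [algType] excludes the zero algebra; a Hopf algebra is       *)
(* nonzero since [counit 1 = 1].                                              *)
HB.mixin Record isHopfAlgebra (k : fieldType) H
    of GRing.Algebra k H & Coalgebra k H := {
  comulM : forall g h : H, comul (g * h) =
    \sum_(p <- pures (comul g)) \sum_(q <- pures (comul h))
      (p.1 * q.1) \ox (p.2 * q.2);
  comul1 : comul (1 : H) = 1 \ox 1;
  counitM : forall g h : H, counit (g * h) = counit g * counit h;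
  counit1 : counit (1 : H) = 1;
  antipode : {linear H -> H};
  antipodel : forall h : H,
    \sum_(p <- pures (comul h)) antipode p.1 * p.2 = counit h *: 1;
  antipoder : forall h : H,
    \sum_(p <- pures (comul h)) p.1 * antipode p.2 = counit h *: 1
}.

#[short(type="hopfType")]
HB.structure Definition HopfAlgebra (k : fieldType) :=
  {H of GRing.Algebra k H & Coalgebra k H & isHopfAlgebra k H}.

HB.mixin Record isLeftHModule (k : fieldType) (H : hopfType k) V
    of GRing.Lmodule k V := {
  lact : H -> V -> V;
  lact_bilinear : bilinear_for *:%R *:%R lact;
  lact1 : forall v, lact 1 v = v;
  lactM : forall g h v, lact (g * h) v = lact g (lact h v)
}.

#[short(type="leftHModType")]
HB.structure Definition LeftHModule (k : fieldType) (H : hopfType k) :=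
  {V of GRing.Lmodule k V & isLeftHModule k H V}.

HB.mixin Record isRightHModule (k : fieldType) (H : hopfType k) M
    of GRing.Lmodule k M := {
  ract : M -> H -> M;
  ract_bilinear : bilinear_for *:%R *:%R ract;
  ract1 : forall m, ract m 1 = m;
  ractM : forall m g h, ract m (g * h) = ract (ract m g) h
}.

#[short(type="rightHModType")]
HB.structure Definition RightHModule (k : fieldType) (H : hopfType k) :=
  {M of GRing.Lmodule k M & isRightHModule k H M}.

HB.mixin Record isLeftHComodule (k : fieldType) (H : hopfType k) M
    of GRing.Lmodule k M := {
  coact : {linear M -> tensor H M};
  coactA : forall m,
    \sum_(p <- pures (coact m)) \sum_(q <- pures (comul p.1))
      q.1 \ox (q.2 \ox p.2) =
    \sum_(p <- pures (coact m)) \sum_(q <- pures (coact p.2))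
      p.1 \ox (q.1 \ox q.2);
  coact_counit : forall m, \sum_(p <- pures (coact m)) counit p.1 *: p.2 = m
}.

#[short(type="leftHComodType")]
HB.structure Definition LeftHComodule (k : fieldType) (H : hopfType k) :=
  {M of GRing.Lmodule k M & isLeftHComodule k H M}.

HB.mixin Record isStableAYD (k : fieldType) (H : hopfType k) M
    of RightHModule k H M & LeftHComodule k H M := {
  ayd : forall (m : M) (h : H), coact (ract m h) =
    \sum_(p <- pures (coact m)) \sum_(x <- pures (comul h))
      \sum_(y <- pures (comul x.2))
        (antipode y.2 * p.1 * x.1) \ox (ract p.2 y.1);
  stable : forall m : M, \sum_(p <- pures (coact m)) ract p.2 p.1 = m
}.

#[short(type="saydType")]
HB.structure Definition StableAYD (k : fieldType) (H : hopfType k) :=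
  {M of RightHModule k H M & LeftHComodule k H M & isStableAYD k H M}.

HB.mixin Record isHModuleCoalgebra (k : fieldType) (H : hopfType k) C
    of Coalgebra k C & LeftHModule k H C := {
  comul_lact : forall (h : H) (c : C), comul (lact h c) =
    \sum_(p <- pures (comul h)) \sum_(q <- pures (comul c))
      (lact p.1 q.1) \ox (lact p.2 q.2);
  counit_lact : forall (h : H) (c : C),
    counit (lact h c) = counit h * counit c
}.

#[short(type="hmodCoalgType")]
HB.structure Definition HModuleCoalgebra (k : fieldType) (H : hopfType k) :=
  {C of Coalgebra k C & LeftHModule k H C & isHModuleCoalgebra k H C}.

(* Associative unital algebras, possibly zero: the library's [algType]         *)
(* requires 1 != 0, and Hierarchy Builder does not allow a structure between   *)
(* [lmodType] and [algType].                                                   *)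
HB.mixin Record isUnitalAlgebra (k : fieldType) A of GRing.Lmodule k A := {
  amul : A -> A -> A;
  aone : A;
  amul_bilinear : bilinear_for *:%R *:%R amul;
  amulA : associative amul;
  amul1l : left_id aone amul;
  amul1r : right_id aone amul
}.

#[short(type="unitalAlgType")]
HB.structure Definition UnitalAlgebra (k : fieldType) :=
  {A of GRing.Lmodule k A & isUnitalAlgebra k A}.

HB.mixin Record isHModuleAlgebra (k : fieldType) (H : hopfType k) A
    of UnitalAlgebra k A & LeftHModule k H A := {
  lact_amul : forall (h : H) (a b : A), lact h (amul a b) =
    \sum_(p <- pures (comul h)) amul (lact p.1 a) (lact p.2 b);
  lact_aone : forall h : H, lact h (aone : A) = counit h *: (aone : A)
}.

#[short(type="hmodAlgType")]
HB.structure Definition HModuleAlgebra (k : fieldType) (H : hopfType k) :=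
  {A of UnitalAlgebra k A & LeftHModule k H A & isHModuleAlgebra k H A}.

(* [sweedler n c] lists the (n+1)-tuples whose sum of pure tensors is the     *)
(* iterated coproduct c^(1) \ox .. \ox c^(n+1).                               *)
Fixpoint sweedler (k : fieldType) (C : coalgType k) (n : nat) (c : C) :
    seq (seq C) :=
  if n is n'.+1 then
    [seq p.1 :: s | p <- pures (comul c), s <- sweedler n' p.2]
  else [:: [:: c]].

Lemma sum_linear (k : fieldType) (E F : lmodType k) (I : Type) (r : seq I) (f : I -> E -> F) :
  (forall i, linear (f i)) -> linear (fun x => \sum_(i <- r) f i x).
Proof.
move=> lf a x y /=; rewrite scaler_sumr -big_split /=.
by apply: eq_bigr => i _; exact: lf.
Qed.

Section DiagonalAction.
Variables (k : fieldType) (H : hopfType k) (C : leftHModType H).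

Fixpoint diag (n : nat) (h : H) : tpow C n -> tpow C n :=
  match n return tpow C n -> tpow C n with
  | 0 => @lact k H C h
  | n'.+1 => fun t => \sum_(q <- pures t) \sum_(p <- pures (comul h))
      lact p.1 q.1 \ox @diag n' p.2 q.2
  end.
Arguments diag n h t : clear implicits.

Let diag_bilinear n h : (forall h', linear (diag n h')) ->
  bilinear_for *:%R *:%R
    (fun (c : C) t => \sum_(p <- pures (comul h)) lact p.1 c \ox diag n p.2 t).
Proof.
move=> ld; split=> [t|c].
  apply: (@sum_linear _ _ _ _ _ (fun p (c : C) => lact p.1 c \ox diag n p.2 t)).
  move=> p a c d /=; have /= -> := (@lact_bilinear _ _ C).2 p.1.
  by have /= -> := (tens_bilinear C (tpow C n)).1 (diag n p.2 t).
apply: (@sum_linear _ _ _ _ _ (fun p t => lact p.1 c \ox diag n p.2 t)).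
move=> p a t u /=; rewrite ld.
by have /= -> := (tens_bilinear C (tpow C n)).2 (lact p.1 c).
Qed.

Lemma diag_linear n h : linear (diag n h).
Proof.
elim: n h => [|n IH] h; first exact: ((@lact_bilinear _ _ C).2 h).
exact: sum_pures_linear (diag_bilinear h IH).
Qed.

Lemma diag_tpure n h (c : n.+1.-tuple C) :
  diag n h (tpure n c) =
  \sum_(s <- sweedler n h) tpure n [seq lact p.1 p.2 | p <- zip s c].
Proof.
elim: n h c => [|n IH] h c; first by rewrite big_seq1; case: c => -[|x []].
rewrite /= (sum_pures_tens (diag_bilinear h (@diag_linear n))).
case/tupleP: c => x c /=; rewrite big_allpairs_dep; apply: eq_bigr => p _ /=.
rewrite IH; have lin : linear (fun t : tpow C n => lact p.1 x \ox t).
  exact: ((tens_bilinear C (tpow C n)).2 (lact p.1 x)).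
exact: (linear_sum (lin_of lin)).
Qed.
End DiagonalAction.
Arguments diag {k H C} n h t.

(* M \ox_H N, for N a left H-module through [act]                             *)
Section BalancedTensor.
Variables (k : fieldType) (H : hopfType k) (M : rightHModType H).
Variables (N : lmodType k) (act : H -> N -> N).

Inductive balanced_rel : tensor M N -> Prop :=
| Balanced m h x : balanced_rel (ract m h \ox x - m \ox act h x).

Definition tensorH := quotv (span balanced_rel).
HB.instance Definition _ := GRing.Lmodule.on tensorH.

Definition tensH (m : M) (x : N) : tensorH :=
  quotv_class (span balanced_rel) (m \ox x).
End BalancedTensor.

Section Dual.
Variables (k : fieldType) (V : lmodType k).

Definition linform : {pred V -> k^o} := fun f => `[< linear f >].

Fact linform_submod : submod_closed linform.
Proof.
split=> [|a f g]; rewrite !unfold_in.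
  by apply/asboolP => b x y; rewrite scaler0 addr0.
move=> /asboolP lf /asboolP lg; apply/asboolP => b x y.
rewrite -[LHS]/(a *: f (b *: x + y) + g (b *: x + y)) lf lg.
rewrite -[RHS]/(b *: (a *: f x + g x) + (a *: f y + g y)).
by rewrite !scalerDr !scalerA [b * a]mulrC addrACA.
Qed.

HB.instance Definition _ := GRing.isSubmodClosed.Build k (V -> k^o) linform
  (GRing.submod_closed_semi linform_submod).

Definition dual : lmodType k := subspace linform.
End Dual.

(* The right action (m \ox a) h = m h^(1) \ox S(h^(2)) a on M \ox A^{n+1}, and *)
(* Hom_H(M \ox A^{n+1}, k)                                                    *)
Section HomH.
Variables (k : fieldType) (H : hopfType k) (M : rightHModType H).
Variables (A : leftHModType H) (n : nat).

Definition ract_tens (x : tensor M (tpow A n)) (h : H) : tensor M (tpow A n) :=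
  \sum_(q <- pures x) \sum_(p <- pures (comul h))
    ract q.1 p.1 \ox diag n (antipode p.2) q.2.

Definition linformH : {pred tensor M (tpow A n) -> k^o} := fun f =>
  `[< linear f /\ forall x h, f (ract_tens x h) = f x * counit h >].

Fact linformH_submod : submod_closed linformH.
Proof.
split=> [|a f g]; rewrite !unfold_in.
  apply/asboolP; split=> [b x y|x h]; first by rewrite scaler0 addr0.
  by rewrite mul0r.
move=> /asboolP[lf Hf] /asboolP[lg Hg]; apply/asboolP; split=> [b x y|x h].
  have := linform_submod (tensor M (tpow A n)); case=> _ /(_ a f g).
  by rewrite !unfold_in => /(_ (introT (asboolP _) lf) (introT (asboolP _) lg));
    move/asboolP/(_ b x y).
rewrite -[LHS]/(a * f (ract_tens x h) + g (ract_tens x h)) Hf Hg.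
by rewrite mulrA -mulrDl.
Qed.

HB.instance Definition _ :=
  GRing.isSubmodClosed.Build k (tensor M (tpow A n) -> k^o) linformH
    (GRing.submod_closed_semi linformH_submod).

Definition homH : lmodType k := subspace linformH.
End HomH.

(* In [coface X n i] and [codegen X n i] only the indices i <= n+1, resp.     *)
(* i <= n, are meaningful; [coface X n] raises the degree from n to n+1.      *)
Record cocyclic_ops (k : fieldType) (X : nat -> lmodType k) := CocyclicOps {
  coface : forall n, nat -> {linear X n -> X n.+1};
  codegen : forall n, nat -> {linear X n.+1 -> X n};
  cocyc : forall n, {linear X n -> X n}
}.
Arguments coface {k X} D n i : rename.
Arguments codegen {k X} D n i : rename.
Arguments cocyc {k X} D n : rename.

Section Cocyclic.
Variables (k : fieldType) (X : nat -> lmodType k).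

Record is_cocyclic (D : cocyclic_ops X) : Prop := IsCocyclic {
  coface_coface : forall n i j x, (i < j <= n.+2)%N ->
    coface D n.+1 j (coface D n i x) = coface D n.+1 i (coface D n j.-1 x);
  codegen_codegen : forall n i j x, (i <= j <= n)%N ->
    codegen D n j (codegen D n.+1 i x) = codegen D n i (codegen D n.+1 j.+1 x);
  codegen_coface_lt : forall n i j x, (i < j <= n.+1)%N ->
    codegen D n.+1 j (coface D n.+1 i x) = coface D n i (codegen D n j.-1 x);
  codegen_coface_eq : forall n j x, (j <= n)%N ->
    codegen D n j (coface D n j x) = x;
  codegen_coface_eqS : forall n j x, (j <= n)%N ->
    codegen D n j (coface D n j.+1 x) = x;
  codegen_coface_gt : forall n i j x, (j.+1 < i <= n.+2)%N ->
    codegen D n.+1 j (coface D n.+1 i x) = coface D n i.-1 (codegen D n j x);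
  cocyc_coface : forall n i x, (1 <= i <= n.+1)%N ->
    cocyc D n.+1 (coface D n i x) = coface D n i.-1 (cocyc D n x);
  cocyc_coface0 : forall n x,
    cocyc D n.+1 (coface D n 0 x) = coface D n n.+1 x;
  cocyc_codegen : forall n i x, (1 <= i <= n)%N ->
    cocyc D n (codegen D n i x) = codegen D n i.-1 (cocyc D n.+1 x);
  cocyc_codegen0 : forall n x,
    cocyc D n (codegen D n 0 x) =
    codegen D n n (cocyc D n.+1 (cocyc D n.+1 x));
  cocyc_order : forall n x, iter n.+1 (cocyc D n) x = x
}.

Definition same_ops (D D' : cocyclic_ops X) : Prop :=
  [/\ forall n i x, (i <= n.+1)%N -> coface D n i x = coface D' n i x,
      forall n i x, (i <= n)%N -> codegen D n i x = codegen D' n i x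
    & forall n x, cocyc D n x = cocyc D' n x].

(* [formulas] describes operators on X: it defines a cocyclic module when     *)
(* there are linear operators satisfying it, they are uniquely determined,    *)
(* and they satisfy the cocyclic identities.                                  *)
Definition define_cocyclic_module (formulas : cocyclic_ops X -> Prop) : Prop :=
  exists D, [/\ formulas D, is_cocyclic D
              & forall D', formulas D' -> same_ops D' D].
End Cocyclic.

Section CyclicCohomology.
Variables (k : fieldType) (X : nat -> lmodType k) (D : cocyclic_ops X).

Definition coboundary_map n (x : X n) : X n.+1 :=
  \sum_(i < n.+2) (-1) ^+ i *: coface D n i x.

Definition cyclic_cochain n (x : X n) : Prop := cocyc D n x = (-1) ^+ n *: x.

Definition cocycle n : {pred X n} :=
  fun x => `[< cyclic_cochain x /\ coboundary_map x = 0 >].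

Let bmap_linear n : linear (@coboundary_map n).
Proof. by apply: sum_linear => i a x y; rewrite linearP scalerDr !scalerA mulrC. Qed.

Let cyclic_linear n a (x y : X n) :
  cyclic_cochain x -> cyclic_cochain y -> cyclic_cochain (a *: x + y).
Proof.
rewrite /cyclic_cochain linearP => -> ->.
by rewrite scalerDr !scalerA mulrC.
Qed.

Let zero_cyclic n : cyclic_cochain (0 : X n).
Proof. by rewrite /cyclic_cochain linear0 scaler0. Qed.

Let bmap0 n : coboundary_map (0 : X n) = 0.
Proof. exact: (linear0 (lin_of (@bmap_linear n))). Qed.

Fact cocycle_submod n : submod_closed (@cocycle n).
Proof.
split=> [|a x y]; rewrite !unfold_in.
  by apply/asboolP.
move=> /asboolP[tx bx] /asboolP[ty b_y]; apply/asboolP; split.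
  exact: cyclic_linear.
by rewrite bmap_linear bx b_y scaler0 addr0.
Qed.

HB.instance Definition _ n := GRing.isSubmodClosed.Build k (X n) (@cocycle n)
  (GRing.submod_closed_semi (cocycle_submod n)).

Definition cocycles n : lmodType k := subspace (@cocycle n).

(* B^n as a subspace of Z^n: no intersection is lost, as the coboundary of a   *)
(* cyclic cochain of a cocyclic module is a cyclic cocycle.                    *)
Definition coboundary n : {pred cocycles n} :=
  match n return {pred cocycles n} with
  | 0 => fun z => z == 0
  | n'.+1 => fun z => `[< exists x : X n',
      cyclic_cochain x /\ subspace_val z = coboundary_map x >]
  end.

Fact coboundary_submod n : submod_closed (@coboundary n).
Proof.
case: n => [|n]; split=> [|a x y]; rewrite !unfold_in //=.
- by rewrite /coboundary => /eqP-> /eqP->; rewrite scaler0 addr0.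
- by apply/asboolP; exists 0; rewrite bmap0.
move=> /asboolP[u [tu ux]] /asboolP[v [tv vy]]; apply/asboolP.
exists (a *: u + v); split; first exact: cyclic_linear.
by rewrite bmap_linear -ux -vy.
Qed.

HB.instance Definition _ n :=
  GRing.isSubmodClosed.Build k (cocycles n) (@coboundary n)
    (GRing.submod_closed_semi (coboundary_submod n)).

Definition HC n : lmodType k := quotv (@coboundary n).

Definition cohomology_class n (z : cocycles n) : HC n := quotv_class _ z.
End CyclicCohomology.

Section SeqOps.
Variables (T : Type) (x0 one : T) (mul : T -> T -> T).

(* (.., a_i a_(i+1), ..) for i <= n, and (a_(n+1) a_0, a_1, .., a_n)          *)
(* otherwise                                                                  *)
Definition face_seq n i (a : seq T) : seq T :=
  if (i <= n)%N then
    take i a ++ mul (nth x0 a i) (nth x0 a i.+1) :: drop i.+2 a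
  else mul (nth x0 a n.+1) (nth x0 a 0) :: take n (behead a).

Definition degen_seq i (a : seq T) : seq T := take i.+1 a ++ one :: drop i.+1 a.

Definition cyc_seq n (a : seq T) : seq T := nth x0 a n :: take n a.

Variable P : (T -> T) -> Prop.
Hypotheses (Pid : P id) (Pl : forall y, P (mul y)) (Pr : forall y, P (mul^~ y)).

Let slot n (F : seq T -> seq T) s1 s2 := exists t1 t2 phi,
  [/\ P phi, (size t1 + size t2)%N = n
    & forall x, F (s1 ++ x :: s2) = t1 ++ phi x :: t2].

Lemma face_slot n i s1 s2 : (size s1 + size s2)%N = n.+1 ->
  slot n (face_seq n i) s1 s2.
Proof.
rewrite /slot /face_seq; case: leqP => [le_in|_] sz; last first.
  case: s1 sz => [|y s1] /= sz.
    exists [::], (take n s2), (mul (nth x0 s2 n)).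
    by split; rewrite ?size_takel //= -ltnS -sz.
  case: s2 sz => [|z s2] /= sz.
    exists [::], s1, (mul^~ y); have -> : n = size s1 by lia.
    by split=> // x; rewrite nth_cat ltnn subnn take_size_cat.
  exists (mul (nth x0 (z :: s2) (n - (size s1).+1)) y :: s1).
  exists (take (n - (size s1).+1) (z :: s2)), id; split=> //= [|x].
    rewrite size_takel /=; lia.
  rewrite nth_cat take_cat !ifN; try lia.
  by have -> : (n - size s1 = (n - (size s1).+1).+1)%N by lia.
have [lt_s1i|le_is1] := ltnP (size s1) i.
  pose j := (i - (size s1).+1)%N; have Di : i = (size s1 + j).+1 by lia.
  exists s1, (take j s2 ++ mul (nth x0 s2 j) (nth x0 s2 j.+1) :: drop j.+2 s2).
  exists id; split=> // [|x].
    rewrite size_cat /= size_drop size_takel; lia.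
  rewrite Di take_cat drop_cat !nth_cat !ifN; try lia.
  have -> : ((size s1 + j).+1 - size s1 = j.+1)%N by lia.
  have -> : ((size s1 + j).+2 - size s1 = j.+2)%N by lia.
  have -> : ((size s1 + j).+3 - size s1 = j.+3)%N by lia.
  by rewrite /= -catA.
have [Di|ne_is1] := eqVneq (size s1) i.
  exists s1, (behead s2), (mul^~ (nth x0 s2 0)); split=> // [|x].
    by rewrite size_behead; lia.
  rewrite -Di take_size_cat // !nth_cat ltnn subnn drop_cat !ifN; try lia.
  have -> : ((size s1).+1 - size s1 = 1)%N by lia.
  have -> : ((size s1).+2 - size s1 = 2)%N by lia.
  by rewrite /= drop1.
have [Di|ne_is1'] := eqVneq (size s1) i.+1.
  exists (take i s1), s2, (mul (nth x0 s1 i)); split=> // [|x].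
    by rewrite size_takel; lia.
  rewrite takel_cat; last by lia.
  rewrite !nth_cat Di ltnSn ltnn subnn drop_cat ifN; last by lia.
  have -> : (i.+2 - size s1 = 1)%N by lia.
  by rewrite /= drop0.
exists (take i s1 ++ mul (nth x0 s1 i) (nth x0 s1 i.+1) :: drop i.+2 s1), s2.
exists id; split=> // [|x].
  rewrite size_cat /= size_drop size_takel; lia.
rewrite takel_cat; last by lia.
rewrite !nth_cat drop_cat.
have -> : (i < size s1)%N by lia.
have -> : (i.+1 < size s1)%N by lia.
have [_|h] := ltnP; first by rewrite -catA.
have -> : (i.+2 - size s1 = 0)%N by lia.
by rewrite [drop i.+2 s1]drop_oversize // drop0 -catA.
Qed.

Lemma degen_slot n i s1 s2 : (size s1 + size s2)%N = n ->
  slot n.+1 (degen_seq i) s1 s2.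
Proof.
rewrite /slot /degen_seq => sz; have [lt_s1i|lt_is1] := ltnP (size s1) i.+1.
  exists s1, (take (i - size s1) s2 ++ one :: drop (i - size s1) s2), id.
  split=> // [|x].
    by rewrite -sz -addnS -[in RHS](cat_take_drop (i - size s1) s2)
      !size_cat /= addnS.
  rewrite take_cat drop_cat !ifN; try lia.
  have -> : (i.+1 - size s1 = (i - size s1).+1)%N by lia.
  by rewrite /= -catA.
exists (take i.+1 s1 ++ one :: drop i.+1 s1), s2, id; split=> // [|x].
  by rewrite -sz -addSn -[in RHS](cat_take_drop i.+1 s1) !size_cat /= addnS.
rewrite takel_cat // drop_cat; have [_|h] := ltnP; first by rewrite -catA.
have -> : (i.+1 - size s1 = 0)%N by lia.
by rewrite [drop i.+1 s1]drop_oversize // drop0 -catA.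
Qed.

Lemma cyc_slot n s1 s2 : (size s1 + size s2)%N = n -> slot n (cyc_seq n) s1 s2.
Proof.
rewrite /slot /cyc_seq => sz; case: s2 sz => [|z s2] /= sz.
  have -> : n = size s1 by lia.
  exists [::], s1, id; split=> // x.
  by rewrite nth_cat ltnn subnn take_size_cat.
exists (nth x0 (z :: s2) (size s2) :: s1), (take (size s2) (z :: s2)), id.
split=> // [|x].
  by rewrite size_takel //= -sz addnS.
have -> : n = (size s1 + (size s2).+1)%N by lia.
rewrite nth_cat take_cat !ifN; try lia.
by rewrite addKn.
Qed.
End SeqOps.

Section CoalgebraCochains.
Variables (k : fieldType) (H : hopfType k) (M : saydType H).
Variables (C : hmodCoalgType H).

Definition coalgC (n : nat) : lmodType k := tensorH M (@diag k H C n).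

Definition ctens n (m : M) (c : seq C) : coalgC n :=
  tensH (@diag k H C n) m (tpure n c).

Record coalg_formulas (D : cocyclic_ops coalgC) : Prop := CoalgFormulas {
  coalg_coface : forall n i m (c : n.+1.-tuple C), (i <= n)%N ->
    coface D n i (ctens n m c) =
    \sum_(p <- pures (comul c`_i))
      ctens n.+1 m (take i c ++ [:: p.1, p.2 & drop i.+1 c]);
  coalg_coface_last : forall n m (c : n.+1.-tuple C),
    coface D n n.+1 (ctens n m c) =
    \sum_(q <- pures (coact m)) \sum_(p <- pures (comul c`_0))
      ctens n.+1 q.2 (p.2 :: rcons (behead c) (lact q.1 p.1));
  coalg_codegen : forall n i m (c : n.+2.-tuple C), (i <= n)%N ->
    codegen D n i (ctens n.+1 m c) =
    counit c`_i.+1 *: ctens n m (take i.+1 c ++ drop i.+2 c);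
  coalg_cocyc : forall n m (c : n.+1.-tuple C),
    cocyc D n (ctens n m c) =
    \sum_(q <- pures (coact m))
      ctens n q.2 (rcons (behead c) (lact q.1 c`_0))
}.
End CoalgebraCochains.

(* [Sinv] stands for the inverse of the antipode.                             *)
Section AlgebraCochains.
Variables (k : fieldType) (H : hopfType k) (M : saydType H).
Variables (A : hmodAlgType H) (Sinv : H -> H).

Definition algC (n : nat) : lmodType k := homH M A n.

Definition algC_eval n (f : algC n) (m : M) (a : seq A) : k :=
  subspace_val f (m \ox tpure n a).

Record alg_formulas (D : cocyclic_ops algC) : Prop := AlgFormulas {
  alg_coface : forall n i f m (a : n.+2.-tuple A), (i <= n)%N ->
    algC_eval (coface D n i f) m a =
    algC_eval f m (take i a ++ amul a`_i a`_i.+1 :: drop i.+2 a);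
  alg_coface_last : forall n f m (a : n.+2.-tuple A),
    algC_eval (coface D n n.+1 f) m a =
    \sum_(q <- pures (coact m))
      algC_eval f q.2
        (amul (lact (Sinv q.1) a`_n.+1) a`_0 :: take n (behead a));
  alg_codegen : forall n i f m (a : n.+1.-tuple A), (i <= n)%N ->
    algC_eval (codegen D n i f) m a =
    algC_eval f m (take i.+1 a ++ aone :: drop i.+1 a);
  alg_cocyc : forall n f m (a : n.+1.-tuple A),
    algC_eval (cocyc D n f) m a =
    \sum_(q <- pures (coact m))
      algC_eval f q.2 (lact (Sinv q.1) a`_n :: take n a)
}.
End AlgebraCochains.

Section Precomp.
Variables (k : fieldType) (U W : lmodType k) (L : {linear U -> W}).

Fact precomp_subproof (f : dual W) :
  (fun x => subspace_val f (L x)) \in @linform k U.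
Proof.
case: f => f /=; rewrite !unfold_in => /asboolP lf; apply/asboolP => a x y.
by rewrite linearP lf.
Qed.

Definition precomp_fun (f : dual W) : dual U := Subspace (precomp_subproof f).

Fact precomp_linear : linear precomp_fun.
Proof. by move=> a f g; apply: val_inj. Qed.

Definition precomp : {linear dual W -> dual U} := lin_of precomp_linear.
End Precomp.

Section UsualCyclic.
Variables (k : fieldType) (A : unitalAlgType k).

Definition usualC (n : nat) : lmodType k := dual (tpow A n).

Definition usualC_eval n (f : usualC n) (a : seq A) : k :=
  subspace_val f (tpure n a).

Let linear_slot (phi : A -> A) := linear phi.

Let slot_linear n (F : seq A -> seq A) s1 s2 :
  (exists t1 t2 phi, [/\ linear_slot phi, (size t1 + size t2)%N = n
     & forall x, F (s1 ++ x :: s2) = t1 ++ phi x :: t2]) ->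
  linear (fun x => tpure n (F (s1 ++ x :: s2))).
Proof.
move=> [t1 [t2 [phi [lphi sz FE]]]] a x y; rewrite !FE lphi.
exact: (tpure_multilinear sz).
Qed.

Let linear_slot_id : linear_slot id. Proof. by []. Qed.
Let linear_slotl x : linear_slot (amul x) := amul_bilinear.2 x.
Let linear_slotr x : linear_slot (amul^~ x) := amul_bilinear.1 x.

Fact face_multilinear n i :
  multilinear n.+1 (fun a => tpure n (face_seq (0 : A) amul n i a)).
Proof.
move=> s1 s2 sz; apply: slot_linear.
exact: (face_slot 0 linear_slot_id linear_slotl linear_slotr i sz).
Qed.

Fact degen_multilinear n i :
  multilinear n (fun a => tpure n.+1 (degen_seq (aone : A) i a)).
Proof.
move=> s1 s2 sz; apply: slot_linear.
exact: (degen_slot _ linear_slot_id i sz).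
Qed.

Fact cyc_multilinear n : multilinear n (fun a => tpure n (cyc_seq (0 : A) n a)).
Proof.
move=> s1 s2 sz; apply: slot_linear.
exact: (cyc_slot 0 linear_slot_id sz).
Qed.

Definition usual_ops : cocyclic_ops usualC := CocyclicOps
  (fun n i => precomp (sval (tpow_lift (@face_multilinear n i))))
  (fun n i => precomp (sval (tpow_lift (@degen_multilinear n i))))
  (fun n => precomp (sval (tpow_lift (@cyc_multilinear n)))).

Lemma usual_coface n i f (a : n.+2.-tuple A) : (i <= n)%N ->
  usualC_eval (coface usual_ops n i f) a =
  usualC_eval f (take i a ++ amul a`_i a`_i.+1 :: drop i.+2 a).
Proof.
move=> le_in; rewrite /usualC_eval /= (svalP (tpow_lift _)).
by rewrite /face_seq le_in.
Qed.

Lemma usual_coface_last n f (a : n.+2.-tuple A) :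
  usualC_eval (coface usual_ops n n.+1 f) a =
  usualC_eval f (amul a`_n.+1 a`_0 :: take n (behead a)).
Proof.
rewrite /usualC_eval /= (svalP (tpow_lift _)).
by rewrite /face_seq ltnn.
Qed.

Lemma usual_codegen n i f (a : n.+1.-tuple A) :
  usualC_eval (codegen usual_ops n i f) a =
  usualC_eval f (take i.+1 a ++ aone :: drop i.+1 a).
Proof. by rewrite /usualC_eval /= (svalP (tpow_lift _)). Qed.

Lemma usual_cocyc n f (a : n.+1.-tuple A) :
  usualC_eval (cocyc usual_ops n f) a = usualC_eval f (a`_n :: take n a).
Proof. by rewrite /usualC_eval /= (svalP (tpow_lift _)). Qed.
End UsualCyclic.

Definition usualHC (k : fieldType) (A : unitalAlgType k) (n : nat) :
  lmodType k := HC (usual_ops A) n.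

Record coalg_action (k : fieldType) (H : hopfType k) (C : hmodCoalgType H)
    (A : hmodAlgType H) (act : C -> A -> A) : Prop := CoalgAction {
  cact_bilinear : bilinear_for *:%R *:%R act;
  cact_mul : forall c a b, act c (amul a b) =
    \sum_(p <- pures (comul c)) amul (act p.1 a) (act p.2 b);
  cact_one : forall c, act c aone = counit c *: aone;
  cact_lact : forall h c a, lact h (act c a) = act (lact h c) a
}.

(* Main.v *)
(* In degree n both kinds of cochains come from M \ox_H V^(n+1), with V = C or    *)
(* A: the cochains of C are its elements and those of A are its linear forms. On *)
(* it the rotation                                                               *)
(*   t (m \ox v_0 \ox .. \ox v_n) = m^(0) \ox v_1 \ox .. \ox v_n \ox m^(-1) v_0       *)
(* is well defined by the anti-Yetter-Drinfeld condition. Coassociativity of the *)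
(* coaction gives t^(n+1) (m \ox v) = m^(0) \ox m^(-1) v = m^(0) m^(-1) \ox v,     *)
(* which is m \ox v by stability. So t is invertible; for C it is tau_n, and for *)
(* A the operator tau_n of the statement is the transpose of t^-1, which avoids  *)
(* checking directly that the formula with S^-1 is balanced.                     *)
(*                                                                               *)
(* If c acts on a, then the forms f (m \ox c_0 a_0 \ox .. \ox c_n a_n) define a     *)
(* pairing of the cochains of C and A that commutes with all cofaces and with    *)
(* tau. A 0-cocycle x satisfies delta_0 x = delta_1 x, hence its iterated        *)
(* cofaces x_n satisfy delta_i x_n = x_(n+1) for all i and tau x_n = x_n, so     *)
(* pairing with x_n is a morphism of cocyclic modules, which passes to           *)
(* cohomology. The iterated cofaces of f and of m \ox c are f (m \ox a_0 .. a_n)  *)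
(* and m \ox c^(1) \ox .. \ox c^(n+1), whence the two formulas.                    *)

(* All three parts rest on the rotation [tau] of M \ox_H V^(n+1), for a left H-module V. The
   anti-Yetter-Drinfeld condition makes it well defined ([rot_act_diag], [tau_subproof]).
   Coassociativity of the coaction and stability give tau^(n+1) = 1 ([iter_tau], [sum_cosweedler],
   [iter_tau_id]). Hence tau^-1 = tau^n, and [iter_tau_inv] computes it as the formula with S^-1.

   Since the last coface is tau_n delta_0, [inner_cocyclicP] leaves only the identities that avoid
   it, plus sigma_0 delta_1 = id in degree 0. The other cofaces and the degeneracies are induced by
   maps of tensor powers that commute with the diagonal action: [del] and [sig] for C, [fac] and
   [ins] for A. Their identities reduce, factor by factor, to coassociativity and counit,
   respectively to associativity and unit. For A, [hat] turns cochains into linear forms on M \ox_H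
   A^(n+1), and the operators are transposes.

   For the cup products, [cochain_pairing] lets C^(n+1) act on A^(n+1) and then applies the form.
   The axiom for c(ab) gives compatibility with the inner cofaces ([fac_pact_del]), and h(ca) =
   (hc)a gives compatibility with tau ([tpact_tau]), hence with all cofaces. The iterated cofaces of
   a 0-cocycle are fixed by tau and have equal cofaces ([coface_last_coface], [cocyc_last_coface]),
   so pairing with them preserves cyclic cocycles and coboundaries, and [cohomology_pairing] passes
   to classes. *)
Require Import Defs.
From mathcomp Require Import all_boot all_algebra.
From mathcomp Require Import boolp functions zify.

Set Implicit Arguments.
Unset Strict Implicit.
Unset Printing Implicit Defensive.

Import GRing.Theory.
Local Open Scope ring_scope.

(** * Linear maps on tensor products, Sweedler sums *)

Section LinearCombinators.
Variable k : fieldType.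
Implicit Types U V W E : lmodType k.

(* [lin] hides the quantifiers of [linear] from [intros], which lets [lin_tac] *)
(* work by matching on goals of the form [lin (fun x => _)].                  *)
Definition lin U E (f : U -> E) : Prop := linear f.

Lemma lin_id U : lin (fun x : U => x). Proof. by []. Qed.

Lemma lin_comp U V E (f : {linear V -> E}) (g : U -> V) :
  lin g -> lin (fun x => f (g x)).
Proof. by move=> lg a x y; rewrite lg linearP. Qed.

Lemma lin_compl U V E (f : V -> E) (g : U -> V) :
  lin f -> lin g -> lin (fun x => f (g x)).
Proof. by move=> lf lg a x y; rewrite lg lf. Qed.

Lemma lin_scalel U E (f : U -> k^o) (v : E) :
  lin f -> lin (fun x => (f x : k) *: v).
Proof. by move=> lf a x y; rewrite lf scalerDl scalerA. Qed.

Lemma lin_scaler U E c (f : U -> E) : lin f -> lin (fun x => c *: f x).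
Proof. by move=> lf a x y; rewrite lf scalerDr !scalerA mulrC. Qed.

Lemma lin_add U E (f g : U -> E) : lin f -> lin g -> lin (fun x => f x + g x).
Proof. by move=> lf lg a x y; rewrite lf lg scalerDr addrACA. Qed.

Lemma lin_tensl U V W (g : U -> V) (w : W) : lin g -> lin (fun x => g x \ox w).
Proof. by move=> lg a x y; rewrite lg; exact: (tens_bilinear V W).1. Qed.

Lemma lin_tensr U V W (v : V) (g : U -> W) : lin g -> lin (fun x => v \ox g x).
Proof. by move=> lg a x y; rewrite lg; exact: (tens_bilinear V W).2. Qed.

Lemma lin_sum U E I (r : seq I) (F : U -> I -> E) :
  (forall i, lin (F^~ i)) -> lin (fun x => \sum_(i <- r) F x i).
Proof. by move=> lF; exact: (sum_linear r (f := fun i x => F x i)). Qed.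

(** The general term is a function of the bound pair, as in Sweedler sums, rather than a curried
    bilinear map; both the tensor and its presentation by [pures] vary with [x]. *)
Lemma lin_pures U V W E (T : U -> tensor V W) (F : V * W -> E) : lin T ->
    (forall w, lin (fun v => F (v, w))) -> (forall v, lin (fun w => F (v, w))) ->
  lin (fun x => \sum_(p <- pures (T x)) F p).
Proof.
move=> lT F1 F2 a x y; rewrite lT.
have eF t : \sum_(p <- pures t) F p = \sum_(p <- pures t) F (p.1, p.2).
  by apply: eq_bigr => -[].
rewrite !eF; apply: (@sum_pures_linear _ _ _ _ (fun v w => F (v, w))).
by split=> [w|v]; [exact: F1 | exact: F2].
Qed.

Lemma sum_pures V W E (F : V * W -> E) v w :
    (forall w, lin (fun v => F (v, w))) -> (forall v, lin (fun w => F (v, w))) ->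
  \sum_(p <- pures (v \ox w)) F p = F (v, w).
Proof.
move=> F1 F2; rewrite (eq_bigr (fun p => F (p.1, p.2))); last by case.
apply: (@sum_pures_tens _ _ _ _ (fun v w => F (v, w))).
by split=> [w'|v']; [exact: F1 | exact: F2].
Qed.

Lemma lin_apply_sum U E (f : U -> E) I (r : seq I) (F : I -> U) :
  lin f -> f (\sum_(i <- r) F i) = \sum_(i <- r) f (F i).
Proof. by move=> lf; exact: (linear_sum (lin_of lf)). Qed.

Lemma lin_applyZ U E (f : U -> E) a u : lin f -> f (a *: u) = a *: f u.
Proof. by move=> lf; exact: (linearZ_LR (lin_of lf)). Qed.

Lemma lin_applyB U E (f : U -> E) u v : lin f -> f (u - v) = f u - f v.
Proof. by move=> lf; exact: (linearB (lin_of lf)). Qed.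

Lemma lin_apply0 U E (f : U -> E) : lin f -> f 0 = 0.
Proof. by move=> lf; exact: (linear0 (lin_of lf)). Qed.

Lemma tens_suml V W I (r : seq I) (F : I -> V) (w : W) :
  (\sum_(i <- r) F i) \ox w = \sum_(i <- r) F i \ox w.
Proof. exact/(lin_apply_sum (f := fun v => v \ox w))/lin_tensl. Qed.

Lemma tens_sumr V W I (r : seq I) (v : V) (F : I -> W) :
  v \ox (\sum_(i <- r) F i) = \sum_(i <- r) v \ox F i.
Proof. exact/(lin_apply_sum (f := tens v))/lin_tensr. Qed.

Lemma tensor_ext V W E (f g : tensor V W -> E) : lin f -> lin g ->
  (forall v w, f (v \ox w) = g (v \ox w)) -> f =1 g.
Proof.
move=> lf lg fg t; rewrite [t]puresE !lin_apply_sum //.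
by apply: eq_bigr => p _; exact: fg.
Qed.

Lemma tpow_tens_ext V n E (f g : tpow V n.+1 -> E) : lin f -> lin g ->
  (forall (v : V) (t : tpow V n), f (v \ox t) = g (v \ox t)) -> f =1 g.
Proof. exact: tensor_ext. Qed.

Lemma tpow_seq_ext V n E (f g : tpow V n -> E) : lin f -> lin g ->
  (forall s, size s = n.+1 -> f (tpure n s) = g (tpure n s)) -> f =1 g.
Proof.
move=> lf lg fg; apply: (tpow_ext (f := lin_of lf) (g := lin_of lg)) => s /=.
by apply: fg; rewrite size_tuple.
Qed.

Lemma quotv_lift V E (S : submodClosed V) (L : V -> E) : lin L ->
    (forall u, u \in S -> L u = 0) ->
  {L' : {linear quotv S -> E} | forall v, L' (quotv_class S v) = L v}.
Proof.
move=> lL L0; pose L' (y : quotv S) := L (repr y).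
have LE v : L' (quotv_class S v) = L v.
  apply/eqP; rewrite -subr_eq0 -(lin_applyB _ _ lL); apply/eqP/L0/quotv_eq.
  exact: quotv_classK.
have lL' : linear L'.
  move=> a x y; rewrite -[x]quotv_classK -[y]quotv_classK -linearP !LE.
  exact: lL.
by exists (lin_of lL').
Qed.
End LinearCombinators.

Section BalancedLift.
Variables (k : fieldType) (H : hopfType k) (M : rightHModType H).
Variables (N : lmodType k) (act : H -> N -> N).

Lemma lin_tensHl (U : lmodType k) (g : U -> M) x :
  lin g -> lin (fun u => tensH act (g u) x).
Proof. by move=> lg a u v; rewrite /tensH lin_tensl // linearP. Qed.

Lemma lin_tensHr (U : lmodType k) m (g : U -> N) :
  lin g -> lin (fun u => tensH act (m : M) (g u)).
Proof. by move=> lg a u v; rewrite /tensH lin_tensr // linearP. Qed.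

Lemma tensH_act m h x : tensH act (ract m h) x = tensH act (m : M) (act h x).
Proof. by apply/quotv_eq/mem_span. Qed.

Lemma tensH_suml I (r : seq I) (F : I -> M) x :
  tensH act (\sum_(i <- r) F i) x = \sum_(i <- r) tensH act (F i) x.
Proof. exact/(lin_apply_sum (f := fun m => tensH act m x))/lin_tensHl. Qed.

Lemma tensH_sumr I (r : seq I) (m : M) (F : I -> N) :
  tensH act m (\sum_(i <- r) F i) = \sum_(i <- r) tensH act m (F i).
Proof. exact/(lin_apply_sum (f := tensH act m))/lin_tensHr. Qed.

Lemma tensHE (y : tensorH M act) :
  y = \sum_(p <- pures (repr y : tensor M N)) tensH act p.1 p.2.
Proof.
by rewrite -[LHS]quotv_classK [X in quotv_class _ X]puresE linear_sum.
Qed.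

Lemma tensorH_ext (E : lmodType k) (f g : tensorH M act -> E) : lin f -> lin g ->
  (forall m x, f (tensH act m x) = g (tensH act m x)) -> f =1 g.
Proof.
move=> lf lg fg y; rewrite [y]tensHE !lin_apply_sum //.
by apply: eq_bigr => p _.
Qed.

(** Universal property of M \ox_H N, through which the operators on cochains are built. It lives in
    a sigma type so that the induced map can be extracted with [sval]. *)
Lemma tensorH_lift (E : lmodType k) (F : M -> N -> E) :
    (forall x, lin (F^~ x)) -> (forall m, lin (F m)) ->
    (forall m h x, F (ract m h) x = F m (act h x)) ->
  {L : {linear tensorH M act -> E} | forall m x, L (tensH act m x) = F m x}.
Proof.
move=> F1 F2 Fb; pose L0 t := \sum_(p <- pures t) F p.1 p.2.
have lL0 : lin L0 by rewrite /L0; apply: lin_pures.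
have L0E m x : L0 (m \ox x) = F m x by rewrite /L0 sum_pures.
have [u|L LE] := quotv_lift (S := Defs.span (@balanced_rel _ _ M N act)) lL0.
  rewrite unfold_in => /asboolP; elim=> [|a {}u v Gu _ IH].
    exact: lin_apply0.
  rewrite lL0 IH addr0; case: Gu => m h x.
  by rewrite (lin_applyB _ _ lL0) !L0E Fb subrr scaler0.
by exists L => m x; rewrite LE L0E.
Qed.
End BalancedLift.

Section HopfLinear.
Variables (k : fieldType) (H : hopfType k).
Implicit Types U : lmodType k.

Lemma lin_mull U (g : U -> H) (b : H) : lin g -> lin (fun x => g x * b).
Proof. by move=> lg a x y; rewrite lg mulrDl scalerAl. Qed.

Lemma lin_mulr U (b : H) (g : U -> H) : lin g -> lin (fun x => b * g x).
Proof. by move=> lg a x y; rewrite lg mulrDr scalerAr. Qed.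

Lemma lin_lactl U (V : leftHModType H) (g : U -> H) (v : V) :
  lin g -> lin (fun x => lact (g x) v).
Proof. by move=> lg a x y; rewrite lg; exact: lact_bilinear.1. Qed.

Lemma lin_lactr U (V : leftHModType H) h (g : U -> V) :
  lin g -> lin (fun x => lact h (g x)).
Proof. by move=> lg a x y; rewrite lg; exact: lact_bilinear.2. Qed.

Lemma lin_ractl U (M : rightHModType H) (g : U -> M) (h : H) :
  lin g -> lin (fun x => ract (g x) h).
Proof. by move=> lg a x y; rewrite lg; exact: ract_bilinear.1. Qed.

Lemma lin_ractr U (M : rightHModType H) (m : M) (g : U -> H) :
  lin g -> lin (fun x => ract m (g x)).
Proof. by move=> lg a x y; rewrite lg; exact: ract_bilinear.2. Qed.

Lemma lin_diagr U (V : leftHModType H) n h (g : U -> tpow V n) :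
  lin g -> lin (fun x => diag n h (g x)).
Proof. by move=> lg a x y; rewrite lg; exact: diag_linear. Qed.
End HopfLinear.

(** A hook, redefined with [::=] whenever new linear operators appear, so that [lin_tac] keeps
    working on terms that contain them. *)
Ltac lin_extra := fail.

Ltac lin_step := first
  [ progress intros; cbn [fst snd]
  | lazymatch goal with |- lin (fun x => x) => exact: lin_id end
  | lazymatch goal with
    | |- lin (fun _ => _) => fail
    | |- lin ?f => change (lin (fun x => f x)); cbn beta
    end
  (* A fixed range is handled by [lin_sum]; a range that varies with [x] makes it fail and is left
     to [lin_pures]. *)
  | lazymatch goal with |- lin (fun x => \sum_(p <- @?r x) _) =>
      lazymatch r with (fun _ => _) => apply: lin_sum end
    end
  | match goal with
    | |- lin (fun x => \sum_(p <- pures (@?T x)) _) =>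
        apply: (@lin_pures _ _ _ _ _ T)
    | |- lin (fun x => @?g x \ox ?w) => apply: (@lin_tensl _ _ _ _ g)
    | |- lin (fun x => @?f x + @?g x) => apply: (@lin_add _ _ _ f g)
    | |- lin (fun x => ?v \ox @?g x) => apply: (@lin_tensr _ _ _ _ _ g)
    | |- lin (fun x => ?v * @?g x) => apply: (@lin_mulr _ _ _ _ g)
    | |- lin (fun x => @?g x * ?w) => apply: (@lin_mull _ _ _ g)
    | |- lin (fun x => ?v *: @?g x) => apply: (@lin_scaler _ _ _ _ g)
    | |- lin (fun x => @?g x *: ?v) => apply: (@lin_scalel _ _ _ g)
    | |- lin (fun x => lact ?v (@?g x)) => apply: (@lin_lactr _ _ _ _ _ g)
    | |- lin (fun x => lact (@?g x) ?v) => apply: (@lin_lactl _ _ _ _ g)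
    | |- lin (fun x => ract ?v (@?g x)) => apply: (@lin_ractr _ _ _ _ _ g)
    | |- lin (fun x => ract (@?g x) ?v) => apply: (@lin_ractl _ _ _ _ g)
    | |- lin (fun x => diag ?n ?h (@?g x)) => apply: (@lin_diagr _ _ _ _ n h g)
    | |- lin (fun x => tensH _ ?v (@?g x)) => apply: (@lin_tensHr _ _ _ _ _ _ _ g)
    | |- lin (fun x => tensH _ (@?g x) ?v) => apply: (@lin_tensHl _ _ _ _ _ _ g)
    | h : lin ?f |- @lin _ ?U _ (fun x => ?f (@?g x)) =>
        refine (@lin_compl _ U _ _ f g h _)
    | h : forall m, lin (?G m) |- @lin _ ?U _ (fun x => ?G ?m (@?g x)) =>
        refine (@lin_compl _ U _ _ (G m) g (h m) _)
    | h : forall w, lin (fun m => ?G m w) |- @lin _ ?U _ (fun x => ?G (@?g x) ?w) =>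
        refine (@lin_compl _ U _ _ (fun m => G m w) g (h w) _)
    | |- lin (fun x => GRing.Linear.sort _ (@?g x)) =>
        apply: (@lin_comp _ _ _ _ _ g)
    end
  | lin_extra ].

Ltac lin_tac := try (solve [repeat lin_step; try by []]).

(** * Sweedler calculus and the antipode *)

Section HopfTheory.
Variables (k : fieldType) (H : hopfType k).

Section Coassociativity.
Variables (C : coalgType k) (E : lmodType k).

(** A trilinear [F] factors through a linear map [L] on C \ox (C \ox C); apply [L] to the axiom
    [comulA]. *)
Lemma comul_assocF (F : C -> C -> C -> E) c :
    (forall y z, lin (fun x => F x y z)) -> (forall x z, lin (fun y => F x y z)) ->
    (forall x y, lin (fun z => F x y z)) ->
  \sum_(p <- pures (comul c)) \sum_(q <- pures (comul p.1)) F q.1 q.2 p.2 =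
  \sum_(p <- pures (comul c)) \sum_(q <- pures (comul p.2)) F p.1 q.1 q.2.
Proof.
move=> F1 F2 F3.
pose L t := \sum_(p <- pures t) \sum_(q <- pures (p.2 : tensor C C)) F p.1 q.1 q.2.
have lL : lin L by rewrite /L; lin_tac.
have LE x y z : L (x \ox (y \ox z)) = F x y z.
  by rewrite /L sum_pures; lin_tac; cbn; rewrite sum_pures; lin_tac.
have := congr1 L (comulA c).
rewrite !(lin_apply_sum _ _ lL).
under eq_bigr => p _ do (rewrite (lin_apply_sum _ _ lL); under eq_bigr do rewrite LE).
by under [in RHS]eq_bigr => p _ do
  (rewrite (lin_apply_sum _ _ lL); under eq_bigr do rewrite LE).
Qed.

(* The general term is a function [G] of the two bound pairs so that rewriting *)
(* finds it by higher-order pattern unification; the first hypothesis says    *)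
(* that it ignores the component that has been split.                         *)
Lemma comul_assocl (G : C * C -> C * C -> E) c :
    (forall p q, G p q = G (0, p.2) q) ->
    (forall y z, lin (fun x => G (0, z) (x, y))) ->
    (forall x z, lin (fun y => G (0, z) (x, y))) ->
    (forall x y, lin (fun z => G (0, z) (x, y))) ->
  \sum_(p <- pures (comul c)) \sum_(q <- pures (comul p.1)) G p q =
  \sum_(p <- pures (comul c)) \sum_(q <- pures (comul p.2)) G (0, q.2) (p.1, q.1).
Proof.
move=> G0 G1 G2 G3; rewrite -(comul_assocF (F := fun x y z => G (0, z) (x, y))) //.
by apply: eq_bigr => p _; apply: eq_bigr => -[q1 q2] _; rewrite G0.
Qed.

Lemma counit_suml (G : C * C -> E) c :
    (forall p, G p = G (0, p.2)) -> lin (fun x => G (0, x)) ->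
  \sum_(p <- pures (comul c)) counit p.1 *: G p = G (0, c).
Proof.
move=> G0 lF; rewrite -{2}(counitl c) (lin_apply_sum _ _ lF).
by apply: eq_bigr => p _; rewrite G0 (lin_applyZ _ _ lF).
Qed.

Lemma counit_sumr (G : C * C -> E) c :
    (forall p, G p = G (p.1, 0)) -> lin (fun x => G (x, 0)) ->
  \sum_(p <- pures (comul c)) counit p.2 *: G p = G (c, 0).
Proof.
move=> G0 lF; rewrite -{2}(counitr c) (lin_apply_sum _ _ lF).
by apply: eq_bigr => p _; rewrite G0 (lin_applyZ _ _ lF).
Qed.
End Coassociativity.

Section Coaction.
Variables (M : leftHComodType H) (E : lmodType k).

(** Coassociativity of the coaction, oriented so that a repeated coaction becomes a coproduct of
    m^(-1). The zeros fill the components that [G] ignores. *)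
Lemma coact_assoc (G : H * M -> H * M -> E) m :
    (forall p q, G p q = G (p.1, 0) q) ->
    (forall y z, lin (fun x => G (x, 0) (y, z))) ->
    (forall x z, lin (fun y => G (x, 0) (y, z))) ->
    (forall x y, lin (fun z => G (x, 0) (y, z))) ->
  \sum_(p <- pures (coact m)) \sum_(q <- pures (coact p.2)) G p q =
  \sum_(p <- pures (coact m)) \sum_(q <- pures (comul p.1)) G (q.1, 0) (q.2, p.2).
Proof.
move=> G0 F1 F2 F3.
pose L t := \sum_(p <- pures t) \sum_(q <- pures (p.2 : tensor H M))
  G (p.1, 0) (q.1, q.2).
have lL : lin L by rewrite /L; lin_tac.
have LE x y z : L (x \ox (y \ox z)) = G (x, 0) (y, z).
  by rewrite /L sum_pures; lin_tac; cbn; rewrite sum_pures; lin_tac.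
have := congr1 L (coactA m).
rewrite !(lin_apply_sum _ _ lL).
under eq_bigr => p _ do (rewrite (lin_apply_sum _ _ lL); under eq_bigr do rewrite LE).
under [in RHS]eq_bigr => p _ do
  (rewrite (lin_apply_sum _ _ lL); under eq_bigr do rewrite LE).
move=> ->; apply: eq_bigr => p _.
by apply: eq_bigr => -[q1 q2] _; rewrite G0.
Qed.

Lemma coact_counit_sum (G : H * M -> E) m :
    (forall p, G p = G (0, p.2)) -> lin (fun x => G (0, x)) ->
  \sum_(p <- pures (coact m)) counit p.1 *: G p = G (0, m).
Proof.
move=> G0 lF; rewrite -{2}(coact_counit m) (lin_apply_sum _ _ lF).
by apply: eq_bigr => p _; rewrite G0 (lin_applyZ _ _ lF).
Qed.
End Coaction.

Lemma sum_pures_sum (V W E : lmodType k) I (r : seq I) (T : I -> tensor V W)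
    (F : V * W -> E) :
    (forall w, lin (fun v => F (v, w))) -> (forall v, lin (fun w => F (v, w))) ->
  \sum_(x <- pures (\sum_(i <- r) T i)) F x =
  \sum_(i <- r) \sum_(x <- pures (T i)) F x.
Proof.
move=> F1 F2; pose L t := \sum_(x <- pures t) F x.
have lL : lin L by rewrite /L; lin_tac.
exact: (lin_apply_sum r T lL).
Qed.

Lemma sum_pures_sum2 (V W E : lmodType k) I J (r : seq I) (s : I -> seq J)
    (a : I -> J -> V) (b : I -> J -> W) (F : V * W -> E) :
    (forall w, lin (fun v => F (v, w))) -> (forall v, lin (fun w => F (v, w))) ->
  \sum_(x <- pures (\sum_(i <- r) \sum_(j <- s i) a i j \ox b i j)) F x =
  \sum_(i <- r) \sum_(j <- s i) F (a i j, b i j).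
Proof.
move=> F1 F2; rewrite sum_pures_sum //; apply: eq_bigr => i _.
by rewrite sum_pures_sum //; apply: eq_bigr => j _; rewrite sum_pures.
Qed.

Lemma sum_comulM (E : lmodType k) (F : H * H -> E) (g h : H) :
    (forall w, lin (fun v => F (v, w))) -> (forall v, lin (fun w => F (v, w))) ->
  \sum_(x <- pures (comul (g * h))) F x =
  \sum_(p <- pures (comul g)) \sum_(q <- pures (comul h))
    F (p.1 * q.1, p.2 * q.2).
Proof. by move=> F1 F2; rewrite comulM sum_pures_sum2. Qed.

(* Both sides equal the sum of S(g1 h1) (g2 h2) (S h3 S g3). *)
Lemma antipodeM (g h : H) : antipode (g * h) = antipode h * antipode g.
Proof.
pose S : H -> H := antipode.
pose F g1 g2 g3 h1 h2 h3 := S (g1 * h1) * (g2 * h2) * (S h3 * S g3).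
have FE : \sum_(p <- pures (comul g)) \sum_(q <- pures (comul p.1))
    \sum_(r <- pures (comul h)) \sum_(s <- pures (comul r.1))
    F q.1 q.2 p.2 s.1 s.2 r.2 = S h * S g.
  (* S(g1 h1) (g2 h2) collapses by [antipodel], applied to the product of the two elements. *)
  transitivity (\sum_(p <- pures (comul g)) \sum_(r <- pures (comul h))
      counit p.1 *: (counit r.1 *: (S r.2 * S p.2))).
    apply: eq_bigr => p _; rewrite exchange_big; apply: eq_bigr => r _ /=.
    under eq_bigr do rewrite -mulr_suml.
    rewrite -mulr_suml scalerA -counitM -[in RHS](mul1r (S _ * _)) scalerAl.
    by congr (_ * _); rewrite -antipodel sum_comulM //; lin_tac.
  under eq_bigr do rewrite -scaler_sumr.
  rewrite counit_suml //=; last by rewrite /S; lin_tac.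
  by rewrite counit_suml //= /S; lin_tac.
rewrite -/(S _) -[S h * S g]FE /F comul_assocl //=; try by rewrite /S; lin_tac.
under eq_bigr => p _ do under eq_bigr => q _ do
  (rewrite comul_assocl //=; try by rewrite /S; lin_tac).
(* With the other bracketing, g2 (h2 S h3) S g3 collapses by [antipoder], first for [h], then for
   [g]. *)
transitivity (\sum_(p <- pures (comul g)) counit p.2 *:
    \sum_(r <- pures (comul h)) counit r.2 *: S (p.1 * r.1)).
  rewrite counit_sumr //=; last by rewrite /S; lin_tac.
  by rewrite counit_sumr //=; rewrite /S; lin_tac.
apply: eq_bigr => p _; rewrite exchange_big scaler_sumr /=.
apply: eq_bigr => r _; rewrite exchange_big /=.
have mA (a b c d e : H) : a * (b * c) * (d * e) = a * (b * ((c * d) * e)).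
  by rewrite !mulrA.
under eq_bigr do under eq_bigr do rewrite mA.
rewrite exchange_big /=.
under eq_bigr do rewrite -!mulr_sumr -mulr_suml antipoder -scalerAl mul1r -!scalerAr.
rewrite -scaler_sumr -mulr_sumr antipoder -scalerAr mulr1.
by rewrite !scalerA mulrC.
Qed.

Lemma antipode1 : antipode (1 : H) = 1.
Proof.
have := antipodel (1 : H); rewrite comul1 sum_pures; lin_tac; move=> /=.
by rewrite mulr1 counit1 scale1r.
Qed.

Section Inverse.
Variable Sinv : H -> H.
Hypotheses (SK : cancel (antipode : H -> H) Sinv).
Hypothesis (SinvK : cancel Sinv (antipode : H -> H)).

Lemma lin_Sinv (U : lmodType k) (g : U -> H) : lin g -> lin (fun x => Sinv (g x)).
Proof. by move=> lg a x y; rewrite lg -{1}[g x]SinvK -{1}[g y]SinvK -linearP SK. Qed.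

(** The antipode is injective and antimultiplicative, and it sends h^(2) S^-1(h^(1)) to h^(1)
    S(h^(2)). *)
Lemma Sinv_mul (h : H) : \sum_(p <- pures (comul h)) p.2 * Sinv p.1 = counit h *: 1.
Proof.
rewrite -[LHS]SK -[RHS]SK; congr Sinv.
rewrite linearZ_LR antipode1 -antipoder linear_sum /=.
by apply: eq_bigr => p _; rewrite antipodeM SinvK.
Qed.
End Inverse.
End HopfTheory.

(** * The rotation of [M \ox_H V^(n+1)] *)

Section DiagonalTheory.
Variables (k : fieldType) (H : hopfType k) (V : leftHModType H).

Lemma diag_tens n h (v : V) (t : tpow V n) :
  diag n.+1 h (v \ox t) = \sum_(p <- pures (comul h)) lact p.1 v \ox diag n p.2 t.
Proof. by rewrite /= sum_pures; lin_tac. Qed.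

Lemma lin_diagl n (x : tpow V n) : lin (fun h : H => diag n h x).
Proof. by elim: n x => [|n IH] x /=; lin_tac. Qed.

Lemma lin_diagl_comp (U : lmodType k) n (g : U -> H) (x : tpow V n) :
  lin g -> lin (fun u => diag n (g u) x).
Proof. by move=> lg a u v; rewrite lg lin_diagl. Qed.

(** [tpow] associates to the right, so adding a factor at the far end takes a recursion. *)
Fixpoint snoc n (w : V) : tpow V n -> tpow V n.+1 :=
  match n return tpow V n -> tpow V n.+1 with
  | 0 => fun v => v \ox w
  | n'.+1 => fun t => \sum_(q <- pures t) q.1 \ox @snoc n' w q.2
  end.
Arguments snoc n w t : clear implicits.

Lemma lin_snocr (U : lmodType k) n w (g : U -> tpow V n) :
  lin g -> lin (fun u => snoc n w (g u)).
Proof.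
suff l m v : lin (snoc m v) by move=> lg a x y; rewrite lg l.
by elim: m v => [|m IH] v; [exact: lin_tensl | rewrite /=; lin_tac].
Qed.

Lemma lin_snocl (U : lmodType k) n (g : U -> V) (x : tpow V n) :
  lin g -> lin (fun u => snoc n (g u) x).
Proof. by move=> lg; elim: n x => [|n IH] x /=; lin_tac. Qed.

Lemma snoc_tens n w v (t : tpow V n) : snoc n.+1 w (v \ox t) = v \ox snoc n w t.
Proof. by rewrite /= sum_pures; lin_tac; move=> v'; apply/lin_tensr/lin_snocr. Qed.

Lemma snoc_tpure n w (s : seq V) : size s = n.+1 ->
  snoc n w (tpure n s) = tpure n.+1 (rcons s w).
Proof.
elim: n s => [|n IH] [|v s] //= [sz]; first by case: s sz.
by rewrite [LHS]snoc_tens IH.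
Qed.
End DiagonalTheory.
Arguments snoc {k H V} n w t.

Ltac lin_snoc := match goal with
  | |- lin (fun x => diag ?n (@?g x) ?v) => apply: (@lin_diagl_comp _ _ _ _ n g)
  | |- lin (fun x => snoc ?n ?w (@?g x)) => apply: (@lin_snocr _ _ _ _ n w g)
  | |- lin (fun x => snoc ?n (@?g x) ?v) => apply: (@lin_snocl _ _ _ _ n g)
  end.
Ltac lin_extra ::= lin_snoc.

Section RotationAction.
Variables (k : fieldType) (H : hopfType k) (V : leftHModType H).

(** [diag] splits off the first leg of the coproduct while [snoc] requires the last one;
    coassociativity reconciles the two. *)
Lemma diag_snoc n h (w : V) (t : tpow V n) :
  diag n.+1 h (snoc n w t) =
  \sum_(p <- pures (comul h)) snoc n (lact p.2 w) (diag n p.1 t).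
Proof.
elim: n h t => [|n IH] h t; first by rewrite [LHS]diag_tens.
move: t; apply: tpow_tens_ext; [by lin_tac | by lin_tac |] => v t.
rewrite [snoc _ _ _]snoc_tens diag_tens.
under eq_bigr do rewrite IH.
under eq_bigr do rewrite tens_sumr.
under [RHS]eq_bigr => p _.
  rewrite diag_tens (lin_apply_sum (f := snoc n.+1 _)); lin_tac.
  under eq_bigr do rewrite snoc_tens.
  over.
rewrite comul_assocl; lin_tac.
Qed.

Lemma diagM n g h (t : tpow V n) : diag n (g * h) t = diag n g (diag n h t).
Proof.
elim: n g h t => [|n IH] g h t; first exact: lactM.
move: t; apply: tpow_tens_ext => [||v t]; [by lin_tac | by lin_tac |].
rewrite !diag_tens (lin_apply_sum (f := diag n.+1 g)); lin_tac.
rewrite sum_comulM; lin_tac; rewrite exchange_big.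
apply: eq_bigr => q _; rewrite diag_tens; apply: eq_bigr => p _ /=.
by rewrite lactM IH.
Qed.

Lemma diag1 n (t : tpow V n) : diag n 1 t = t.
Proof.
elim: n t => [|n IH] t; first exact: lact1.
move: t; apply: tpow_tens_ext => [||v t]; [by lin_tac | by lin_tac |].
by rewrite diag_tens comul1 sum_pures; lin_tac; rewrite /= lact1 IH.
Qed.

(* The rotation v_0 \ox v_1 \ox .. \ox v_n |-> v_1 \ox .. \ox v_n \ox h v_0. *)
Definition rot_act n (h : H) : tpow V n -> tpow V n :=
  match n return tpow V n -> tpow V n with
  | 0 => lact h
  | n'.+1 => fun t => \sum_(q <- pures t) snoc n' (lact h q.1) q.2
  end.
Arguments rot_act n h t : clear implicits.

Lemma rot_act_tens n h v (t : tpow V n) :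
  rot_act n.+1 h (v \ox t) = snoc n (lact h v) t.
Proof. by rewrite /= sum_pures; lin_tac. Qed.

Lemma lin_rot_actr (U : lmodType k) n h (g : U -> tpow V n) :
  lin g -> lin (fun u => rot_act n h (g u)).
Proof. by case: n g => [|n] g lg /=; lin_tac. Qed.

Lemma lin_rot_actl (U : lmodType k) n (g : U -> H) x :
  lin g -> lin (fun u => rot_act n (g u) x).
Proof. by case: n x => [|n] x lg /=; lin_tac. Qed.

Lemma rot_act_tpure n h v (s : seq V) : size s = n ->
  rot_act n h (tpure n (v :: s)) = tpure n (rcons s (lact h v)).
Proof.
case: n => [|n] sz; first by case: s sz.
by rewrite [LHS]rot_act_tens snoc_tpure.
Qed.

End RotationAction.
Arguments rot_act {k H V} n h t.

Ltac lin_rotation := first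
  [ lin_snoc
  | match goal with
    | |- lin (fun x => rot_act ?n ?w (@?g x)) => apply: (@lin_rot_actr _ _ _ _ n w g)
    | |- lin (fun x => rot_act ?n (@?g x) ?v) => apply: (@lin_rot_actl _ _ _ _ n g)
    end ].
Ltac lin_extra ::= lin_rotation.

Section Rotation.
Variables (k : fieldType) (H : hopfType k) (V : leftHModType H).

(* The anti-Yetter-Drinfeld condition reduces the compatibility of [tau] with  *)
(* the balancing relations to this identity, where the antipode cancels the    *)
(* leg of [h] that acts on the rotated factor.                                 *)
Lemma rot_act_diag n g h (x : tpow V n) :
  \sum_(p <- pures (comul h)) \sum_(q <- pures (comul p.2))
    diag n q.1 (rot_act n (antipode q.2 * g * p.1) x) =
  rot_act n g (diag n h x).
Proof.
case: n x => [|n] x.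
  rewrite /=.
  under eq_bigr => p _.
    under eq_bigr do rewrite -lactM -!mulrA mulrA.
    rewrite -(lin_apply_sum (f := fun y => lact y x)); lin_tac.
    rewrite -mulr_suml antipoder -scalerAl mul1r.
    rewrite (lin_applyZ (f := fun y => lact y x)); lin_tac.
    over.
  by rewrite counit_sumr; lin_tac; rewrite lactM.
move: x; apply: tpow_tens_ext => [||v t]; [by lin_tac | by lin_tac |].
rewrite diag_tens (lin_apply_sum (f := rot_act n.+1 g)); lin_tac.
under [RHS]eq_bigr do rewrite rot_act_tens.
apply: (etrans (y := \sum_(p <- pures (comul h))
  \sum_(q <- pures (comul p.2)) counit q.2 *:
    snoc n (lact g (lact p.1 v)) (diag n q.1 t))); last first.
  by apply: eq_bigr => p _; rewrite counit_sumr; lin_tac.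
apply: eq_bigr => p _.
under eq_bigr do rewrite rot_act_tens diag_snoc.
rewrite comul_assocl; lin_tac; apply: eq_bigr => q _ /=.
(* The last two legs of [h] now meet as h^(3) S(h^(4)) in front of g h^(1) v, and cancel. *)
under eq_bigr do rewrite -lactM -!mulrA mulrA.
rewrite -(lin_apply_sum (f := fun y => snoc n (lact y v) (diag n q.1 t))); lin_tac.
rewrite -mulr_suml antipoder -scalerAl mul1r.
rewrite (lin_applyZ (f := fun y => snoc n (lact y v) (diag n q.1 t))); lin_tac.
by rewrite lactM.
Qed.

Variable M : saydType H.

Definition vtens n (m : M) (s : seq V) : tensorH M (@diag k H V n) :=
  tensH (@diag k H V n) m (tpure n s).

Lemma vtens_ext n (E : lmodType k) (f g : tensorH M (@diag k H V n) -> E) :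
    lin f -> lin g ->
  (forall m s, size s = n.+1 -> f (vtens n m s) = g (vtens n m s)) -> f =1 g.
Proof.
move=> lf lg fg; apply: tensorH_ext => // m.
apply: tpow_seq_ext => [||s sz]; last exact: fg.
  by apply: (lin_compl lf); lin_tac.
by apply: (lin_compl lg); lin_tac.
Qed.

Lemma tau_subproof n : {L : {linear tensorH M (@diag k H V n) ->
    tensorH M (@diag k H V n)} | forall m x, L (tensH _ m x) =
    \sum_(q <- pures (coact m)) tensH _ q.2 (rot_act n q.1 x)}.
Proof.
apply: tensorH_lift => [x|m|m h x]; [by lin_tac | by lin_tac |].
(* The leg h^(2) that [ayd] leaves on M crosses the balanced tensor by [tensH_act], which gives the
   left-hand side of [rot_act_diag]. *)
rewrite ayd sum_pures_sum; lin_tac.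
apply: eq_bigr => q _.
rewrite sum_pures_sum2; lin_tac => /=.
rewrite -rot_act_diag tensH_sumr; apply: eq_bigr => p _.
by rewrite tensH_sumr; apply: eq_bigr => r _; rewrite tensH_act.
Qed.

Definition tau n := sval (tau_subproof n).

Lemma tauE n m x :
  tau n (tensH _ m x) = \sum_(q <- pures (coact m)) tensH _ q.2 (rot_act n q.1 x).
Proof. exact: (svalP (tau_subproof n)). Qed.

Lemma tau_vtens n m v (s : seq V) : size s = n ->
  tau n (vtens n m (v :: s)) =
  \sum_(q <- pures (coact m)) vtens n q.2 (rcons s (lact q.1 v)).
Proof.
move=> sz; rewrite /vtens tauE.
by apply: eq_bigr => q _; rewrite rot_act_tpure.
Qed.

(* The Sweedler legs of the iterated coaction: ([:: m^(-n); ..; m^(-1)], m^(0)). *)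
Fixpoint cosweedler n (m : M) : seq (seq H * M) :=
  if n is n'.+1 then
    [seq (q.1 :: r.1, r.2) | q <- pures (coact m), r <- cosweedler n' q.2]
  else [:: ([::], m)].

Lemma cosweedlerS (E : lmodType k) n m (F : seq H * M -> E) :
  \sum_(r <- cosweedler n.+1 m) F r =
  \sum_(q <- pures (coact m)) \sum_(r <- cosweedler n q.2) F (q.1 :: r.1, r.2).
Proof. by rewrite big_allpairs_dep. Qed.

Definition lact_seq (s : seq H) (c : seq V) : seq V :=
  [seq lact p.1 p.2 | p <- zip s c].

(** Each rotation spends one leg of the iterated coaction on the factor it moves, so after [j]
    rotations the first [j] factors stand at the end with their legs in order. The case j = n.+1,
    where nothing remains in front, is the one behind tau^(n+1) = 1. *)
Lemma iter_tau n j m (s : seq V) : size s = n.+1 -> (j <= n.+1)%N ->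
  iter j (tau n) (vtens n m s) =
  \sum_(r <- cosweedler j m) vtens n r.2 (drop j s ++ lact_seq r.1 (take j s)).
Proof.
elim: j m s => [|j IH] m [|v s] //= [sz] le_jn.
  by rewrite big_seq1 cats0.
rewrite -iterS iterSr tau_vtens // cosweedlerS.
rewrite (lin_apply_sum (f := iter j (tau n))); last first.
  by elim: j {IH le_jn} => [|j IH] /=; lin_tac; apply: lin_comp.
apply: eq_bigr => q _; rewrite IH ?size_rcons ?sz //; last exact: ltnW.
apply: eq_bigr => r _ /=; rewrite drop_rcons ?sz // cat_rcons.
by rewrite -cats1 takel_cat ?sz.
Qed.
(** By [coact_assoc] the legs of the iterated coaction are those of the iterated coproduct of
    m^(-1); acting with them factor by factor is the diagonal action. *)
Lemma sum_cosweedler n (E : lmodType k) (G : M -> tpow V n -> E) m (c : seq V) :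
    (forall x, lin (G^~ x)) -> (forall m, lin (G m)) -> size c = n.+1 ->
  \sum_(r <- cosweedler n.+1 m) G r.2 (tpure n (lact_seq r.1 c)) =
  \sum_(q <- pures (coact m)) G q.2 (diag n q.1 (tpure n c)).
Proof.
elim: n E G m c => [|n IH] E G m [|v c] // G1 G2 [sz]; rewrite cosweedlerS.
  by apply: eq_bigr => q _; rewrite big_seq1; case: c sz.
transitivity (\sum_(p <- pures (coact m)) \sum_(q <- pures (coact p.2))
    G q.2 (lact p.1 v \ox diag n q.1 (tpure n c))).
  apply: eq_bigr => q _.
  rewrite -(IH _ (fun m t => G m (lact q.1 v \ox t))) // => m'.
  by apply: (lin_compl (G2 m')); lin_tac.
rewrite coact_assoc; lin_tac.
apply: eq_bigr => q _ /=; rewrite sum_pures; lin_tac.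
by rewrite (lin_apply_sum _ _ (G2 _)).
Qed.

Lemma iter_tau_id n x : iter n.+1 (tau n) x = x.
Proof.
move: x; apply: vtens_ext => [||m s sz]; last 1 first.
(* Stability enters here, replacing [m] on the right by m^(0) m^(-1). *)
- rewrite iter_tau // -[RHS]/(tensH _ m _) -{2}(stable m) tensH_suml.
  rewrite take_oversize ?sz // drop_oversize ?sz //=.
  rewrite (sum_cosweedler (G := fun m x => tensH _ m x)) //; lin_tac.
  by apply: eq_bigr => q _; rewrite tensH_act.
- by elim: n.+1 => [|j IH] /=; lin_tac; apply: lin_comp.
- by [].
Qed.

Section Inverse.
Variable Sinv : H -> H.
Hypotheses (SK : cancel (antipode : H -> H) Sinv).
Hypothesis (SinvK : cancel Sinv (antipode : H -> H)).

(** As tau^(n+1) = 1, it is enough that [tau] sends the right-hand side to [vtens n m (rcons s v)].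
    There the two coaction legs meet as m^(-1) S^-1(m^(-2)) and cancel by [Sinv_mul]. *)
Lemma iter_tau_inv n m v (s : seq V) : size s = n ->
  iter n (tau n) (vtens n m (rcons s v)) =
  \sum_(q <- pures (coact m)) vtens n q.2 (lact (Sinv q.1) v :: s).
Proof.
move=> sz; have lv (m' : M) : lin (fun w => vtens n m' (rcons s w)).
  apply: lin_tensHr => a x y; rewrite -!cats1.
  by apply: (tpure_multilinear (s2 := [::])); rewrite addn0.
have lv1 w : lin (fun m' => vtens n m' (rcons s w)) by rewrite /vtens; lin_tac.
have lS : lin Sinv := lin_Sinv SK SinvK (@lin_id _ _).
suff <- : tau n (\sum_(q <- pures (coact m)) vtens n q.2 (lact (Sinv q.1) v :: s)) =
    vtens n m (rcons s v) by rewrite -iterSr iter_tau_id.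
rewrite linear_sum; under eq_bigr do rewrite tau_vtens //.
have lvS m' a : lin (fun h => vtens n m' (rcons s (lact h a))).
  by apply: (lin_compl (lv m')); lin_tac.
have lvS' m' h : lin (fun a => vtens n m' (rcons s (lact h a))).
  by apply: (lin_compl (lv m')); lin_tac.
rewrite coact_assoc //=; try by move=> y z; [exact: (lin_compl (lvS' z y)); lin_tac | exact: lvS].
- rewrite -[RHS](coact_counit_sum (G := fun q => vtens n q.2 (rcons s v))) //.
  apply: eq_bigr => q _; under eq_bigr do rewrite -lactM.
  rewrite -(lin_apply_sum (f := fun h => vtens n q.2 (rcons s (lact h v)))) //.
  by rewrite Sinv_mul // (lin_applyZ (f := fun h => vtens n q.2 (rcons s (lact h v)))) // lact1.
- move=> y z.
  apply: (lin_compl (f := fun a => vtens n z (rcons s (lact y a))) (lvS' z y)).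
  by lin_tac.
Qed.
End Inverse.
End Rotation.
Arguments tau {k H V} M n.
Arguments vtens {k H V M} n m s.
#[global] Arguments diag : simpl never.
#[global] Arguments snoc : simpl never.
#[global] Arguments rot_act : simpl never.

(** * Cocyclic modules and pairings with a 0-cocycle *)

Section CocyclicCriterion.
Variables (k : fieldType) (X : nat -> lmodType k) (D : cocyclic_ops X).

(* The identities that do not mention the last coface, which is tau_n delta_0. *)
(* Of those that do, only sigma_0 delta_1 = id in degree 0 has to be assumed.  *)
Record inner_cocyclic : Prop := InnerCocyclic {
  inner_coface_coface : forall n i j x, (i < j <= n.+1)%N ->
    coface D n.+1 j (coface D n i x) = coface D n.+1 i (coface D n j.-1 x);
  inner_codegen_codegen : forall n i j x, (i <= j <= n)%N ->
    codegen D n j (codegen D n.+1 i x) = codegen D n i (codegen D n.+1 j.+1 x);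
  inner_codegen_coface_lt : forall n i j x, (i < j <= n.+1)%N ->
    codegen D n.+1 j (coface D n.+1 i x) = coface D n i (codegen D n j.-1 x);
  inner_codegen_coface_eq : forall n j x, (j <= n)%N ->
    codegen D n j (coface D n j x) = x;
  inner_codegen_coface_eqS : forall n j x, (j < n)%N ->
    codegen D n j (coface D n j.+1 x) = x;
  inner_codegen_coface01 : forall x, codegen D 0 0 (coface D 0 1 x) = x;
  inner_codegen_coface_gt : forall n i j x, (j.+1 < i <= n.+1)%N ->
    codegen D n.+1 j (coface D n.+1 i x) = coface D n i.-1 (codegen D n j x);
  inner_cocyc_coface : forall n i x, (1 <= i <= n)%N ->
    cocyc D n.+1 (coface D n i x) = coface D n i.-1 (cocyc D n x);
  inner_cocyc_coface0 : forall n x,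
    coface D n n.+1 x = cocyc D n.+1 (coface D n 0 x);
  inner_cocyc_codegen : forall n i x, (1 <= i <= n)%N ->
    cocyc D n (codegen D n i x) = codegen D n i.-1 (cocyc D n.+1 x);
  inner_cocyc_codegen0 : forall n x,
    cocyc D n (codegen D n 0 x) =
    codegen D n n (cocyc D n.+1 (cocyc D n.+1 x));
  inner_cocyc_order : forall n x, iter n.+1 (cocyc D n) x = x
}.

(** The identities for the last coface follow from those for inner cofaces by conjugation with tau,
    whose order is finite. *)
Lemma inner_cocyclicP : inner_cocyclic -> is_cocyclic D.
Proof.
case=> dd ss sd_lt sd_eq sd_eqS sd01 sd_gt td td0 ts ts0 ord.
have iter_td n j x : (j <= n)%N ->
    iter j (cocyc D n.+1) (coface D n j x) = coface D n 0 (iter j (cocyc D n) x).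
  elim: j x => [//|j IH] x le_jn.
  by rewrite !iterSr td //= IH // ltnW.
(* This is tau delta_(n+1) = delta_n tau: delta_0 tau^n = tau^n delta_n, and tau has order n+2 in
   degree n+1. *)
have ttd0 n x : cocyc D n.+1 (cocyc D n.+1 (coface D n 0 x)) =
    coface D n n (cocyc D n x).
  rewrite -{1}(ord n x) iterSr -iter_td // -!iterS ord //.
(* In positive degree write x = tau y; then sigma_n tau^2 delta_1 y = tau sigma_0 delta_1 y, where
   delta_1 is inner. *)
have s_last n x : codegen D n n (coface D n n.+1 x) = x.
  case: n x => [|n] x; first exact: sd01.
  rewrite td0 -{1}(ord n.+1 x) iterS -[coface _ _ 0 _]/(coface D n.+1 1.-1 _).
  by rewrite -td // -ts0 sd_eqS // -iterS ord.
split=> //.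
- move=> n i j x /andP[lt_ij]; rewrite leq_eqVlt => /predU1P[Dj|lt_j]; last first.
    by apply: dd; rewrite lt_ij.
  rewrite {}Dj in lt_ij *; rewrite !td0 /=.
  have [le_in|lt_ni] := leqP i n.
    by rewrite -(dd n 0 i.+1) // td.
  have -> : i = n.+1 by lia.
  rewrite td0 -ttd0 -[coface _ _ 0 (cocyc _ _ _)]/(coface D n.+1 1.-1 _).
  by rewrite -td // dd.
- move=> n j x; rewrite leq_eqVlt => /predU1P[-> //|]; exact: sd_eqS.
- move=> n i j x /andP[lt_ji]; rewrite leq_eqVlt => /predU1P[Di|lt_i]; last first.
    by apply: sd_gt; rewrite lt_ji.
  rewrite {}Di in lt_ji *; rewrite !td0.
  by rewrite -[codegen _ _ j _]/(codegen D n.+1 j.+1.-1 _) -ts // sd_lt.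
- move=> n i x /andP[i_gt0]; rewrite leq_eqVlt => /predU1P[Di|lt_i]; last first.
    by apply: td; rewrite i_gt0.
  by rewrite {}Di td0 ttd0.
Qed.
End CocyclicCriterion.

Section Cocycle0.
Variables (k : fieldType) (X : nat -> lmodType k) (D : cocyclic_ops X).

(** The index is always the last one with an inner formula, so the iterates are explicit for both C
    and A. On 0-cocycles every other index gives the same result, by [coface_last_coface]. *)
Fixpoint last_coface n (x : X 0) : X n :=
  if n is n'.+1 then coface D n' n' (last_coface n' x) else x.

Lemma lin_last_coface n : lin (last_coface n).
Proof. by elim: n => [|n IH] //=; lin_tac. Qed.

Hypothesis cycD : is_cocyclic D.
Variable x : X 0.
Hypothesis dx : coface D 0 0 x = coface D 0 1 x.

(** By induction, delta_(j+1) delta_0 = delta_0 delta_j reduces every coface of the next iterate to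
    delta_0; the base case is the cocycle condition. *)
Lemma coface_last_coface n i : (i <= n.+1)%N ->
  coface D n i (last_coface n x) = last_coface n.+1 x.
Proof.
elim: n i => [|n IH] i le_in; first by case: i le_in => [|[]].
have dE j : (j <= n.+2)%N ->
    coface D n.+1 j (last_coface n.+1 x) = coface D n.+1 0 (last_coface n.+1 x).
  case: j => [//|j] le_j; rewrite -{1}(IH 0) // (coface_coface cycD) //.
  by rewrite /= (IH j).
by rewrite dE // -[RHS]/(coface D n.+1 n.+1 (last_coface n.+1 x)) dE.
Qed.

Lemma cocyc_last_coface n : cocyc D n (last_coface n x) = last_coface n x.
Proof.
case: n => [|n]; first exact: (cocyc_order cycD (n := 0)).
by rewrite -{1}(coface_last_coface (i := 0)) // (cocyc_coface0 cycD) coface_last_coface.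
Qed.
End Cocycle0.

Section CohomologyPairing.
Variable k : fieldType.

Lemma cocycle0P (X : nat -> lmodType k) (D : cocyclic_ops X) (f : cocycles D 0) :
  coface D 0 0 (subspace_val f) = coface D 0 1 (subspace_val f).
Proof.
case: f => f /=; rewrite unfold_in => /asboolP[_].
rewrite /coboundary_map big_ord_recl big_ord1 expr0 scale1r expr1 scaleN1r.
by move/eqP; rewrite subr_eq0 => /eqP.
Qed.

Variables (X Y Z : nat -> lmodType k).
Variables (DX : cocyclic_ops X) (DY : cocyclic_ops Y) (DZ : cocyclic_ops Z).
(** Both cup products are instances: the 0-cochain comes from A in one and from C in the other.
    Compatibility is asked only when that 0-cochain satisfies delta_0 y = delta_1 y. *)
Variable B : forall n, X n -> Y 0 -> Z n.
Hypothesis lBl : forall n y, lin ((@B n)^~ y).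
Hypothesis lBr : forall n x, lin (@B n x).
Hypothesis B_coface : forall n i x y,
  coface DY 0 0 y = coface DY 0 1 y -> (i <= n.+1)%N ->
  B (coface DX n i x) y = coface DZ n i (B x y).
Hypothesis B_cocyc : forall n x y,
  coface DY 0 0 y = coface DY 0 1 y -> B (cocyc DX n x) y = cocyc DZ n (B x y).

Lemma B_coboundary_map n x (f : cocycles DY 0) :
  B (coboundary_map DX (x : X n)) (subspace_val f) =
  coboundary_map DZ (B x (subspace_val f)).
Proof.
rewrite /coboundary_map (lin_apply_sum _ _ (@lBl _ _)); apply: eq_bigr => i _.
rewrite (lin_applyZ _ _ (@lBl _ _)) B_coface //; first exact: cocycle0P.
by rewrite -ltnS.
Qed.

Lemma B_cyclic n x (f : cocycles DY 0) : cyclic_cochain DX (x : X n) ->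
  cyclic_cochain DZ (B x (subspace_val f)).
Proof.
rewrite /cyclic_cochain -B_cocyc; last exact: cocycle0P.
by move=> ->; rewrite (lin_applyZ _ _ (@lBl _ _)).
Qed.

Fact pair_cocycle_subproof n (z : cocycles DX n) (f : cocycles DY 0) :
  B (subspace_val z) (subspace_val f) \in @cocycle k Z DZ n.
Proof.
case: z => z /=; rewrite !unfold_in => /asboolP[tz bz]; apply/asboolP; split.
  exact: B_cyclic.
by rewrite -B_coboundary_map bz (lin_apply0 (@lBl _ _)).
Qed.

Definition pair_cocycle n (z : cocycles DX n) (f : cocycles DY 0) : cocycles DZ n :=
  Subspace (pair_cocycle_subproof z f).

Lemma lin_pair_cocyclel n (f : cocycles DY 0) : lin (fun z : cocycles DX n => pair_cocycle z f).
Proof. by move=> a z w; apply: val_inj; apply: lBl. Qed.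

Lemma lin_pair_cocycler n (z : cocycles DX n) : lin (pair_cocycle z).
Proof. by move=> a f g; apply: val_inj; apply: lBr. Qed.

Lemma pair_coboundary n (z : cocycles DX n) (f : cocycles DY 0) :
  z \in @coboundary k X DX n -> pair_cocycle z f \in @coboundary k Z DZ n.
Proof.
case: n z => [|n] z; rewrite !unfold_in /=.
  by move=> /eqP->; apply/eqP; exact: (lin_apply0 (@lin_pair_cocyclel 0 f)).
move=> /asboolP[x [tx bx]]; apply/asboolP; exists (B x (subspace_val f)).
by split; [exact: B_cyclic | rewrite /= bx B_coboundary_map].
Qed.

(** In degree 0 the only coboundary is zero, so [repr] recovers a 0-cocycle from its class; only the
    first argument has to be factored through a quotient. *)
Lemma cohomology_pairing n : {Phi : {linear tensor (HC DX n) (HC DY 0) -> HC DZ n} |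
  forall z f, Phi (cohomology_class z \ox cohomology_class f) =
              cohomology_class (pair_cocycle z f)}.
Proof.
have cl (m : nat) (W : nat -> lmodType k) (D : cocyclic_ops W) :
    lin (@cohomology_class k W D m) by move=> a u v; rewrite /cohomology_class linearP.
have Lf f : {L : {linear HC DX n -> HC DZ n} |
    forall z, L (cohomology_class z) = cohomology_class (pair_cocycle z f)}.
  apply: quotv_lift; first exact: (lin_compl (cl _ _ _) (@lin_pair_cocyclel n f)).
  move=> u /(pair_coboundary f) pu.
  by rewrite -[RHS](lin_apply0 (cl _ _ _)); apply/quotv_eq; rewrite subr0.
have reprK0 (f : cocycles DY 0) : repr (cohomology_class f) = f.
  apply/eqP; rewrite -subr_eq0.
  have /quotv_eq := quotv_classK (cohomology_class f).
  by rewrite unfold_in.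
pose F (x : HC DX n) (y : HC DY 0) : HC DZ n := sval (Lf (repr y)) x.
have FE z f : F (cohomology_class z) (cohomology_class f) =
    cohomology_class (pair_cocycle z f).
  by rewrite /F (svalP (Lf _)) reprK0.
have F1 y : lin (F^~ y) by move=> a u v; rewrite /F linearP.
have F2 x : lin (F x).
  move=> a y y'; rewrite -[x]quotv_classK -[y]quotv_classK -[y']quotv_classK.
  rewrite -linearP -!/(cohomology_class _) !FE.
  by rewrite lin_pair_cocycler; apply: cl.
exists (lin_of (lin_pures (T := id) (F := fun p => F p.1 p.2) (@lin_id _ _) F1 F2)).
by move=> z f; rewrite /= sum_pures /= ?FE.
Qed.
End CohomologyPairing.

(** * Cochains of a module coalgebra *)

Lemma tensorH_map (k : fieldType) (H : hopfType k) (M : rightHModType H)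
    (N N' : lmodType k) (act : H -> N -> N) (act' : H -> N' -> N')
    (phi : N -> N') : lin phi -> (forall h x, phi (act h x) = act' h (phi x)) ->
  {L : {linear tensorH M act -> tensorH M act'} |
    forall m x, L (tensH act m x) = tensH act' m (phi x)}.
Proof.
move=> lphi phiE; apply: tensorH_lift => [x|m|m h x]; [by lin_tac | by lin_tac |].
by rewrite tensH_act phiE.
Qed.

Section TensorMap.
Variables (k : fieldType) (V W W' : lmodType k).

(** The map id \ox f for a bare function [f], so that recursive operators can use it before they are
    known to be linear. *)
Definition tmapr (f : W -> W') (t : tensor V W) : tensor V W' :=
  \sum_(p <- pures t) p.1 \ox f p.2.

Lemma lin_tmapr (U : lmodType k) f (g : U -> tensor V W) :
  lin f -> lin g -> lin (fun u => tmapr f (g u)).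
Proof. by move=> lf lg; rewrite /tmapr; lin_tac. Qed.

Lemma tmapr_tens f v w : lin f -> tmapr f (v \ox w) = v \ox f w.
Proof. by move=> lf; rewrite /tmapr sum_pures; lin_tac. Qed.
End TensorMap.

Lemma lin_cst0 (k : fieldType) (U E : lmodType k) : lin (fun _ : U => 0 : E).
Proof. by move=> a x y; rewrite scaler0 addr0. Qed.

(* [D] and [e] stand for the coproduct and the counit: [hmodCoalgType] inherits *)
(* from [lmodType] in two ways, through [leftHModType] and through [coalgType], *)
(* and over an abstract [leftHModType] only one of them occurs.                 *)
Section CoalgebraOps.
Variables (k : fieldType) (H : hopfType k) (C : leftHModType H).
Variables (D : C -> tensor C C) (e : C -> k^o).
Hypotheses (lD : lin D) (le : lin e).

(* [del i n] splits and [sig i n] deletes the factor number i, resp. i.+1; they *)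
(* are 0 if i > n.                                                              *)
Fixpoint del i n : tpow C n -> tpow C n.+1 :=
  match i, n return tpow C n -> tpow C n.+1 with
  | 0, 0 => D
  | 0, n'.+1 => fun t => \sum_(q <- pures t) \sum_(p <- pures (D q.1))
                  p.1 \ox (p.2 \ox q.2 : tpow C n'.+1)
  | i'.+1, 0 => fun=> 0
  | i'.+1, n'.+1 => tmapr (@del i' n')
  end.
Arguments del i n t : clear implicits.

Fixpoint sig i n : tpow C n.+1 -> tpow C n :=
  match i, n return tpow C n.+1 -> tpow C n with
  | 0, 0 => fun t => \sum_(q <- pures t) (e q.2 : k) *: q.1
  | 0, n'.+1 => fun t => \sum_(q <- pures t) \sum_(p <- pures (q.2 : tensor C (tpow C n')))
                  (e p.1 : k) *: (q.1 \ox p.2 : tpow C n'.+1)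
  | i'.+1, 0 => fun=> 0
  | i'.+1, n'.+1 => tmapr (@sig i' n')
  end.
Arguments sig i n t : clear implicits.

Lemma lin_del i n (U : lmodType k) (g : U -> tpow C n) :
  lin g -> lin (fun u => del i n (g u)).
Proof.
suff l : lin (del i n) by move=> lg a x y; rewrite lg l.
elim: i n {g} => [|i IH] [|n] //=; [by lin_tac | exact: lin_cst0 |].
exact: lin_tmapr.
Qed.

Lemma lin_sig i n (U : lmodType k) (g : U -> tpow C n.+1) :
  lin g -> lin (fun u => sig i n (g u)).
Proof.
suff l : lin (sig i n) by move=> lg a x y; rewrite lg l.
elim: i n {g} => [|i IH] [|n] //=; [by lin_tac | by lin_tac | exact: lin_cst0 |].
exact: (lin_tmapr (g := id)) (IH n) (@lin_id _ _).
Qed.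

Ltac lin_extra ::= first
  [ lin_rotation
  | match goal with
    | |- lin (fun x => del ?i ?n (@?g x)) => apply: (@lin_del i n _ g)
    | |- lin (fun x => sig ?i ?n (@?g x)) => apply: (@lin_sig i n _ g)
    end ].

Lemma delS_tens i n c (t : tpow C n) : del i.+1 n.+1 (c \ox t) = c \ox del i n t.
Proof. exact/tmapr_tens/lin_del. Qed.

Lemma sigS_tens i n c (t : tpow C n.+1) : sig i.+1 n.+1 (c \ox t) = c \ox sig i n t.
Proof. exact/tmapr_tens/lin_sig. Qed.

Lemma del0_tens n c (t : tpow C n) :
  del 0 n.+1 (c \ox t) = \sum_(p <- pures (D c)) p.1 \ox (p.2 \ox t : tpow C n.+1).
Proof. by rewrite /= sum_pures; lin_tac. Qed.

Lemma sig0_tens n a c (t : tpow C n) :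
  sig 0 n.+1 (a \ox (c \ox t : tpow C n.+1)) = (e c : k) *: (a \ox t : tpow C n.+1).
Proof. by rewrite /= sum_pures; lin_tac; rewrite /= sum_pures; lin_tac. Qed.

Lemma del0_tpure n c (s : seq C) : size s = n ->
  del 0 n (tpure n (c :: s)) = \sum_(p <- pures (D c)) tpure n.+1 [:: p.1, p.2 & s].
Proof.
case: n => [|n] sz; last by rewrite [LHS]del0_tens.
by rewrite [LHS]puresE; apply: eq_bigr.
Qed.

Lemma sig0_tpure n a c (s : seq C) : size s = n ->
  sig 0 n (tpure n.+1 [:: a, c & s]) = (e c : k) *: tpure n (a :: s).
Proof.
case: n => [|n] sz; last by rewrite [LHS]sig0_tens.
by rewrite /= sum_pures; lin_tac.
Qed.

Arguments del : simpl never.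
Arguments sig : simpl never.

Lemma del_tpure i n (s : seq C) : size s = n.+1 -> (i <= n)%N ->
  del i n (tpure n s) = \sum_(p <- pures (D s`_i))
    tpure n.+1 (take i s ++ [:: p.1, p.2 & drop i.+1 s]).
Proof.
elim: i n s => [|i IH] n [|c s] // [sz]; first by rewrite del0_tpure //= drop0.
case: n sz => [//|n] sz le_in; rewrite [LHS]delS_tens IH // tens_sumr.
by apply: eq_bigr => p _.
Qed.

Lemma sig_tpure i n (s : seq C) : size s = n.+2 -> (i <= n)%N ->
  sig i n (tpure n.+1 s) = (e s`_i.+1 : k) *: tpure n (take i.+1 s ++ drop i.+2 s).
Proof.
elim: i n s => [|i IH] n [|c [|d s]] // [sz]; first by rewrite sig0_tpure //= !drop0 ?take0.
case: n sz => [//|n] sz le_in; rewrite [LHS]sigS_tens IH //= ?sz //.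
by rewrite -lin_applyZ //; lin_tac.
Qed.

Lemma del_snoc i n w (t : tpow C n) : (i <= n)%N ->
  del i n.+1 (snoc n w t) = snoc n.+1 w (del i n t).
Proof.
elim: i n t => [|i IH] n t.
  move=> _; move: t; apply: tpow_seq_ext => [||[|c s] // sz]; [by lin_tac | by lin_tac |].
  rewrite snoc_tpure // rcons_cons; move: sz => [sz].
  rewrite [LHS]del0_tpure ?size_rcons ?sz // del0_tpure //.
  rewrite (lin_apply_sum (f := snoc n.+1 w)); lin_tac.
  by apply: eq_bigr => p _; rewrite snoc_tpure //= sz.
case: n t => [//|n] t le_in; move: t.
apply: tpow_tens_ext => [||c t]; [by lin_tac | by lin_tac |].
by rewrite snoc_tens !delS_tens IH // snoc_tens.
Qed.

Lemma sig_snoc i n w (t : tpow C n.+1) : (i <= n)%N ->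
  sig i n.+1 (snoc n.+1 w t) = snoc n w (sig i n t).
Proof.
elim: i n t => [|i IH] n t.
  move=> _; move: t; apply: tpow_seq_ext => [||[|c [|d s]] // sz]; [by lin_tac | by lin_tac |].
  rewrite snoc_tpure // !rcons_cons; move: sz => [sz].
  rewrite [LHS]sig0_tpure ?size_rcons ?sz // sig0_tpure //.
  by rewrite (lin_applyZ (f := snoc n w)); lin_tac; rewrite snoc_tpure //= sz.
case: n t => [//|n] t le_in; move: t.
apply: tpow_tens_ext => [||c t]; [by lin_tac | by lin_tac |].
by rewrite snoc_tens !sigS_tens IH // snoc_tens.
Qed.

Hypothesis DA : forall (E : lmodType k) (F : C -> C -> C -> E) c,
    (forall y z, lin (fun x => F x y z)) -> (forall x z, lin (fun y => F x y z)) ->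
    (forall x y, lin (fun z => F x y z)) ->
  \sum_(p <- pures (D c)) \sum_(q <- pures (D p.1)) F q.1 q.2 p.2 =
  \sum_(p <- pures (D c)) \sum_(q <- pures (D p.2)) F p.1 q.1 q.2.
Hypothesis Del : forall (E : lmodType k) (F : C -> E) c, lin F ->
  \sum_(p <- pures (D c)) (e p.1 : k) *: F p.2 = F c.
Hypothesis Der : forall (E : lmodType k) (F : C -> E) c, lin F ->
  \sum_(p <- pures (D c)) (e p.2 : k) *: F p.1 = F c.
Hypothesis D_lact : forall h c, D (lact h c) =
  \sum_(p <- pures (comul h)) \sum_(q <- pures (D c)) lact p.1 q.1 \ox lact p.2 q.2.
Hypothesis e_lact : forall h c, e (lact h c) = (counit h * (e c : k)) :> k.

Lemma lin_tpure n (s1 s2 : seq C) (U : lmodType k) (g : U -> C) :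
  (size s1 + size s2)%N = n -> lin g -> lin (fun u => tpure n (s1 ++ g u :: s2)).
Proof. by move=> sz lg; apply: (lin_compl (tpure_multilinear sz)). Qed.

(** Stripping first factors reduces to i = 0. There j = 1 is coassociativity, and for j > 1 the two
    splittings concern different factors. The identities that follow have the same pattern. *)
Lemma del_del n i j x : (i < j <= n.+1)%N ->
  del j n.+1 (del i n x) = del i n.+1 (del j.-1 n x).
Proof.
elim: i n j x => [|i IH] n [|j] x //.
  case: j x => [|j] x le_jn.
    move: x; apply: tpow_seq_ext => [||[|c s] // [sz]]; [by lin_tac | by lin_tac |].
    rewrite del0_tpure // !(lin_apply_sum (f := del _ n.+1)); lin_tac.
    transitivity (\sum_(p <- pures (D c)) \sum_(q <- pures (D p.2))
        tpure n.+2 [:: p.1, q.1, q.2 & s]).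
      apply: eq_bigr => p _; rewrite [LHS]delS_tens del0_tpure //.
      by rewrite (lin_apply_sum (f := tens p.1)); lin_tac.
    rewrite -(DA (F := fun x y z => tpure n.+2 [:: x, y, z & s])).
    - by apply: eq_bigr => p _; rewrite del0_tpure //= sz.
    - by move=> y z; apply: (@lin_tpure _ [::] [:: y, z & s]); rewrite /= ?sz.
    - by move=> y z; apply: (@lin_tpure _ [:: y] [:: z & s]); rewrite /= ?sz.
    - by move=> y z; apply: (@lin_tpure _ [:: y; z] s); rewrite /= ?sz.
  case: n le_jn x => [|n] le_jn; first by case: j le_jn.
  apply: tpow_tens_ext => [||c t]; [by lin_tac | by lin_tac |].
  rewrite delS_tens !del0_tens (lin_apply_sum (f := del _ _)); lin_tac.
  by apply: eq_bigr => p _; rewrite !delS_tens.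
rewrite ltnS => /andP[lt_ij le_jn].
case: n le_jn x => [|n] le_jn; first by lia.
apply: tpow_tens_ext => [||c t]; [by lin_tac | by lin_tac |].
case: j lt_ij le_jn => [//|j] lt_ij le_jn.
by rewrite !delS_tens IH // lt_ij.
Qed.

Lemma sig_sig n i j x : (i <= j <= n)%N ->
  sig j n (sig i n.+1 x) = sig i n (sig j.+1 n.+1 x).
Proof.
elim: i n j x => [|i IH] n j x.
  case: j x => [|j] x le_jn.
    move: x; apply: tpow_seq_ext => [||[|c [|d [|f s]]] // [sz]]; [by lin_tac | by lin_tac |].
    rewrite sig0_tpure /= ?sz // [X in _ = sig 0 n X]sigS_tens sig0_tpure //.
    rewrite (lin_applyZ (f := tens c)); lin_tac.
    rewrite !(lin_applyZ (f := sig 0 n)); lin_tac.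
    by rewrite sig0_tpure // [in RHS]sig0_tpure // !scalerA mulrC.
  case: n le_jn x => [|n] le_jn //.
  apply: tpow_tens_ext => [||c]; [by lin_tac | by lin_tac |].
  apply: tpow_tens_ext => [||d t]; [by lin_tac | by lin_tac |].
  rewrite !sigS_tens !sig0_tens (lin_applyZ (f := sig j.+1 n.+1)); lin_tac.
  by rewrite sigS_tens.
case: j x => [|j] x //; rewrite ltnS => /andP[lt_ij].
case: n x => [|n] x // le_jn; move: x.
apply: tpow_tens_ext => [||c t]; [by lin_tac | by lin_tac |].
by rewrite !sigS_tens IH // lt_ij.
Qed.

Lemma sig_del_lt n i j x : (i < j <= n.+1)%N ->
  sig j n.+1 (del i n.+1 x) = del i n (sig j.-1 n x).
Proof.
elim: i n j x => [|i IH] n [|j] x //.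
  case: j x => [|j] x le_jn.
    move: x; apply: tpow_seq_ext => [||[|c [|d s]] // [sz]]; [by lin_tac | by lin_tac |].
    rewrite del0_tpure /= ?sz // sig0_tpure //.
    rewrite (lin_applyZ (f := del 0 n)); lin_tac; rewrite del0_tpure //.
    rewrite scaler_sumr (lin_apply_sum (f := sig 1 n.+1)); lin_tac.
    apply: eq_bigr => p _; rewrite [LHS]sigS_tens sig0_tpure //.
    by rewrite (lin_applyZ (f := tens _)); lin_tac.
  case: n le_jn x => [|n] le_jn; first by case: j le_jn.
  apply: tpow_tens_ext => [||c t]; [by lin_tac | by lin_tac |].
  rewrite sigS_tens !del0_tens (lin_apply_sum (f := sig _ _)); lin_tac.
  by apply: eq_bigr => p _; rewrite !sigS_tens.
rewrite ltnS => /andP[lt_ij le_jn].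
case: n le_jn x => [|n] le_jn; first by lia.
apply: tpow_tens_ext => [||c t]; [by lin_tac | by lin_tac |].
case: j lt_ij le_jn => [//|j] lt_ij le_jn.
by rewrite delS_tens !sigS_tens delS_tens IH // lt_ij.
Qed.

Lemma sig_del_eq n j x : (j <= n)%N -> sig j n (del j n x) = x.
Proof.
elim: j n x => [|j IH] n x.
  move=> _; move: x; apply: tpow_seq_ext => [||[|c s] // [sz]]; [by lin_tac | by lin_tac |].
  rewrite del0_tpure // (lin_apply_sum (f := sig 0 n)); lin_tac.
  under eq_bigr do rewrite sig0_tpure //.
  rewrite (Der (F := fun x => tpure n (x :: s))) //.
  by apply: (@lin_tpure _ [::]).
case: n x => [//|n] x le_jn; move: x.
apply: tpow_tens_ext => [||c t]; [by lin_tac | by lin_tac |].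
by rewrite delS_tens sigS_tens IH.
Qed.

Lemma sig_del_eqS n j x : (j < n)%N -> sig j n (del j.+1 n x) = x.
Proof.
elim: j n x => [|j IH] [|n] x //.
  move=> _; move: x; apply: tpow_seq_ext => [||[|c [|d s]] // [sz]]; [by lin_tac | by lin_tac |].
  rewrite [X in sig _ _ X]delS_tens del0_tpure // tens_sumr.
  rewrite (lin_apply_sum (f := sig 0 n.+1)); lin_tac.
  transitivity (\sum_(p <- pures (D d)) (e p.1 : k) *: tpure n.+1 [:: c, p.2 & s]).
    by apply: eq_bigr => p _; rewrite -sig0_tpure //= sz.
  rewrite (Del (F := fun x => tpure n.+1 [:: c, x & s])) //.
  by apply: (@lin_tpure _ [:: c]); rewrite /= ?sz.
rewrite ltnS => le_jn; move: x.
apply: tpow_tens_ext => [||c t]; [by lin_tac | by lin_tac |].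
by rewrite delS_tens sigS_tens IH.
Qed.

Lemma sig_del_gt n i j x : (j.+1 < i <= n.+1)%N ->
  sig j n.+1 (del i n.+1 x) = del i.-1 n (sig j n x).
Proof.
elim: j n i x => [|j IH] [|n] [|[|i]] x //; try lia.
  move=> _; move: x.
  apply: tpow_tens_ext => [||c]; [by lin_tac | by lin_tac |].
  apply: tpow_tens_ext => [||d t]; [by lin_tac | by lin_tac |].
  rewrite !delS_tens !sig0_tens (lin_applyZ (f := del _ _)); lin_tac.
  by rewrite delS_tens.
rewrite ltnS => /andP[lt_ji le_in]; move: x.
apply: tpow_tens_ext => [||c t]; [by lin_tac | by lin_tac |].
by rewrite delS_tens !sigS_tens [in RHS]delS_tens IH //; lia.
Qed.

(** Since the coproduct of C is H-linear, splitting a factor commutes with the diagonal action and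
    so descends to M \ox_H C^(n+1). *)
Lemma diag_del i n h x : diag n.+1 h (del i n x) = del i n (diag n h x).
Proof.
elim: i n h x => [|i IH] [|n] h x.
- rewrite -[diag 0 h x]/(lact h x) [RHS]D_lact -[del 0 0 x]/(D x) [X in diag 1 h X]puresE.
  rewrite (lin_apply_sum (f := diag 1 h)); lin_tac; rewrite exchange_big.
  by apply: eq_bigr => q _; rewrite diag_tens.
- move: x; apply: tpow_tens_ext => [||c t]; [by lin_tac | by lin_tac |].
  rewrite del0_tens diag_tens (lin_apply_sum (f := diag _ h)); lin_tac.
  rewrite (lin_apply_sum (f := del _ _)); lin_tac.
  under [RHS]eq_bigr do (rewrite del0_tens D_lact sum_pures_sum2; lin_tac).
  rewrite comul_assocl; lin_tac.
  under eq_bigr do rewrite diag_tens.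
  rewrite exchange_big; apply: eq_bigr => p _.
  under eq_bigr do rewrite diag_tens tens_sumr.
  by rewrite exchange_big; apply: eq_bigr.
- exact/lin_apply0/diag_linear.
- move: x; apply: tpow_tens_ext => [||c t]; [by lin_tac | by lin_tac |].
  rewrite delS_tens !diag_tens (lin_apply_sum (f := del _ _)); lin_tac.
  by apply: eq_bigr => p _; rewrite delS_tens IH.
Qed.

Lemma diag_sig i n h x : sig i n (diag n.+1 h x) = diag n h (sig i n x).
Proof.
elim: i n h x => [|i IH] [|n] h x.
- move: x; apply: tpow_tens_ext => [||c d]; [by lin_tac | by lin_tac |].
  have sE a b : sig 0 0 (a \ox (b : tpow C 0)) = (e b : k) *: a.
    exact: (@sig0_tpure 0 a b [::]).
  rewrite diag_tens sE (lin_apply_sum (f := sig 0 0)); lin_tac.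
  rewrite (lin_applyZ (f := diag 0 h)); lin_tac.
  transitivity (\sum_(p <- pures (comul h)) counit p.2 *: ((e d : k) *: lact p.1 c)).
    by apply: eq_bigr => p _; rewrite sE [e _]e_lact scalerA.
  by rewrite counit_sumr; lin_tac.
- move: x; apply: tpow_tens_ext => [||c]; [by lin_tac | by lin_tac |].
  apply: tpow_tens_ext => [||d t]; [by lin_tac | by lin_tac |].
  rewrite sig0_tens !diag_tens (lin_apply_sum (f := sig _ _)); lin_tac.
  rewrite (lin_applyZ (f := diag _ _)); lin_tac; rewrite diag_tens scaler_sumr.
  apply: eq_bigr => p _; rewrite diag_tens tens_sumr.
  rewrite (lin_apply_sum (f := sig _ _)); lin_tac.
  transitivity (\sum_(q <- pures (comul p.2))
      counit q.1 *: ((e d : k) *: (lact p.1 c \ox diag n q.2 t : tpow C n.+1))).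
    by apply: eq_bigr => q _; rewrite sig0_tens [e _]e_lact scalerA.
  by rewrite counit_suml; lin_tac.
- by apply/esym/lin_apply0/diag_linear.
- move: x; apply: tpow_tens_ext => [||c t]; [by lin_tac | by lin_tac |].
  rewrite sigS_tens !diag_tens (lin_apply_sum (f := sig _ _)); lin_tac.
  by apply: eq_bigr => p _; rewrite sigS_tens IH.
Qed.

Lemma rot_act_del n i h x : (i < n)%N ->
  rot_act n.+1 h (del i.+1 n x) = del i n (rot_act n h x).
Proof.
case: n x => [//|n] x le_in; move: x.
apply: tpow_tens_ext => [||c t]; [by lin_tac | by lin_tac |].
by rewrite delS_tens !rot_act_tens del_snoc.
Qed.

Lemma rot_act_sig n i h x : (i < n)%N ->
  rot_act n h (sig i.+1 n x) = sig i n (rot_act n.+1 h x).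
Proof.
case: n x => [//|n] x le_in; move: x.
apply: tpow_tens_ext => [||c t]; [by lin_tac | by lin_tac |].
by rewrite sigS_tens !rot_act_tens sig_snoc.
Qed.

Variable M : saydType H.
Notation X n := (tensorH M (@diag k H C n)).

Fact cdel_subproof i n : {L : {linear X n -> X n.+1} |
  forall m x, L (tensH _ m x) = tensH _ m (del i n x)}.
Proof. by apply: tensorH_map => [|h x]; [lin_tac | rewrite diag_del]. Qed.

Fact csig_subproof i n : {L : {linear X n.+1 -> X n} |
  forall m x, L (tensH _ m x) = tensH _ m (sig i n x)}.
Proof. by apply: tensorH_map => [|h x]; [lin_tac | rewrite diag_sig]. Qed.

Fact last_cdel_subproof n : linear (fun x : X n => tau M n.+1 (sval (cdel_subproof 0 n) x)).
Proof. by move=> a x y; rewrite !linearP. Qed.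

(** The last coface is tau delta_0 by definition, the form that [inner_cocyclic] asks for; every
    index above [n] is sent to it. *)
Definition coalg_ops : cocyclic_ops (fun n => X n) := CocyclicOps
  (fun n i => if (i <= n)%N then sval (cdel_subproof i n) else lin_of (@last_cdel_subproof n))
  (fun n i => sval (csig_subproof i n)) (fun n => tau M n).

Lemma coalg_ops_coface n i m x : (i <= n)%N ->
  coface coalg_ops n i (tensH _ m x) = tensH _ m (del i n x).
Proof. by move=> le_in /=; rewrite le_in (svalP (cdel_subproof i n)). Qed.

Lemma coalg_ops_coface_last n x :
  coface coalg_ops n n.+1 x = cocyc coalg_ops n.+1 (coface coalg_ops n 0 x).
Proof. by rewrite /= ltnn. Qed.

Lemma coalg_ops_codegen n i m x :
  codegen coalg_ops n i (tensH _ m x) = tensH _ m (sig i n x).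
Proof. exact: (svalP (csig_subproof i n)). Qed.

Lemma coalg_ops_cocyc n m x : cocyc coalg_ops n (tensH _ m x) =
  \sum_(q <- pures (coact m)) tensH _ q.2 (rot_act n q.1 x).
Proof. exact: tauE. Qed.

Lemma coalg_ops_cocyc_vtens n m c (s : seq C) : size s = n ->
  cocyc coalg_ops n (vtens n m (c :: s)) =
  \sum_(q <- pures (coact m)) vtens n q.2 (rcons s (lact q.1 c)).
Proof. exact: tau_vtens. Qed.

Lemma coalg_ops_codegen_vtens n i m (s : seq C) : size s = n.+2 -> (i <= n)%N ->
  codegen coalg_ops n i (vtens n.+1 m s) =
  (e s`_i.+1 : k) *: vtens n m (take i.+1 s ++ drop i.+2 s).
Proof.
move=> sz le_in; rewrite /vtens coalg_ops_codegen sig_tpure //.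
by rewrite (lin_applyZ (f := tensH _ m)); lin_tac.
Qed.

Lemma coalg_ops_coface_vtens n i m (s : seq C) : size s = n.+1 -> (i <= n)%N ->
  coface coalg_ops n i (vtens n m s) = \sum_(p <- pures (D s`_i))
    vtens n.+1 m (take i s ++ [:: p.1, p.2 & drop i.+1 s]).
Proof.
move=> sz le_in; apply: (etrans (coalg_ops_coface _ _ le_in)).
by rewrite del_tpure // tensH_sumr.
Qed.

Lemma coalg_ops_coface_last_vtens n m c (s : seq C) : size s = n ->
  coface coalg_ops n n.+1 (vtens n m (c :: s)) =
  \sum_(q <- pures (coact m)) \sum_(p <- pures (D c))
    vtens n.+1 q.2 (p.2 :: rcons s (lact q.1 p.1)).
Proof.
move=> sz; rewrite coalg_ops_coface_last (@coalg_ops_coface_vtens n 0) //; last by rewrite /= sz.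
rewrite linear_sum exchange_big; apply: eq_bigr => p _.
rewrite take0 drop1.
by apply: (etrans (coalg_ops_cocyc_vtens _ _ _)); rewrite /= ?sz.
Qed.

Lemma rot_act1 h (a b : C) : rot_act 1 h (a \ox b) = b \ox lact h a.
Proof. exact: (@rot_act_tens _ _ _ 0). Qed.

Lemma sig00_tens (a b : C) : sig 0 0 (a \ox b) = (e b : k) *: a.
Proof. exact: (@sig0_tpure 0 a b [::]). Qed.

#[local] Opaque coalg_ops tensH tau rot_act.

Lemma coalg_ops_inner : inner_cocyclic coalg_ops.
Proof.
split.
- move=> n i j x /andP[lt_ij le_jn]; move: x.
  apply: tensorH_ext => [||m x]; [by lin_tac | by lin_tac |].
  rewrite [coface _ n i _]coalg_ops_coface; last by lia.
  rewrite [coface _ n j.-1 _]coalg_ops_coface; last by lia.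
  rewrite [coface _ n.+1 j _]coalg_ops_coface; last by lia.
  rewrite [coface _ n.+1 i _]coalg_ops_coface; last by lia.
  by rewrite del_del ?lt_ij.
- move=> n i j x le_ijn; move: x.
  apply: tensorH_ext => [||m x]; [by lin_tac | by lin_tac |].
  rewrite [codegen _ n.+1 i _]coalg_ops_codegen [codegen _ n.+1 j.+1 _]coalg_ops_codegen.
  by rewrite [codegen _ n j _]coalg_ops_codegen [codegen _ n i _]coalg_ops_codegen sig_sig.
- move=> n i j x le_ijn; move: x.
  apply: tensorH_ext => [||m x]; [by lin_tac | by lin_tac |].
  rewrite [coface _ n.+1 i _]coalg_ops_coface; last by lia.
  rewrite [codegen _ n j.-1 _]coalg_ops_codegen [coface _ n i _]coalg_ops_coface; last by lia.
  by rewrite [codegen _ n.+1 j _]coalg_ops_codegen sig_del_lt.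
- move=> n j x le_jn; move: x.
  apply: tensorH_ext => [||m x]; [by lin_tac | by lin_tac |].
  by rewrite [coface _ n j _]coalg_ops_coface // [LHS]coalg_ops_codegen sig_del_eq.
- move=> n j x le_jn; move: x.
  apply: tensorH_ext => [||m x]; [by lin_tac | by lin_tac |].
  by rewrite [coface _ n _ _]coalg_ops_coface // [LHS]coalg_ops_codegen sig_del_eqS.
(* sigma_0 delta_1 in degree 0: the deleted factor m^(-1) c^(1) contributes the product of two
   counits, absorbed by the counit laws of M and C. *)
- apply: tensorH_ext => [||m c]; [by lin_tac | by lin_tac |].
  rewrite coalg_ops_coface_last coalg_ops_coface // -[del 0 0 c]/(D c).
  rewrite [Y in tensH _ m Y]puresE tensH_sumr !linear_sum /=.
  rewrite -[RHS](Del (F := tensH (@diag k H C 0) m)); lin_tac.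
  apply: eq_bigr => p _; rewrite [cocyc _ _ _]coalg_ops_cocyc linear_sum.
  rewrite -(coact_counit_sum (G := fun q => tensH (@diag k H C 0) q.2 p.2)); lin_tac.
  rewrite scaler_sumr; apply: eq_bigr => q _.
  apply: (etrans (@coalg_ops_codegen 0 0 q.2 (rot_act 1 q.1 (p.1 \ox p.2)))).
  rewrite rot_act1 sig00_tens [e _]e_lact.
  by rewrite (lin_applyZ (f := tensH _ q.2)) ?scalerA 1?mulrC; lin_tac.
- move=> n i j x le_ijn; move: x.
  apply: tensorH_ext => [||m x]; [by lin_tac | by lin_tac |].
  rewrite [coface _ n.+1 i _]coalg_ops_coface; last by lia.
  rewrite [codegen _ n j _]coalg_ops_codegen [coface _ n i.-1 _]coalg_ops_coface; last by lia.
  by rewrite [codegen _ n.+1 j _]coalg_ops_codegen sig_del_gt.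
- move=> n [|i] x // le_in; move: x.
  apply: tensorH_ext => [||m x]; [by lin_tac | by lin_tac |].
  rewrite [coface _ n i.+1 _]coalg_ops_coface //.
  rewrite [LHS]coalg_ops_cocyc [cocyc _ n _]coalg_ops_cocyc linear_sum.
  apply: eq_bigr => q _; rewrite rot_act_del // [RHS]coalg_ops_coface //; lia.
- exact: coalg_ops_coface_last.
- move=> n [|i] x // le_in; move: x.
  apply: tensorH_ext => [||m x]; [by lin_tac | by lin_tac |].
  rewrite [codegen _ n i.+1 _]coalg_ops_codegen.
  rewrite [LHS]coalg_ops_cocyc [cocyc _ n.+1 _]coalg_ops_cocyc linear_sum.
  by apply: eq_bigr => q _; rewrite rot_act_sig // [RHS]coalg_ops_codegen.
(* After two rotations the factor number 1 is the last one, with a coaction leg acting on it;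
   deleting it leaves the counit of that leg, which the coaction absorbs. *)
- move=> n; apply: vtens_ext => [||m [|a [|c s]] // [sz]]; [by lin_tac | by lin_tac |].
  rewrite coalg_ops_codegen_vtens /= ?sz // drop0 linearZ_LR /=.
  rewrite coalg_ops_cocyc_vtens // [cocyc _ n.+1 (vtens _ m _)]coalg_ops_cocyc_vtens /= ?sz //.
  rewrite scaler_sumr [cocyc _ _ _]linear_sum [RHS]linear_sum /=; apply: eq_bigr => q _.
  rewrite [cocyc _ n.+1 (vtens _ q.2 _)]coalg_ops_cocyc_vtens; last by rewrite size_rcons sz.
  rewrite linear_sum.
  transitivity (\sum_(r <- pures (coact q.2)) counit r.1 *:
      ((e c : k) *: vtens n r.2 (rcons s (lact q.1 a)))).
    by rewrite coact_counit_sum // /vtens; lin_tac.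
  apply: eq_bigr => r _.
  symmetry; apply: (etrans (coalg_ops_codegen_vtens _ _ (leqnn n))).
    by rewrite !size_rcons sz.
  rewrite nth_rcons size_rcons sz ltnn eqxx.
  rewrite drop_oversize ?size_rcons ?sz // cats0.
  rewrite -[rcons (rcons _ _) _]cats1 take_size_cat ?size_rcons ?sz //.
  by rewrite [e (lact _ _)]e_lact scalerA.
- exact: iter_tau_id.
Qed.
End CoalgebraOps.
Arguments del : simpl never.
Arguments del {k H C} D i n t.

Section ModuleCoalgebra.
Variables (k : fieldType) (H : hopfType k) (M : saydType H) (C : hmodCoalgType H).

Let comul_lin : lin (comul : C -> tensor C C). Proof. exact: (linearP comul). Qed.
Let counit_lin : lin (counit : C -> k^o). Proof. exact: linearP. Qed.

Let counitl_sum (E : lmodType k) (F : C -> E) c : lin F ->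
  \sum_(p <- pures (comul c)) (counit p.1 : k) *: F p.2 = F c.
Proof. by move=> lF; rewrite (counit_suml (G := fun p => F p.2)). Qed.

Let counitr_sum (E : lmodType k) (F : C -> E) c : lin F ->
  \sum_(p <- pures (comul c)) (counit p.2 : k) *: F p.1 = F c.
Proof. by move=> lF; rewrite (counit_sumr (G := fun p => F p.1)). Qed.

Definition modcoalg_ops : cocyclic_ops (coalgC M C) :=
  coalg_ops comul_lin counit_lin (@comul_lact k H C) (@counit_lact k H C) M.

Lemma modcoalg_ops_cocyclic : is_cocyclic modcoalg_ops.
Proof.
apply/inner_cocyclicP/coalg_ops_inner.
- exact: comul_assocF.
- exact: counitl_sum.
- exact: counitr_sum.
Qed.

Lemma modcoalg_ops_formulas : coalg_formulas modcoalg_ops.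
Proof.
split.
- by move=> n i m c; apply: coalg_ops_coface_vtens; rewrite size_tuple.
- move=> n m c; case/tupleP: c => c s.
  by apply: coalg_ops_coface_last_vtens; rewrite size_tuple.
- by move=> n i m c; apply: coalg_ops_codegen_vtens; rewrite size_tuple.
- move=> n m c; case/tupleP: c => c s.
  by apply: coalg_ops_cocyc_vtens; rewrite size_tuple.
Qed.

(** Linear operators are determined on pure tensors. Besides uniqueness, this lets the cup products,
    stated for any operators with these formulas, be computed with [modcoalg_ops]. *)
Lemma coalg_formulas_same (D D' : cocyclic_ops (coalgC M C)) :
  coalg_formulas D -> coalg_formulas D' -> same_ops D D'.
Proof.
move=> fD fD'; split.
- move=> n i x le_in; move: x; apply: vtens_ext => [||m s /eqP sz]; [by lin_tac | by lin_tac |].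
  have [le_i|lt_i] := leqP i n.
    have E := coalg_coface fD m (Tuple sz) le_i.
    exact: (etrans E (esym (coalg_coface fD' m (Tuple sz) le_i))).
  have -> : i = n.+1 by lia.
  have E := coalg_coface_last fD m (Tuple sz).
  exact: (etrans E (esym (coalg_coface_last fD' m (Tuple sz)))).
- move=> n i x le_in; move: x; apply: vtens_ext => [||m s /eqP sz]; [by lin_tac | by lin_tac |].
  have E := coalg_codegen fD m (Tuple sz) le_in.
  exact: (etrans E (esym (coalg_codegen fD' m (Tuple sz) le_in))).
- move=> n; apply: vtens_ext => [||m s /eqP sz]; [by lin_tac | by lin_tac |].
  have E := coalg_cocyc fD m (Tuple sz).
  exact: (etrans E (esym (coalg_cocyc fD' m (Tuple sz)))).
Qed.

Lemma coalg_define : define_cocyclic_module (@coalg_formulas k H M C).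
Proof.
exists modcoalg_ops; split; [exact: modcoalg_ops_formulas | exact: modcoalg_ops_cocyclic |].
by move=> D' fD'; apply: coalg_formulas_same => //; exact: modcoalg_ops_formulas.
Qed.
End ModuleCoalgebra.

(** * Cochains of a module algebra *)

Ltac lin_extra ::= lin_rotation.

Section HomHDual.
Variables (k : fieldType) (H : hopfType k) (M : saydType H) (A : leftHModType H).
Notation XA n := (tensorH M (@diag k H A n)).

Lemma homH_lin n (f : homH M A n) : lin (subspace_val f).
Proof. by case: f => f /=; rewrite unfold_in => /asboolP[]. Qed.

Lemma homH_ract n (f : homH M A n) x h :
  subspace_val f (ract_tens x h) = subspace_val f x * counit h.
Proof. by case: f => f /=; rewrite unfold_in => /asboolP[_]. Qed.

Lemma lin_ract_tens n h : lin (fun x => @ract_tens k H M A n x h).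
Proof. by rewrite /ract_tens; lin_tac. Qed.

Lemma ract_tens_pure n (m : M) (x : tpow A n) h : ract_tens (m \ox x) h =
  \sum_(p <- pures (comul h)) ract m p.1 \ox diag n (antipode p.2) x.
Proof. by rewrite /ract_tens sum_pures; lin_tac. Qed.

(** Equivariance for the leg h^(1) turns m \ox h x into m h^(1) \ox S(h^(2)) h^(3) x, where the
    antipode cancels. *)
Lemma homH_balanced n (f : homH M A n) m h (x : tpow A n) :
  subspace_val f (ract m h \ox x) = subspace_val f (m \ox diag n h x).
Proof.
have lf := homH_lin f.
pose G (p : H * H) : k^o := subspace_val f (m \ox diag n p.2 x).
rewrite -[RHS](counit_suml (G := G)) /G; lin_tac.
pose G' (p : H * H) : k^o := subspace_val f (ract m p.1 \ox x).
rewrite -[LHS](counit_sumr (G := G')) /G'; lin_tac.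
symmetry; transitivity (\sum_(p <- pures (comul h)) \sum_(q <- pures (comul p.1))
    subspace_val f (ract m q.1 \ox diag n (antipode q.2) (diag n p.2 x))).
  apply: eq_bigr => p _; rewrite -(lin_apply_sum _ _ lf) -ract_tens_pure homH_ract.
  by rewrite mulrC.
rewrite comul_assocl; lin_tac; apply: eq_bigr => p _ /=.
under eq_bigr do rewrite -diagM.
rewrite -(lin_apply_sum (f := fun y => subspace_val f (ract m p.1 \ox diag n y x))); lin_tac.
rewrite antipodel (lin_applyZ (f := fun y => subspace_val f (ract m p.1 \ox diag n y x))); lin_tac.
by rewrite diag1.
Qed.

(* [hat] and [unhat] identify Hom_H(M \ox A^(n+1), k) with the linear forms on *)
(* M \ox_H A^(n+1), so that cochain operators are precompositions.            *)
Fact hat_subproof n (f : homH M A n) : {L : {linear XA n -> k^o} |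
  forall m x, L (tensH _ m x) = subspace_val f (m \ox x)}.
Proof.
have lf := homH_lin f.
apply: tensorH_lift => [x|m|m h x]; [by lin_tac | by lin_tac |].
exact: homH_balanced.
Qed.

Definition hat n (f : homH M A n) : {linear XA n -> k^o} := sval (hat_subproof f).

Lemma hatE n (f : homH M A n) m x : hat f (tensH _ m x) = subspace_val f (m \ox x).
Proof. exact: (svalP (hat_subproof f)). Qed.

Lemma hat_inj n (f g : homH M A n) : hat f =1 hat g -> f = g.
Proof.
move=> fg; apply: val_inj; apply: funext; apply: tensor_ext; try exact: homH_lin.
by move=> m x; rewrite -[LHS]hatE -[RHS]hatE fg.
Qed.

Lemma lin_hat n (y : XA n) : lin (fun f : homH M A n => hat f y).
Proof.
move=> a f g; move: y; apply: tensorH_ext => [||m x]; [by lin_tac | | by rewrite !hatE].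
exact: (lin_add (lin_scaler _ (linearP (hat f))) (linearP (hat g))).
Qed.

(** Conversely, balancing turns m h^(1) \ox S(h^(2)) x into m \ox h^(1) S(h^(2)) x, and the antipode
    cancels again. *)
Fact unhat_subproof n (g : XA n -> k^o) : lin g ->
  (fun x => g (quotv_class _ x)) \in @linformH k H M A n.
Proof.
move=> lg; rewrite unfold_in; apply/asboolP.
have lgq : lin (fun x : tensor M (tpow A n) => g (quotv_class _ x)).
  by move=> a x y; rewrite linearP; apply: lg.
split; first by move=> a x y; rewrite linearP; apply: lg.
move=> x h; apply: (etrans _ (mulrC _ _)); move: x.
pose lhs x : k^o := g (quotv_class _ (ract_tens x h)).
pose rhs x : k^o := counit h *: g (quotv_class _ x).
apply: (tensor_ext (f := lhs) (g := rhs)) => [||m x].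
- exact: (lin_compl lgq (@lin_ract_tens n h)).
- exact: lin_scaler.
rewrite /lhs /rhs ract_tens_pure linear_sum (lin_apply_sum _ _ lg).
transitivity (\sum_(p <- pures (comul h)) g (tensH _ m (diag n (p.1 * antipode p.2) x))).
  by apply: eq_bigr => p _; rewrite diagM -tensH_act.
rewrite -(lin_apply_sum (f := fun y => g (tensH _ m (diag n y x)))); lin_tac.
rewrite antipoder (lin_applyZ (f := fun y => g (tensH _ m (diag n y x)))); lin_tac.
by rewrite diag1.
Qed.

Definition unhat n (g : {linear XA n -> k^o}) : homH M A n :=
  Subspace (unhat_subproof (linearP g)).

Lemma unhatK n (g : {linear XA n -> k^o}) : hat (unhat g) =1 g.
Proof. by apply: tensorH_ext => [||m x]; [by lin_tac | by lin_tac | rewrite hatE]. Qed.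

Section Precomp.
Variables (n p : nat) (L : {linear XA p -> XA n}).

Definition precompH_fun (f : homH M A n) : homH M A p :=
  unhat (lin_of (lin_compl (linearP (hat f)) (linearP L))).

Lemma hat_precompH_fun f y : hat (precompH_fun f) y = hat f (L y).
Proof. by rewrite unhatK. Qed.

Fact precompH_linear : linear precompH_fun.
Proof.
move=> a f g; apply: hat_inj => y.
by rewrite hat_precompH_fun lin_hat (lin_hat y) !hat_precompH_fun.
Qed.

Definition precompH : {linear homH M A n -> homH M A p} := lin_of precompH_linear.

Lemma hat_precompH f y : hat (precompH f) y = hat f (L y).
Proof. exact: hat_precompH_fun. Qed.
End Precomp.

Lemma hat_seq_ext n (f g : homH M A n) :
  (forall m s, size s = n.+1 -> hat f (vtens n m s) = hat g (vtens n m s)) -> f = g.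
Proof.
move=> fg; apply: hat_inj; apply: vtens_ext => //; lin_tac.
Qed.
End HomHDual.

Section AlgebraOps.
Variables (k : fieldType) (H : hopfType k) (A : leftHModType H).
Variables (mu : A -> A -> A) (eta : A).
Hypotheses (lmul : forall b, lin (mu^~ b)) (lmur : forall a, lin (mu a)).

(* [fac i n] multiplies the factors number i and i.+1 and [ins i n] inserts    *)
(* [eta] after the factor number i; they are 0 if i > n.                       *)
Fixpoint fac i n : tpow A n.+1 -> tpow A n :=
  match i, n return tpow A n.+1 -> tpow A n with
  | 0, 0 => fun t => \sum_(q <- pures t) mu q.1 q.2
  | 0, n'.+1 => fun t => \sum_(q <- pures t) \sum_(p <- pures (q.2 : tensor A (tpow A n')))
                  (mu q.1 p.1 \ox p.2 : tpow A n'.+1)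
  | i'.+1, 0 => fun=> 0
  | i'.+1, n'.+1 => tmapr (@fac i' n')
  end.
Arguments fac i n t : clear implicits.

Fixpoint ins i n : tpow A n -> tpow A n.+1 :=
  match i, n return tpow A n -> tpow A n.+1 with
  | 0, 0 => fun t => t \ox eta
  | 0, n'.+1 => fun t => \sum_(q <- pures t) q.1 \ox (eta \ox q.2 : tpow A n'.+1)
  | i'.+1, 0 => fun=> 0
  | i'.+1, n'.+1 => tmapr (@ins i' n')
  end.
Arguments ins i n t : clear implicits.

Lemma lin_fac i n (U : lmodType k) (g : U -> tpow A n.+1) :
  lin g -> lin (fun u => fac i n (g u)).
Proof.
suff l : lin (fac i n) by move=> lg a x y; rewrite lg l.
elim: i n {g} => [|i IH] [|n] //=; [by lin_tac | by lin_tac | exact: lin_cst0 |].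
exact: (lin_tmapr (g := id)) (IH n) (@lin_id _ _).
Qed.

Lemma lin_ins i n (U : lmodType k) (g : U -> tpow A n) :
  lin g -> lin (fun u => ins i n (g u)).
Proof.
suff l : lin (ins i n) by move=> lg a x y; rewrite lg l.
elim: i n {g} => [|i IH] [|n] //=; [by lin_tac | by lin_tac | exact: lin_cst0 |].
exact: (lin_tmapr (g := id)) (IH n) (@lin_id _ _).
Qed.

Ltac lin_extra ::= first
  [ lin_rotation
  | match goal with
    | |- lin (fun x => fac ?i ?n (@?g x)) => apply: (@lin_fac i n _ g)
    | |- lin (fun x => ins ?i ?n (@?g x)) => apply: (@lin_ins i n _ g)
    end ].

Lemma facS_tens i n a (t : tpow A n.+1) : fac i.+1 n.+1 (a \ox t) = a \ox fac i n t.
Proof. exact/tmapr_tens/lin_fac. Qed.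

Lemma insS_tens i n a (t : tpow A n) : ins i.+1 n.+1 (a \ox t) = a \ox ins i n t.
Proof. exact/tmapr_tens/lin_ins. Qed.

Lemma fac0_tens n a b (t : tpow A n) :
  fac 0 n.+1 (a \ox (b \ox t : tpow A n.+1)) = mu a b \ox t.
Proof. by rewrite /= sum_pures; lin_tac; rewrite /= sum_pures; lin_tac. Qed.

Lemma ins0_tens n a (t : tpow A n) :
  ins 0 n.+1 (a \ox t) = a \ox (eta \ox t : tpow A n.+1).
Proof. by rewrite /= sum_pures; lin_tac. Qed.

Lemma fac0_tpure n a b (s : seq A) : size s = n ->
  fac 0 n (tpure n.+1 [:: a, b & s]) = tpure n (mu a b :: s).
Proof.
case: n => [|n] sz; last by rewrite [LHS]fac0_tens.
by rewrite /= sum_pures; lin_tac.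
Qed.

Lemma ins0_tpure n a (s : seq A) : size s = n ->
  ins 0 n (tpure n (a :: s)) = tpure n.+1 [:: a, eta & s].
Proof. by case: n => [|n] sz //; rewrite [LHS]ins0_tens. Qed.

Arguments fac : simpl never.
Arguments ins : simpl never.

Lemma fac_tpure i n (s : seq A) : size s = n.+2 -> (i <= n)%N ->
  fac i n (tpure n.+1 s) = tpure n (take i s ++ mu s`_i s`_i.+1 :: drop i.+2 s).
Proof.
elim: i n s => [|i IH] n [|a [|b s]] // [sz]; first by rewrite fac0_tpure //= drop0.
case: n sz => [//|n] sz le_in; rewrite [LHS]facS_tens IH //=.
by rewrite sz.
Qed.

Lemma ins_tpure i n (s : seq A) : size s = n.+1 -> (i <= n)%N ->
  ins i n (tpure n s) = tpure n.+1 (take i.+1 s ++ eta :: drop i.+1 s).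
Proof.
elim: i n s => [|i IH] n [|a s] // [sz]; first by rewrite ins0_tpure //= drop0 take0.
by case: n sz => [//|n] sz le_in; rewrite [LHS]insS_tens IH.
Qed.

Lemma fac_snoc i n w (t : tpow A n.+1) : (i <= n)%N ->
  fac i n.+1 (snoc n.+1 w t) = snoc n w (fac i n t).
Proof.
elim: i n t => [|i IH] n t.
  move=> _; move: t; apply: tpow_seq_ext => [||[|a [|b s]] // sz]; [by lin_tac | by lin_tac |].
  rewrite snoc_tpure // !rcons_cons; move: sz => [sz].
  rewrite [LHS]fac0_tpure ?size_rcons ?sz // fac0_tpure // snoc_tpure //=.
  by rewrite sz.
case: n t => [//|n] t le_in; move: t.
apply: tpow_tens_ext => [||a t]; [by lin_tac | by lin_tac |].
by rewrite snoc_tens !facS_tens IH // snoc_tens.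
Qed.

Lemma ins_snoc i n w (t : tpow A n) : (i <= n)%N ->
  ins i n.+1 (snoc n w t) = snoc n.+1 w (ins i n t).
Proof.
elim: i n t => [|i IH] n t.
  move=> _; move: t; apply: tpow_seq_ext => [||[|a s] // sz]; [by lin_tac | by lin_tac |].
  rewrite snoc_tpure // !rcons_cons; move: sz => [sz].
  rewrite [LHS]ins0_tpure ?size_rcons ?sz // ins0_tpure // snoc_tpure //=.
  by rewrite sz.
case: n t => [//|n] t le_in; move: t.
apply: tpow_tens_ext => [||a t]; [by lin_tac | by lin_tac |].
by rewrite snoc_tens !insS_tens IH // snoc_tens.
Qed.

Hypothesis muA : associative mu.
Hypotheses (mu1l : left_id eta mu) (mu1r : right_id eta mu).
Hypothesis lact_mu : forall h a b, lact h (mu a b) =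
  \sum_(p <- pures (comul h)) mu (lact p.1 a) (lact p.2 b).
Hypothesis lact_eta : forall h, lact h eta = counit h *: eta.

(** Associativity is the case i = 0, j = 1. These are simplicial identities; precomposition turns
    them into cosimplicial ones. *)
Lemma fac_fac n i j x : (i < j <= n.+1)%N ->
  fac i n (fac j n.+1 x) = fac j.-1 n (fac i n.+1 x).
Proof.
elim: i n j x => [|i IH] n [|j] x //.
  case: j x => [|j] x le_jn.
    move: x; apply: tpow_seq_ext => [||[|a [|b [|c s]]] // [sz]]; [by lin_tac | by lin_tac |].
    rewrite [Y in fac 0 n Y = _]facS_tens fac0_tpure //.
    apply: (etrans (fac0_tpure a (mu b c) sz)); rewrite muA.
    by rewrite [Y in _ = fac 0 n Y]fac0_tpure /= ?sz // [RHS]fac0_tpure.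
  case: n le_jn x => [|n] le_jn; first by case: j le_jn.
  apply: tpow_tens_ext => [||a]; [by lin_tac | by lin_tac |].
  apply: tpow_tens_ext => [||b t]; [by lin_tac | by lin_tac |].
  by rewrite !facS_tens !fac0_tens facS_tens.
rewrite ltnS => /andP[lt_ij le_jn].
case: n le_jn x => [|n] le_jn; first by lia.
apply: tpow_tens_ext => [||a t]; [by lin_tac | by lin_tac |].
case: j lt_ij le_jn => [//|j] lt_ij le_jn.
by rewrite !facS_tens IH // lt_ij.
Qed.

Lemma ins_ins n i j x : (i <= j <= n)%N ->
  ins i n.+1 (ins j n x) = ins j.+1 n.+1 (ins i n x).
Proof.
elim: i n j x => [|i IH] n j x.
  case: j x => [|j] x le_jn.
    move: x; apply: tpow_seq_ext => [||[|a s] // [sz]]; [by lin_tac | by lin_tac |].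
    by rewrite ins0_tpure // [RHS]insS_tens !ins0_tpure //= sz.
  case: n le_jn x => [|n] le_jn //.
  apply: tpow_tens_ext => [||a t]; [by lin_tac | by lin_tac |].
  by rewrite !insS_tens !ins0_tens !insS_tens.
case: j x => [|j] x //; rewrite ltnS => /andP[lt_ij].
case: n x => [|n] x // le_jn; move: x.
apply: tpow_tens_ext => [||a t]; [by lin_tac | by lin_tac |].
by rewrite !insS_tens IH // lt_ij.
Qed.

Lemma fac_ins_lt n i j x : (i < j <= n.+1)%N ->
  fac i n.+1 (ins j n.+1 x) = ins j.-1 n (fac i n x).
Proof.
elim: i n j x => [|i IH] n [|j] x //.
  case: j x => [|j] x le_jn.
    move: x; apply: tpow_seq_ext => [||[|a [|b s]] // [sz]]; [by lin_tac | by lin_tac |].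
    rewrite [X in fac _ _ X]insS_tens ins0_tpure // fac0_tpure // ins0_tpure //.
    by apply: (etrans (@fac0_tpure n.+1 a b (eta :: s) _)); rewrite /= ?sz.
  case: n le_jn x => [|n] le_jn; first by case: j le_jn.
  apply: tpow_tens_ext => [||a]; [by lin_tac | by lin_tac |].
  apply: tpow_tens_ext => [||b t]; [by lin_tac | by lin_tac |].
  by rewrite !insS_tens !fac0_tens insS_tens.
rewrite ltnS => /andP[lt_ij le_jn].
case: n le_jn x => [|n] le_jn; first by lia.
apply: tpow_tens_ext => [||a t]; [by lin_tac | by lin_tac |].
case: j lt_ij le_jn => [//|j] lt_ij le_jn.
by rewrite insS_tens !facS_tens insS_tens IH // lt_ij.
Qed.

Lemma fac_ins_eq n j x : (j <= n)%N -> fac j n (ins j n x) = x.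
Proof.
elim: j n x => [|j IH] n x.
  move=> _; move: x; apply: tpow_seq_ext => [||[|a s] // [sz]]; [by lin_tac | by lin_tac |].
  by rewrite ins0_tpure // fac0_tpure // mu1r.
case: n x => [//|n] x le_jn; move: x.
apply: tpow_tens_ext => [||a t]; [by lin_tac | by lin_tac |].
by rewrite insS_tens facS_tens IH.
Qed.

Lemma fac_ins_eqS n j x : (j < n)%N -> fac j.+1 n (ins j n x) = x.
Proof.
elim: j n x => [|j IH] [|n] x //.
  move=> _; move: x.
  apply: tpow_seq_ext => [||[|a [|b s]] // [sz]]; [by lin_tac | by lin_tac |].
  by rewrite ins0_tpure /= ?sz // [LHS]facS_tens fac0_tpure // mu1l.
rewrite ltnS => le_jn; move: x.
apply: tpow_tens_ext => [||a t]; [by lin_tac | by lin_tac |].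
by rewrite insS_tens facS_tens IH.
Qed.

Lemma fac_ins_gt n i j x : (j.+1 < i <= n.+1)%N ->
  fac i n.+1 (ins j n.+1 x) = ins j n (fac i.-1 n x).
Proof.
elim: j n i x => [|j IH] [|n] [|[|i]] x //; try lia.
  move=> _; move: x.
  apply: tpow_tens_ext => [||a t]; [by lin_tac | by lin_tac |].
  by rewrite !facS_tens !ins0_tens !facS_tens.
rewrite ltnS => /andP[lt_ji le_in]; move: x.
apply: tpow_tens_ext => [||a t]; [by lin_tac | by lin_tac |].
by rewrite insS_tens !facS_tens [in RHS]insS_tens IH //; lia.
Qed.

Lemma fac00_tens (a b : A) : fac 0 0 (a \ox b) = mu a b.
Proof. exact: (@fac0_tpure 0 a b [::]). Qed.

Lemma diag_fac i n h x : diag n h (fac i n x) = fac i n (diag n.+1 h x).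
Proof.
elim: i n h x => [|i IH] [|n] h x.
- move: x; apply: tpow_tens_ext => [||a b]; [by lin_tac | by lin_tac |].
  rewrite diag_tens (lin_apply_sum (f := fac 0 0)); lin_tac.
  rewrite fac00_tens; under [RHS]eq_bigr do rewrite fac00_tens.
  exact: lact_mu.
- move: x; apply: tpow_tens_ext => [||a]; [by lin_tac | by lin_tac |].
  apply: tpow_tens_ext => [||b t]; [by lin_tac | by lin_tac |].
  rewrite fac0_tens !diag_tens (lin_apply_sum (f := fac _ _)); lin_tac.
  under eq_bigr do rewrite lact_mu tens_suml.
  rewrite comul_assocl; lin_tac; apply: eq_bigr => p _.
  rewrite diag_tens tens_sumr (lin_apply_sum (f := fac _ _)); lin_tac.
  by apply: eq_bigr => q _; rewrite fac0_tens.
- exact/lin_apply0/diag_linear.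
- move: x; apply: tpow_tens_ext => [||a t]; [by lin_tac | by lin_tac |].
  rewrite facS_tens !diag_tens (lin_apply_sum (f := fac _ _)); lin_tac.
  by apply: eq_bigr => p _; rewrite facS_tens IH.
Qed.

Lemma diag_ins i n h x : diag n.+1 h (ins i n x) = ins i n (diag n h x).
Proof.
elim: i n h x => [|i IH] [|n] h x.
- rewrite -[ins 0 0 x]/(x \ox eta) -[RHS]/(diag 0 h x \ox eta) diag_tens.
  transitivity (\sum_(p <- pures (comul h)) counit p.2 *: (lact p.1 x \ox eta)).
    apply: eq_bigr => p _; rewrite -[diag 0 _ _]/(lact _ _) lact_eta.
    by rewrite (lin_applyZ (f := tens _)); lin_tac.
  by rewrite counit_sumr; lin_tac.
- move: x; apply: tpow_tens_ext => [||a t]; [by lin_tac | by lin_tac |].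
  rewrite ins0_tens !diag_tens (lin_apply_sum (f := ins _ _)); lin_tac.
  apply: eq_bigr => p _; rewrite ins0_tens diag_tens tens_sumr.
  transitivity (\sum_(q <- pures (comul p.2))
      counit q.1 *: (lact p.1 a \ox (eta \ox diag n q.2 t : tpow A n.+1))).
    apply: eq_bigr => q _; rewrite lact_eta.
    rewrite -(lin_applyZ (f := fun x => lact p.1 a \ox (x \ox diag n q.2 t : tpow A n.+1))) //.
    by lin_tac.
  by rewrite counit_suml; lin_tac.
- exact/lin_apply0/diag_linear.
- move: x; apply: tpow_tens_ext => [||a t]; [by lin_tac | by lin_tac |].
  rewrite insS_tens !diag_tens (lin_apply_sum (f := ins _ _)); lin_tac.
  by apply: eq_bigr => p _; rewrite insS_tens IH.
Qed.

Lemma rot_act_fac n i h x : (i < n)%N ->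
  rot_act n h (fac i.+1 n x) = fac i n (rot_act n.+1 h x).
Proof.
case: n x => [//|n] x le_in; move: x.
apply: tpow_tens_ext => [||a t]; [by lin_tac | by lin_tac |].
by rewrite facS_tens !rot_act_tens fac_snoc.
Qed.

Lemma rot_act_ins n i h x : (i < n)%N ->
  rot_act n.+1 h (ins i.+1 n x) = ins i n (rot_act n h x).
Proof.
case: n x => [//|n] x le_in; move: x.
apply: tpow_tens_ext => [||a t]; [by lin_tac | by lin_tac |].
by rewrite insS_tens !rot_act_tens ins_snoc.
Qed.

Variable M : saydType H.
Notation XA n := (tensorH M (@diag k H A n)).

Fact afac_subproof i n : {L : {linear XA n.+1 -> XA n} |
  forall m x, L (tensH _ m x) = tensH _ m (fac i n x)}.
Proof.
apply: tensorH_map => [|h x]; first exact: (lin_fac i (@lin_id _ _)).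
by rewrite diag_fac.
Qed.

Fact ains_subproof i n : {L : {linear XA n -> XA n.+1} |
  forall m x, L (tensH _ m x) = tensH _ m (ins i n x)}.
Proof.
apply: tensorH_map => [|h x]; first exact: (lin_ins i (@lin_id _ _)).
by rewrite diag_ins.
Qed.

Definition afac i n := sval (afac_subproof i n).
Definition ains i n := sval (ains_subproof i n).

Lemma afacE i n m x : afac i n (tensH _ m x) = tensH _ m (fac i n x).
Proof. exact: (svalP (afac_subproof i n)). Qed.

Lemma ainsE i n m x : ains i n (tensH _ m x) = tensH _ m (ins i n x).
Proof. exact: (svalP (ains_subproof i n)). Qed.

Lemma afac_vtens i n m (s : seq A) : size s = n.+2 -> (i <= n)%N ->
  afac i n (vtens n.+1 m s) = vtens n m (take i s ++ mu s`_i s`_i.+1 :: drop i.+2 s).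
Proof. by move=> sz le_in; rewrite /vtens afacE fac_tpure. Qed.

Lemma ains_vtens i n m (s : seq A) : size s = n.+1 -> (i <= n)%N ->
  ains i n (vtens n m s) = vtens n.+1 m (take i.+1 s ++ eta :: drop i.+1 s).
Proof. by move=> sz le_in; rewrite /vtens ainsE ins_tpure. Qed.

Fact tau_inv_linear n : linear (fun x : XA n => iter n (tau M n) x).
Proof.
suff l j : lin (fun x : XA n => iter j (tau M n) x) by exact: l.
by elim: j => [//|j IH] a x y; rewrite !iterS IH linearP.
Qed.

(** The inverse of [tau], by [iter_tau_id]. Taken as a power of [tau], it is linear and well defined
    on the balanced tensor product at once. *)
Definition tau_inv n : {linear XA n -> XA n} := lin_of (@tau_inv_linear n).

Lemma tau_invK n x : tau_inv n (tau M n x) = x.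
Proof. by rewrite /= -iterSr iter_tau_id. Qed.

Lemma tauK n x : tau M n (tau_inv n x) = x.
Proof. by rewrite /= -iterS iter_tau_id. Qed.

Lemma iter_tau_inv_id n x : iter n.+1 (tau_inv n) x = x.
Proof.
suff K j y : iter j (tau M n) (iter j (tau_inv n) y) = y.
  by rewrite -[RHS](K n.+1) iter_tau_id.
by elim: j y => [//|j IH] y; rewrite iterSr [iter j.+1 (tau_inv n) y]iterS tauK IH.
Qed.

Fact last_afac_linear n : linear (fun x : XA n.+1 => afac 0 n (tau_inv n.+1 x)).
Proof. by move=> a x y; rewrite !linearP. Qed.

(** Forms are pulled back, so tau_n delta_0 f becomes f composed with t^-1 and then the product of
    the first two factors: a_n is first brought to the front, then multiplied by a_0. *)
Definition alg_ops : cocyclic_ops (fun n => homH M A n) := CocyclicOps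
  (fun n i => precompH (if (i <= n)%N then afac i n else lin_of (@last_afac_linear n)))
  (fun n i => precompH (ains i n)) (fun n => precompH (tau_inv n)).

Lemma hat_coface n i f y : (i <= n)%N -> hat (coface alg_ops n i f) y = hat f (afac i n y).
Proof. by move=> le_in; rewrite hat_precompH le_in. Qed.

Lemma hat_coface_last n f y :
  hat (coface alg_ops n n.+1 f) y = hat f (afac 0 n (tau_inv n.+1 y)).
Proof. by rewrite hat_precompH ltnn. Qed.

Lemma hat_codegen n i f y : hat (codegen alg_ops n i f) y = hat f (ains i n y).
Proof. exact: hat_precompH. Qed.

Lemma hat_cocyc n f y : hat (cocyc alg_ops n f) y = hat f (tau_inv n y).
Proof. exact: hat_precompH. Qed.

Lemma hat_iter_cocyc n j f y :
  hat (iter j (cocyc alg_ops n) f) y = hat f (iter j (tau_inv n) y).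
Proof. by elim: j f y => [//|j IH] f y; rewrite iterSr IH hat_cocyc. Qed.

#[local] Opaque alg_ops tensH tau tau_inv afac ains.

Lemma afac_afac n i j x : (i < j <= n.+1)%N ->
  afac i n (afac j n.+1 x) = afac j.-1 n (afac i n.+1 x).
Proof.
move=> le_ij; move: x; apply: tensorH_ext => [||m x]; [by lin_tac | by lin_tac |].
rewrite [afac j n.+1 _]afacE [afac i n _]afacE [afac i n.+1 _]afacE.
by rewrite [afac j.-1 n _]afacE fac_fac.
Qed.

Lemma ains_ains n i j x : (i <= j <= n)%N ->
  ains i n.+1 (ains j n x) = ains j.+1 n.+1 (ains i n x).
Proof.
move=> le_ij; move: x; apply: tensorH_ext => [||m x]; [by lin_tac | by lin_tac |].
rewrite [ains j n _]ainsE [ains i n.+1 _]ainsE [ains i n _]ainsE.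
by rewrite [ains j.+1 n.+1 _]ainsE ins_ins.
Qed.

Lemma afac_ains_lt n i j x : (i < j <= n.+1)%N ->
  afac i n.+1 (ains j n.+1 x) = ains j.-1 n (afac i n x).
Proof.
move=> le_ij; move: x; apply: tensorH_ext => [||m x]; [by lin_tac | by lin_tac |].
rewrite [ains j n.+1 _]ainsE [afac i n.+1 _]afacE [afac i n _]afacE.
by rewrite [ains j.-1 n _]ainsE fac_ins_lt.
Qed.

Lemma afac_ains_eq n j x : (j <= n)%N -> afac j n (ains j n x) = x.
Proof.
move=> le_jn; move: x; apply: tensorH_ext => [||m x]; [by lin_tac | by lin_tac |].
by rewrite [ains _ _ _]ainsE [afac _ _ _]afacE fac_ins_eq.
Qed.

Lemma afac_ains_eqS n j x : (j < n)%N -> afac j.+1 n (ains j n x) = x.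
Proof.
move=> lt_jn; move: x; apply: tensorH_ext => [||m x]; [by lin_tac | by lin_tac |].
by rewrite [ains _ _ _]ainsE [afac _ _ _]afacE fac_ins_eqS.
Qed.

Lemma afac_ains_gt n i j x : (j.+1 < i <= n.+1)%N ->
  afac i n.+1 (ains j n.+1 x) = ains j n (afac i.-1 n x).
Proof.
move=> le_ij; move: x; apply: tensorH_ext => [||m x]; [by lin_tac | by lin_tac |].
rewrite [ains j n.+1 _]ainsE [afac i n.+1 _]afacE [afac i.-1 n _]afacE.
by rewrite [ains j n _]ainsE fac_ins_gt.
Qed.

Lemma tau_afac n i x : (i < n)%N ->
  tau M n (afac i.+1 n x) = afac i n (tau M n.+1 x).
Proof.
move=> lt_in; move: x; apply: tensorH_ext => [||m x]; [by lin_tac | by lin_tac |].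
rewrite [afac i.+1 n _]afacE [LHS]tauE [tau M n.+1 _]tauE linear_sum.
by apply: eq_bigr => q _; rewrite [RHS]afacE rot_act_fac.
Qed.

Lemma tau_ains n i x : (i < n)%N ->
  tau M n.+1 (ains i.+1 n x) = ains i n (tau M n x).
Proof.
move=> lt_in; move: x; apply: tensorH_ext => [||m x]; [by lin_tac | by lin_tac |].
rewrite [ains i.+1 n _]ainsE [LHS]tauE [tau M n _]tauE linear_sum.
by apply: eq_bigr => q _; rewrite [RHS]ainsE rot_act_ins.
Qed.

(** Two rotations carry the inserted unit to the end, where a coaction leg acts on it by its counit
    and disappears. *)
Lemma tau2_ains0 n x : tau M n.+1 (tau M n.+1 (ains 0 n x)) = ains n n (tau M n x).
Proof.
move: x; apply: vtens_ext => [||m [|a s] // [sz]]; [by lin_tac | by lin_tac |].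
rewrite ains_vtens /= ?sz // take0 drop0.
rewrite [tau M n.+1 (vtens _ m _)]tau_vtens /= ?sz // [tau M n _]tau_vtens //.
rewrite !linear_sum; apply: eq_bigr => q _.
rewrite [LHS]tau_vtens ?size_rcons ?sz //.
rewrite [RHS]ains_vtens ?size_rcons ?sz // take_oversize ?size_rcons ?sz //.
rewrite drop_oversize ?size_rcons ?sz // cats1.
transitivity (\sum_(r <- pures (coact q.2)) counit r.1 *:
    vtens n.+1 r.2 (rcons (rcons s (lact q.1 a)) eta)).
  apply: eq_bigr => r _; rewrite lact_eta; set t := rcons s _.
  pose G (x : A) := vtens n.+1 r.2 (rcons t x).
  apply: (lin_applyZ (f := G)); rewrite /G /vtens => b x y.
  rewrite -!cats1; apply: (lin_compl (f := tensH _ r.2) (g := fun x => tpure n.+1 (t ++ [:: x]))).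
    by lin_tac.
  by apply: (tpure_multilinear (s2 := [::])); rewrite size_rcons sz addn0.
by rewrite coact_counit_sum // /vtens; lin_tac.
Qed.

(** Rotation puts the unit in front of m^(-1) a, so multiplying leaves tau_0, which is the
    identity. *)
Lemma afac_tau_ains00 x : afac 0 0 (tau M 1 (ains 0 0 x)) = x.
Proof.
rewrite -[RHS](iter_tau_id (n := 0)) /=.
move: x; apply: vtens_ext => [||m [|a [|//]] // _]; [by lin_tac | by lin_tac |].
rewrite ains_vtens // [tau M 1 _]tau_vtens // [RHS]tau_vtens // linear_sum.
apply: eq_bigr => q _; rewrite drop1.
apply: (etrans (@afac_vtens 0 0 q.2 [:: eta; lact q.1 a] erefl isT)).
by rewrite /= mu1l.
Qed.

Lemma alg_ops_inner : inner_cocyclic alg_ops.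
Proof.
split.
- move=> n i j f le_ij; apply: hat_inj => y.
  do 4 (rewrite hat_coface; last by lia).
  by rewrite afac_afac.
- move=> n i j f le_ij; apply: hat_inj => y.
  by rewrite !hat_codegen ains_ains.
- move=> n i j f le_ij; apply: hat_inj => y.
  rewrite [LHS]hat_codegen [LHS]hat_coface; last by lia.
  rewrite [RHS]hat_coface; last by lia.
  by rewrite [RHS]hat_codegen afac_ains_lt.
- move=> n j f le_jn; apply: hat_inj => y.
  by rewrite hat_codegen hat_coface // afac_ains_eq.
- move=> n j f lt_jn; apply: hat_inj => y.
  by rewrite hat_codegen hat_coface // afac_ains_eqS.
- move=> f; apply: hat_inj => y.
  (* In degree 1 the inverse rotation is [tau] itself, iterated once. *)
  by rewrite hat_codegen hat_coface_last -[in RHS](afac_tau_ains00 y).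
- move=> n i j f le_ij; apply: hat_inj => y.
  rewrite [LHS]hat_codegen [LHS]hat_coface; last by lia.
  rewrite [RHS]hat_coface; last by lia.
  by rewrite [RHS]hat_codegen afac_ains_gt.
- move=> n [|i] f // le_in; apply: hat_inj => y.
  rewrite hat_cocyc hat_coface; last by lia.
  rewrite hat_coface; last by lia.
  (* Writing [y] as [tau] of its inverse rotation reduces the relation for t^-1 to the one for t. *)
  by rewrite hat_cocyc -{2}(tauK y) -tau_afac ?tau_invK.
- by move=> n f; apply: hat_inj => y; rewrite hat_coface_last hat_cocyc hat_coface.
- move=> n [|i] f // le_in; apply: hat_inj => y.
  rewrite [LHS]hat_cocyc [LHS]hat_codegen [RHS]hat_codegen [RHS]hat_cocyc.
  by rewrite -{2}(tauK y) -tau_ains ?tau_invK.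
- move=> n f; apply: hat_inj => y.
  rewrite [LHS]hat_cocyc [LHS]hat_codegen [RHS]hat_codegen 2![RHS]hat_cocyc.
  by rewrite -{2}(tauK y) -tau2_ains0 !tau_invK.
- by move=> n f; apply: hat_inj => y; rewrite hat_iter_cocyc iter_tau_inv_id.
Qed.

Lemma hat_coface_vtens n i f m (s : seq A) : size s = n.+2 -> (i <= n)%N ->
  hat (coface alg_ops n i f) (vtens n.+1 m s) =
  hat f (vtens n m (take i s ++ mu s`_i s`_i.+1 :: drop i.+2 s)).
Proof. by move=> sz le_in; rewrite hat_coface // afac_vtens. Qed.

Lemma hat_codegen_vtens n i f m (s : seq A) : size s = n.+1 -> (i <= n)%N ->
  hat (codegen alg_ops n i f) (vtens n m s) =
  hat f (vtens n.+1 m (take i.+1 s ++ eta :: drop i.+1 s)).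
Proof. by move=> sz le_in; rewrite hat_codegen ains_vtens. Qed.

Section Inverse.
Variable Sinv : H -> H.
Hypotheses (SK : cancel (antipode : H -> H) Sinv).
Hypothesis (SinvK : cancel Sinv (antipode : H -> H)).

Lemma tau_inv_vtens n m a (s : seq A) : size s = n ->
  tau_inv n (vtens n m (rcons s a)) =
  \sum_(q <- pures (coact m)) vtens n q.2 (lact (Sinv q.1) a :: s).
Proof. exact: iter_tau_inv. Qed.

Lemma hat_cocyc_vtens n f m a (s : seq A) : size s = n ->
  hat (cocyc alg_ops n f) (vtens n m (rcons s a)) =
  \sum_(q <- pures (coact m)) hat f (vtens n q.2 (lact (Sinv q.1) a :: s)).
Proof. by move=> sz; rewrite hat_cocyc tau_inv_vtens // linear_sum. Qed.

Lemma hat_coface_last_vtens n f m a b (s : seq A) : size s = n ->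
  hat (coface alg_ops n n.+1 f) (vtens n.+1 m (a :: rcons s b)) =
  \sum_(q <- pures (coact m)) hat f (vtens n q.2 (mu (lact (Sinv q.1) b) a :: s)).
Proof.
move=> sz; rewrite hat_coface_last -rcons_cons tau_inv_vtens /= ?sz // !linear_sum.
by apply: eq_bigr => q _; rewrite [afac _ _ _]afac_vtens /= ?sz // drop0.
Qed.
End Inverse.
End AlgebraOps.
Arguments fac : simpl never.
Arguments fac {k H A} mu i n t.

Section ModuleAlgebra.
Variables (k : fieldType) (H : hopfType k) (M : saydType H) (A : hmodAlgType H).

Let amul_linl (b : A) : lin (amul^~ b). Proof. exact: (amul_bilinear.1 b). Qed.
Let amul_linr (a : A) : lin (amul a). Proof. exact: (amul_bilinear.2 a). Qed.

Definition modalg_ops : cocyclic_ops (algC M A) :=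
  alg_ops amul_linl amul_linr (@lact_amul k H A) (@lact_aone k H A) M.

Lemma modalg_ops_cocyclic : is_cocyclic modalg_ops.
Proof.
apply/inner_cocyclicP/alg_ops_inner.
- exact: amulA.
- exact: amul1l.
- exact: amul1r.
Qed.

Lemma algC_evalE n (f : algC M A n) m (a : seq A) : algC_eval f m a = hat f (vtens n m a).
Proof. by rewrite /vtens hatE. Qed.

Lemma modalg_ops_coface_vtens n i f m (s : seq A) : size s = n.+2 -> (i <= n)%N ->
  hat (coface modalg_ops n i f) (vtens n.+1 m s) =
  hat f (vtens n m (take i s ++ amul s`_i s`_i.+1 :: drop i.+2 s)).
Proof. exact: hat_coface_vtens. Qed.

Lemma algC_ext n (f g : algC M A n) :
  (forall m (a : n.+1.-tuple A), algC_eval f m a = algC_eval g m a) -> f = g.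
Proof.
move=> fg; apply: hat_seq_ext => m s /eqP sz.
by have := fg m (Tuple sz); rewrite !algC_evalE.
Qed.

Section Formulas.
Variable Sinv : H -> H.
Hypotheses (SK : cancel (antipode : H -> H) Sinv).
Hypothesis (SinvK : cancel Sinv (antipode : H -> H)).

Lemma modalg_ops_formulas : alg_formulas Sinv modalg_ops.
Proof.
split.
- move=> n i f m a le_in; rewrite !algC_evalE.
  by apply: hat_coface_vtens; rewrite ?size_tuple.
- move=> n f m a; rewrite algC_evalE; under eq_bigr do rewrite algC_evalE.
  set g := coface _ _ _ f; case/tupleP: a => a; case/tupleP => b s /=.
  rewrite (lastI b s).
  have sz : size (belast b s) = n by rewrite size_belast size_tuple.
  rewrite -[nth 0 _ n]/(nth 0 (rcons (belast b s) (last b s)) n) nth_rcons sz ltnn eqxx.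
  rewrite -cats1 take_size_cat ?size_belast ?size_tuple // cats1.
  exact: (hat_coface_last_vtens _ _ _ _ SK SinvK f m a _ sz).
- move=> n i f m a le_in; rewrite !algC_evalE.
  by apply: hat_codegen_vtens; rewrite ?size_tuple.
- move=> n f m a; rewrite algC_evalE; under eq_bigr do rewrite algC_evalE.
  set g := cocyc _ _ f; case/tupleP: a => a s /=; rewrite (lastI a s).
  have sz : size (belast a s) = n by rewrite size_belast size_tuple.
  rewrite nth_rcons sz ltnn eqxx -cats1 take_size_cat ?size_belast ?size_tuple // cats1.
  exact: (hat_cocyc_vtens _ _ _ _ SK SinvK f m _ sz).
Qed.

Lemma alg_formulas_same (D D' : cocyclic_ops (algC M A)) :
  alg_formulas Sinv D -> alg_formulas Sinv D' -> same_ops D D'.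
Proof.
move=> fD fD'; split.
- move=> n i f le_in; apply: algC_ext => m a.
  have [le_i|lt_i] := leqP i n.
    exact: (etrans (alg_coface fD f m a le_i) (esym (alg_coface fD' f m a le_i))).
  have -> : i = n.+1 by lia.
  exact: (etrans (alg_coface_last fD f m a) (esym (alg_coface_last fD' f m a))).
- move=> n i f le_in; apply: algC_ext => m a.
  exact: (etrans (alg_codegen fD f m a le_in) (esym (alg_codegen fD' f m a le_in))).
- move=> n f; apply: algC_ext => m a.
  exact: (etrans (alg_cocyc fD f m a) (esym (alg_cocyc fD' f m a))).
Qed.

Lemma alg_define : define_cocyclic_module (@alg_formulas k H M A Sinv).
Proof.
exists modalg_ops; split; [exact: modalg_ops_formulas | exact: modalg_ops_cocyclic |].
by move=> D' fD'; apply: alg_formulas_same => //; exact: modalg_ops_formulas.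
Qed.
End Formulas.
End ModuleAlgebra.

(** * The cup products *)

Section ActionOnTensorPowers.
Variables (k : fieldType) (H : hopfType k) (C A : leftHModType H).
Variables (D : C -> tensor C C) (mu : A -> A -> A) (act : C -> A -> A).
Hypothesis lD : lin D.
Hypotheses (lmul : forall b, lin (mu^~ b)) (lmur : forall a, lin (mu a)).
Hypotheses (lactl : forall a, lin (act^~ a)) (lactr : forall c, lin (act c)).
Hypothesis act_mu : forall c a b,
  act c (mu a b) = \sum_(p <- pures (D c)) mu (act p.1 a) (act p.2 b).
Hypothesis lact_act : forall h c a, lact h (act c a) = act (lact h c) a.

Fixpoint pact n : tpow C n -> tpow A n -> tpow A n :=
  match n return tpow C n -> tpow A n -> tpow A n with
  | 0 => act
  | n'.+1 => fun s t => \sum_(p <- pures s) \sum_(q <- pures t)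
               act p.1 q.1 \ox @pact n' p.2 q.2
  end.
Arguments pact n s t : clear implicits.

Lemma lin_pactr n s (U : lmodType k) (g : U -> tpow A n) :
  lin g -> lin (fun u => pact n s (g u)).
Proof.
suff l : lin (pact n s) by move=> lg a x y; rewrite lg l.
by elim: n s {g} => [|n IH] s; [exact: lactr | rewrite /=; lin_tac].
Qed.

Lemma lin_pactl n (U : lmodType k) (g : U -> tpow C n) t :
  lin g -> lin (fun u => pact n (g u) t).
Proof.
suff l : lin (fun s => pact n s t) by move=> lg a x y; rewrite lg l.
elim: n t {g} => [|n IH] t; first exact: lactl.
have lr m s : lin (pact m s) by exact: lin_pactr.
by rewrite /=; lin_tac.
Qed.

Ltac lin_extra ::= first
  [ lin_rotation
  | match goal with
    | |- lin (fun x => fac _ ?i ?n (@?g x)) => apply: (@lin_fac _ _ _ _ lmul lmur i n _ g)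
    | |- lin (fun x => del _ ?i ?n (@?g x)) => apply: (@lin_del _ _ _ _ lD i n _ g)
    | |- lin (fun x => pact ?n ?s (@?g x)) => apply: (@lin_pactr n s _ g)
    | |- lin (fun x => pact ?n (@?g x) ?t) => apply: (@lin_pactl n _ g t)
    end ].

Lemma pact_tens n c (s : tpow C n) a (t : tpow A n) :
  pact n.+1 (c \ox s) (a \ox t) = act c a \ox pact n s t.
Proof. by rewrite /= sum_pures; lin_tac; rewrite /= sum_pures; lin_tac. Qed.

Lemma pact_tpure n (s : seq C) (a : seq A) : size s = n.+1 -> size a = n.+1 ->
  pact n (tpure n s) (tpure n a) = tpure n [seq act q.1 q.2 | q <- zip s a].
Proof.
elim: n s a => [|n IH] [|c s] [|b a] // [sz] [sza].
by rewrite [LHS]pact_tens IH.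
Qed.

Arguments pact : simpl never.

Lemma diag_pact n h s t : pact n (diag n h s) t = diag n h (pact n s t).
Proof.
elim: n h s t => [|n IH] h s t; first by symmetry; apply: lact_act.
move: s; apply: tpow_tens_ext => [||c s]; [by lin_tac | by lin_tac |].
move: t; apply: tpow_tens_ext => [||a t]; [by lin_tac | by lin_tac |].
rewrite diag_tens pact_tens diag_tens.
rewrite (lin_apply_sum (f := fun x => pact n.+1 x (a \ox t))); lin_tac.
by apply: eq_bigr => p _; rewrite pact_tens IH lact_act.
Qed.

(** At position [i] this is the axiom c(ab) = (c^(1) a)(c^(2) b): splitting in C is adjoint to
    multiplying in A. *)
Lemma fac_pact_del i n s t : (i <= n)%N ->
  fac mu i n (pact n.+1 (del D i n s) t) = pact n s (fac mu i n t).
Proof.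
elim: i n s t => [|i IH] n s t.
  move=> _; move: s; apply: tpow_seq_ext => [||[|c s] // [sz]]; [by lin_tac | by lin_tac |].
  move: t; apply: tpow_seq_ext => [||[|a [|b t]] // [szt]]; [by lin_tac | by lin_tac |].
  rewrite del0_tpure // (lin_apply_sum (f := fun x => fac mu 0 n (pact n.+1 x _))); lin_tac.
  rewrite fac0_tpure // pact_tpure /= ?sz ?szt // act_mu.
  pose G x := tpure n (x :: [seq act q.1 q.2 | q <- zip s t]).
  rewrite -[RHS]/(G _) (lin_apply_sum (f := G)); last first.
    by apply: (@tpure_multilinear _ _ _ [::]); rewrite size_map size_zip sz szt minnn.
  apply: eq_bigr => p _.
  rewrite (@pact_tpure n.+1 [:: p.1, p.2 & s] [:: a, b & t]) /= ?sz ?szt //.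
  apply: (fac0_tpure lmul lmur (act p.1 a) (act p.2 b)).
  by rewrite size_map size_zip sz szt minnn.
case: n s t => [//|n] s t le_in; move: s.
apply: tpow_tens_ext => [||c s]; [by lin_tac | by lin_tac |].
move: t; apply: tpow_tens_ext => [||a t]; [by lin_tac | by lin_tac |].
by rewrite delS_tens // pact_tens !facS_tens // pact_tens IH.
Qed.

Variable M : saydType H.
Notation X V n := (tensorH M (@diag k H V n)).

Fact tpact_subproof n (t : tpow A n) : {L : {linear X C n -> X A n} |
  forall m s, L (tensH _ m s) = tensH _ m (pact n s t)}.
Proof. by apply: tensorH_map => [|h x]; [lin_tac | rewrite diag_pact]. Qed.

Definition tpact n t := sval (@tpact_subproof n t).

Lemma tpactE n t m s : tpact t (tensH _ m s) = tensH _ m (pact n s t).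
Proof. exact: (svalP (tpact_subproof t)). Qed.

Lemma lin_tpact n (x : X C n) : lin (fun t => tpact t x).
Proof.
move=> a t u; move: x; apply: tensorH_ext => [||m s]; [by lin_tac | | ].
  exact: (lin_add (lin_scaler _ (linearP (tpact t))) (linearP (tpact u))).
by rewrite !tpactE (lin_compl (f := tensH _ m) (g := pact n s)); lin_tac.
Qed.

Lemma tpact_vtens n m (s : seq C) (a : seq A) : size s = n.+1 -> size a = n.+1 ->
  tpact (tpure n a) (vtens n m s) = vtens n m [seq act q.1 q.2 | q <- zip s a].
Proof. by move=> sz sza; rewrite /vtens tpactE pact_tpure. Qed.

(** Both sides move c_0 a_0 to the end, and m^(-1) may act on c_0 or on c_0 a_0 by [lact_act]. On A
    alone only the plain cyclic shift is left. *)
Lemma tpact_tau n a (s : seq A) (x : X C n) : size s = n ->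
  tpact (tpure n (rcons s a)) (tau M n x) = tau M n (tpact (tpure n (a :: s)) x).
Proof.
move=> sza; move: x.
apply: vtens_ext => [||m [|c t] // [sz]]; [by lin_tac | by lin_tac |].
rewrite tau_vtens // tpact_vtens /= ?sz ?sza // tau_vtens; last first.
  by rewrite size_map size_zip sz sza minnn.
rewrite linear_sum; apply: eq_bigr => q _.
rewrite [LHS]tpact_vtens ?size_rcons ?sz ?sza //.
by rewrite zip_rcons ?sz ?sza // map_rcons /= lact_act.
Qed.
End ActionOnTensorPowers.

Section UsualCochains.
Variables (k : fieldType) (A : unitalAlgType k).

Lemma usualC_ext n (f g : usualC A n) :
  (forall a : n.+1.-tuple A, usualC_eval f a = usualC_eval g a) -> f = g.
Proof.
have lf (h : usualC A n) : lin (subspace_val h).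
  by case: h => h /=; rewrite unfold_in => /asboolP.
move=> fg; apply: val_inj; apply: funext.
apply: tpow_seq_ext => [||s /eqP sz]; [exact: lf | exact: lf | exact: (fg (Tuple sz))].
Qed.

Lemma usual_coface_cocyc n (f : usualC A n) :
  coface (usual_ops A) n n.+1 f = cocyc (usual_ops A) n.+1 (coface (usual_ops A) n 0 f).
Proof.
apply: usualC_ext => a; rewrite usual_coface_last usual_cocyc.
have sz : size (a`_n.+1 :: take n.+1 a) == n.+2 by rewrite /= size_takel ?size_tuple.
apply/esym/(etrans (usual_coface f (Tuple sz) (leq0n n))).
by rewrite /=; case/tupleP: a {sz} => a s; rewrite /= drop0.
Qed.
End UsualCochains.

Section Pairing.
Variables (k : fieldType) (H : hopfType k) (M : saydType H).
Variables (C : hmodCoalgType H) (A : hmodAlgType H) (act : C -> A -> A).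
Hypothesis act_CA : coalg_action act.

Let actl (a : A) : lin (act^~ a). Proof. exact: ((cact_bilinear act_CA).1 a). Qed.
Let actr (c : C) : lin (act c). Proof. exact: ((cact_bilinear act_CA).2 c). Qed.
Let lact_act h c a : lact h (act c a) = act (lact h c) a.
Proof. exact: (cact_lact act_CA). Qed.

Notation PA t := (tpact actl actr lact_act M t).

Fact cochain_pairing_subproof n (x : coalgC M C n) (f : algC M A n) :
  (fun t => hat f (PA t x)) \in @linform k (tpow A n).
Proof.
rewrite unfold_in; apply/asboolP => a t u.
by rewrite lin_tpact linearP.
Qed.

Definition cochain_pairing n (x : coalgC M C n) (f : algC M A n) : usualC A n :=
  Subspace (cochain_pairing_subproof x f).

Lemma cochain_pairingE n x (f : algC M A n) a :
  usualC_eval (cochain_pairing x f) a = hat f (PA (tpure n a) x).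
Proof. by []. Qed.

Lemma lin_cochain_pairingl n (f : algC M A n) : lin (fun x => cochain_pairing x f).
Proof. by move=> a x y; apply: usualC_ext => t; rewrite cochain_pairingE !linearP. Qed.

Lemma lin_cochain_pairingr n (x : coalgC M C n) : lin (cochain_pairing x).
Proof. by move=> a f g; apply: usualC_ext => t; rewrite cochain_pairingE (lin_hat _). Qed.

(** Both arguments take the coface of the same index, as in a levelwise tensor product of cocyclic
    modules. *)
Lemma cochain_pairing_coface_inner n i x f : (i <= n)%N ->
  cochain_pairing (coface (modcoalg_ops M C) n i x) (coface (modalg_ops M A) n i f) =
  coface (usual_ops A) n i (cochain_pairing x f).
Proof.
move=> le_in; apply: usualC_ext => a; apply/esym.
apply: (etrans (usual_coface _ _ le_in)).
rewrite !cochain_pairingE; apply/esym; apply: (etrans (hat_coface _ _ _ _ _ _ le_in)).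
have amul_linl b : lin ((@amul k A)^~ b) := amul_bilinear.1 b.
have amul_linr b : lin (@amul k A b) := amul_bilinear.2 b.
congr (hat f _); rewrite -(fac_tpure amul_linl amul_linr) ?size_tuple //.
move: (tpure n.+1 a) x => t; apply: tensorH_ext => [||m s].
- by apply: (lin_compl (f := afac _ _ _ _ _ _)); lin_tac.
- by lin_tac.
have E : coface (modcoalg_ops M C) n i (tensH (@diag k H C n) m s) =
    tensH (@diag k H C n.+1) m (del (comul : C -> tensor C C) i n s).
  exact: coalg_ops_coface.
rewrite E; apply: (etrans (congr1 _ (tpactE actl actr lact_act t m _))).
rewrite [LHS]afacE.
rewrite (tpactE actl actr lact_act); congr (tensH _ m _).
apply: fac_pact_del => //; [exact: (linearP comul) | exact: (cact_mul act_CA)].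
Qed.

(** The operator of C is t and that of A is the transpose of t^-1; they cancel through [tpact_tau],
    leaving the usual cyclic operator. *)
Lemma cochain_pairing_cocyc n x f :
  cochain_pairing (cocyc (modcoalg_ops M C) n x) (cocyc (modalg_ops M A) n f) =
  cocyc (usual_ops A) n (cochain_pairing x f).
Proof.
apply: usualC_ext => a; apply/esym; apply: (etrans (usual_cocyc _ _)).
rewrite !cochain_pairingE; apply/esym; apply: (etrans (hat_cocyc _ _ _ _ _ _)).
congr (hat f _); case/tupleP: a => a s; rewrite /= (lastI a s).
have sz : size (belast a s) = n by rewrite size_belast size_tuple.
rewrite nth_rcons sz ltnn eqxx -cats1 take_size_cat // cats1.
rewrite -[RHS]tau_invK; congr (tau_inv _ _ _ _).
exact: (tpact_tau actl actr lact_act).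
Qed.

(** In all three modules the last coface is tau delta_0, so it is covered by the two previous
    compatibilities. *)
Lemma cochain_pairing_coface n i x f : (i <= n.+1)%N ->
  cochain_pairing (coface (modcoalg_ops M C) n i x) (coface (modalg_ops M A) n i f) =
  coface (usual_ops A) n i (cochain_pairing x f).
Proof.
rewrite leq_eqVlt => /predU1P[->|]; last by rewrite ltnS; exact: cochain_pairing_coface_inner.
rewrite -(cocyc_coface0 (modcoalg_ops_cocyclic M C)) -(cocyc_coface0 (modalg_ops_cocyclic M A)).
by rewrite usual_coface_cocyc -cochain_pairing_coface_inner // -cochain_pairing_cocyc.
Qed.
End Pairing.

Section SweedlerLists.
Variables (k : fieldType) (C : coalgType k).

Lemma size_sweedler n (c : C) d : d \in sweedler n c -> size d = n.+1.
Proof.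
elim: n c d => [|n IH] c d /=; first by rewrite inE => /eqP->.
by case/allpairsPdep=> p [s [_ sn ->]] /=; rewrite (IH p.2).
Qed.

(** [sweedler] recurses into the last leg, so one more coproduct splits the last entry, matching the
    index used in [last_coface]. *)
Lemma sweedler_last (E : lmodType k) n (F : seq C -> E) (c : C) :
  \sum_(d <- sweedler n.+1 c) F d =
  \sum_(d <- sweedler n c) \sum_(p <- pures (comul d`_n)) F (take n d ++ [:: p.1; p.2]).
Proof.
elim: n F c => [|n IH] F c.
  rewrite big_allpairs_dep [RHS]big_seq1.
  by apply: eq_bigr => p _; rewrite big_seq1.
rewrite big_allpairs_dep [RHS]big_allpairs_dep; apply: eq_bigr => p _.
by rewrite (IH (fun d => F (p.1 :: d))).
Qed.
End SweedlerLists.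

Section CupProducts.
Variables (k : fieldType) (H : hopfType k) (M : saydType H).
Variables (C : hmodCoalgType H) (A : hmodAlgType H).

Lemma last_coface_modcoalg_ops n m (c : C) :
  last_coface (modcoalg_ops M C) n (vtens 0 m [:: c]) = \sum_(d <- sweedler n c) vtens n m d.
Proof.
elim: n => [|n IH]; first by rewrite big_seq1.
rewrite [LHS]/= IH linear_sum sweedler_last.
rewrite big_seq [RHS]big_seq; apply: eq_bigr => d /size_sweedler /eqP sz.
apply: (etrans (coalg_coface (modcoalg_ops_formulas M C) m (Tuple sz) (leqnn n))).
by rewrite drop_oversize ?(eqP sz).
Qed.

(** Each coface multiplies the last two factors, which brackets the product from the right as
    [foldr] does. *)
Lemma hat_last_coface_modalg_ops n f m (s : seq A) : size s = n.+1 ->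
  hat (last_coface (modalg_ops M A) n f) (vtens n m s) =
  hat f (vtens 0 m [:: foldr amul aone s]).
Proof.
elim: n s => [|n IH] s; first by case: s => [|a []] //= _; rewrite amul1r.
case/lastP: s => [//|s b]; rewrite size_rcons => -[].
case/lastP: s => [//|s a]; rewrite size_rcons => -[sz].
rewrite [LHS]modalg_ops_coface_vtens ?size_rcons ?sz //.
rewrite nth_rcons size_rcons sz ltnSn nth_rcons sz ltnn eqxx.
rewrite nth_rcons size_rcons sz ltnn eqxx.
rewrite drop_oversize ?size_rcons ?sz // -!cats1 -catA take_size_cat //.
rewrite IH; last by rewrite size_cat sz addn1.
by rewrite !foldr_cat /= !amul1r.
Qed.

Lemma foldr_amul_zip n (act : C -> A -> A) (c : n.+1.-tuple C) (a : n.+1.-tuple A) :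
  foldr amul aone [seq act q.1 q.2 | q <- zip c a] =
  \big[amul/aone]_(i < n.+1) act c`_i a`_i.
Proof.
rewrite foldrE (big_nth 0) big_mkord size_map size_zip !size_tuple minnn.
apply: eq_bigr => i _.
rewrite (nth_map (0, 0)) ?nth_zip ?size_zip ?size_tuple ?minnn //.
Qed.

Variable act : C -> A -> A.
Hypothesis act_CA : coalg_action act.
Variables (XC : cocyclic_ops (coalgC M C)) (XA : cocyclic_ops (algC M A)).
Hypotheses (sC : same_ops XC (modcoalg_ops M C)) (sA : same_ops XA (modalg_ops M A)).

Lemma cup_n0 n : exists Phi : {linear tensor (HC XC n) (HC XA 0) -> usualHC A n},
  forall (z : cocycles XC n) (f : cocycles XA 0),
  exists phi : cocycles (usual_ops A) n,
    Phi (cohomology_class z \ox cohomology_class f) = cohomology_class phi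
    /\ forall s : seq (M * n.+1.-tuple C),
       subspace_val z = \sum_(p <- s) ctens n p.1 p.2 ->
       forall a : n.+1.-tuple A,
         usualC_eval (subspace_val phi) a =
         \sum_(p <- s) algC_eval (subspace_val f) p.1
           [:: \big[amul/aone]_(i < n.+1) act p.2`_i a`_i].
Proof.
have [dC _ tC] := sC; have [dA _ _] := sA.
pose B n x f := cochain_pairing act_CA x (last_coface (modalg_ops M A) n f).
have lBl m y : lin (fun x => B m x y) by exact: lin_cochain_pairingl.
have lBr m x : lin (B m x).
  exact: (lin_compl (@lin_cochain_pairingr _ _ _ _ _ _ act_CA m x) (@lin_last_coface _ _ _ m)).
have dyE y : coface XA 0 0 y = coface XA 0 1 y ->
    coface (modalg_ops M A) 0 0 y = coface (modalg_ops M A) 0 1 y by rewrite !dA.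
have B_coface m i x y : coface XA 0 0 y = coface XA 0 1 y -> (i <= m.+1)%N ->
    B m.+1 (coface XC m i x) y = coface (usual_ops A) m i (B m x y).
  (* As [y] is a 0-cocycle, its next iterated coface is delta_i of the previous one for this very
     [i]. *)
  move=> /dyE dy le_im; rewrite /B dC // -(coface_last_coface (modalg_ops_cocyclic M A) dy le_im).
  exact: cochain_pairing_coface.
have B_cocyc m x y : coface XA 0 0 y = coface XA 0 1 y ->
    B m (cocyc XC m x) y = cocyc (usual_ops A) m (B m x y).
  move=> /dyE dy; rewrite /B tC -{1}(cocyc_last_coface (modalg_ops_cocyclic M A) dy).
  exact: cochain_pairing_cocyc.
have [Phi PhiE] := cohomology_pairing lBl lBr B_coface B_cocyc n.
(* The witness depends on the cocycle [z] and not on a presentation of it, so the formula holds for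
   every [s]. *)
exists Phi => z f; exists (pair_cocycle lBl B_coface B_cocyc z f).
split=> [|s zE a]; first exact: PhiE.
rewrite -[LHS]/(usualC_eval (B n (subspace_val z) (subspace_val f)) a).
rewrite /B cochain_pairingE zE !linear_sum; apply: eq_bigr => p _.
apply: (etrans (congr1 _ (tpact_vtens _ _ _ _ _ _))); rewrite ?size_tuple //.
rewrite hat_last_coface_modalg_ops ?algC_evalE ?foldr_amul_zip //.
by rewrite size_map size_zip !size_tuple minnn.
Qed.

Lemma cup_0n n : exists Phi : {linear tensor (HC XC 0) (HC XA n) -> usualHC A n},
  forall (z : cocycles XC 0) (f : cocycles XA n),
  exists phi : cocycles (usual_ops A) n,
    Phi (cohomology_class z \ox cohomology_class f) = cohomology_class phi
    /\ forall s : seq (M * C),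
       subspace_val z = \sum_(p <- s) ctens 0 p.1 [:: p.2] ->
       forall a : n.+1.-tuple A,
         usualC_eval (subspace_val phi) a =
         \sum_(p <- s) \sum_(d <- sweedler n p.2)
           algC_eval (subspace_val f) p.1 [seq act q.1 q.2 | q <- zip d a].
Proof.
have [dC _ _] := sC; have [dA _ tA] := sA.
pose B n f x := cochain_pairing act_CA (last_coface (modcoalg_ops M C) n x) f.
have lBr m f : lin (fun x => B m f x).
  exact: (lin_compl (@lin_cochain_pairingl _ _ _ _ _ _ act_CA m f) (@lin_last_coface _ _ _ m)).
have lBl m x : lin (fun f => B m f x) by exact: lin_cochain_pairingr.
have dxE x : coface XC 0 0 x = coface XC 0 1 x ->
    coface (modcoalg_ops M C) 0 0 x = coface (modcoalg_ops M C) 0 1 x by rewrite !dC.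
have B_coface m i f x : coface XC 0 0 x = coface XC 0 1 x -> (i <= m.+1)%N ->
    B m.+1 (coface XA m i f) x = coface (usual_ops A) m i (B m f x).
  move=> /dxE dx le_im; rewrite /B dA // -(coface_last_coface (modcoalg_ops_cocyclic M C) dx le_im).
  exact: cochain_pairing_coface.
have B_cocyc m f x : coface XC 0 0 x = coface XC 0 1 x ->
    B m (cocyc XA m f) x = cocyc (usual_ops A) m (B m f x).
  move=> /dxE dx; rewrite /B tA -{1}(cocyc_last_coface (modcoalg_ops_cocyclic M C) dx).
  exact: cochain_pairing_cocyc.
have [Phi PhiE] := cohomology_pairing lBl lBr B_coface B_cocyc n.
(* [cohomology_pairing] takes the degree 0 class second; [Psi] exchanges the two tensor factors. *)
pose Psi t := \sum_(p <- pures t) Phi (p.2 \ox p.1).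
have lPsi : lin Psi by rewrite /Psi; lin_tac.
exists (lin_of lPsi) => z f; exists (pair_cocycle lBl B_coface B_cocyc f z).
split=> [|s zE a]; first by rewrite /= /Psi sum_pures; lin_tac; exact: PhiE.
rewrite -[LHS]/(usualC_eval (B n (subspace_val f) (subspace_val z)) a) /B cochain_pairingE.
rewrite zE (lin_apply_sum _ _ (@lin_last_coface _ _ _ n)) !linear_sum.
apply: eq_bigr => p _; rewrite [last_coface _ _ _]last_coface_modcoalg_ops !linear_sum.
rewrite big_seq [RHS]big_seq; apply: eq_bigr => d /size_sweedler sz.
rewrite algC_evalE; congr (hat _ _).
by apply: tpact_vtens; rewrite ?size_tuple.
Qed.
End CupProducts.

Theorem theorem0p1 (k : fieldType) (H : hopfType k) (Sinv : H -> H)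
    (SK : cancel (antipode : H -> H) Sinv)
    (SinvK : cancel Sinv (antipode : H -> H)) (M : saydType H) :
  [/\ forall C : hmodCoalgType H,
        define_cocyclic_module (@coalg_formulas k H M C),
      forall A : hmodAlgType H,
        define_cocyclic_module (@alg_formulas k H M A Sinv)
    & [pchar k] =i pred0 ->
      forall (C : hmodCoalgType H) (A : hmodAlgType H) (act : C -> A -> A),
      coalg_action act ->
      forall (XC : cocyclic_ops (coalgC M C)) (XA : cocyclic_ops (algC M A)),
      coalg_formulas XC -> alg_formulas Sinv XA ->
      forall n : nat,
        (exists Phi : {linear tensor (HC XC n) (HC XA 0) -> usualHC A n},
          forall (z : cocycles XC n) (f : cocycles XA 0),
          exists phi : cocycles (usual_ops A) n,
            Phi (cohomology_class z \ox cohomology_class f)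
              = cohomology_class phi
            /\ forall s : seq (M * n.+1.-tuple C),
               subspace_val z = \sum_(p <- s) ctens n p.1 p.2 ->
               forall a : n.+1.-tuple A,
                 usualC_eval (subspace_val phi) a =
                 \sum_(p <- s) algC_eval (subspace_val f) p.1
                   [:: \big[amul/aone]_(i < n.+1) act p.2`_i a`_i])
        /\
        (exists Phi : {linear tensor (HC XC 0) (HC XA n) -> usualHC A n},
          forall (z : cocycles XC 0) (f : cocycles XA n),
          exists phi : cocycles (usual_ops A) n,
            Phi (cohomology_class z \ox cohomology_class f)
              = cohomology_class phi
            /\ forall s : seq (M * C),
               subspace_val z = \sum_(p <- s) ctens 0 p.1 [:: p.2] ->
               forall a : n.+1.-tuple A,
                 usualC_eval (subspace_val phi) a =
                 \sum_(p <- s) \sum_(d <- sweedler n p.2)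
                   algC_eval (subspace_val f) p.1
                     [seq act q.1 q.2 | q <- zip d a])].
Proof.
split=> [C|A|_ C A act act_CA XC XA fC fA n].
- exact: coalg_define.
- exact: (alg_define M A SK SinvK).
have sC := coalg_formulas_same fC (modcoalg_ops_formulas M C).
have sA := alg_formulas_same fA (modalg_ops_formulas M A SK SinvK).
by split; [exact: (cup_n0 act_CA sC sA) | exact: (cup_0n act_CA sC sA)].
Qed.
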